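(* Let $N$ be a von Neumann algebra. The assignments $\mathbf{Mod}$ and $\mathbf{End}$ — on objects $A\mapsto\mathbf{Mod}(A)$, $\mathbf C\mapsto\mathbf{End}(\mathbf C)$, and on the categories of morphisms $$\mathbf{Mod}_{(A,B)}:\mathbf W^*_{(N,N^{op})}(A,B)\to\mathbf{Cat}_{(N,N^{op})}(\mathbf{Mod}(B),\mathbf{Mod}(A)),\quad \phi\mapsto\phi^*,\ \ b\mapsto(\pi(b))_{(L,\pi)},$$ $$\mathbf{End}_{(\mathbf C,\mathbf D)}:\mathbf{Cat}_{(N,N^{op})}(\mathbf C,\mathbf D)\to\mathbf W^*_{(N,N^{op})}(\mathbf{End}(\mathbf D),\mathbf{End}(\mathbf C)),\quad \mathbf F\mapsto\rho^{\mathbf FG_{\mathbf C}},\ \ \alpha\mapsto\mathbf H_{\mathbf D}(\alpha_{G_{\mathbf C}})$$ — define contravariant functors $\mathbf{Mod}:\mathbf W^*_{(N,N^{op})}\to\mathbf{Cat}_{(N,N^{op})}$ and $\mathbf{End}:\mathbf{Cat}_{(N,N^{op})}\to\mathbf W^*_{(N,N^{op})}$ of enriched categories (enriched over the monoidal category of small categories, i.e. of 2-categories). Moreover, the isomorphisms of categories $$\Phi_{\mathbf C,A}:\mathbf{Cat}_{(N,N^{op})}(\mathbf C,\mathbf{Mod}(A))\to\mathbf W^*_{(N,N^{op})}(A,\mathbf{End}(\mathbf C)),$$ defined by $\mathbf FG_{\mathbf C}=(\mathbf H_{\mathbf C}G_{\mathbf C},\Phi_{\mathbf C,A}(\mathbf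 F))$ for functors $\mathbf F$ and $\Phi_{\mathbf C,A}(\alpha)=\alpha_{G_{\mathbf C}}$ for natural transformations $\alpha$, define an adjunction whose unit is $(\eta_{\mathbf C})_{\mathbf C\in\mathbf{Cat}_{(N,N^{op})}}$ and whose counit is $(\epsilon_A)_{A\in\mathbf W^*_{(N,N^{op})}}$. Here $\eta_{\mathbf C}:\mathbf C\to\mathbf{Mod}(\mathbf{End}(\mathbf C))$ is the functor $X\mapsto(\mathbf H_{\mathbf C}X,\rho^X)$, $T\mapsto\mathbf H_{\mathbf C}T$, and $\epsilon_A=\rho^{\mathrm{id}_A}:\mathbf{End}(\mathbf{Mod}(A))\to A$ is the isomorphism obtained by considering the identity representation $\mathrm{id}_A$ as an object of $\mathbf{Mod}(A)$; it is inverse to $\Phi_{\mathbf{Mod}(A),A}(\mathrm{id}_{\mathbf{Mod}(A)})$.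
   Context: (Size issues are ignored; e.g. fix a universe.) $\mathbf W^*\text{-}\mathbf{mod}_{(N,N^{op})}$ is the category of all $N$-bimodules, i.e. of Hilbert spaces $H$ with a normal unital representation $\rho$ and a normal unital antirepresentation $\sigma$ of $N$ with commuting ranges; morphisms are the bounded operators intertwining both. A subcategory of it is called a $*$-subcategory if it is closed with respect to the involution $T\mapsto T^*$ of morphisms. $\mathbf W^*_{(N,N^{op})}$: objects are von Neumann algebras $A$ (acting on a Hilbert space) with a normal unital embedding $\iota_A:N\to A$ and a normal unital anti-embedding $\iota_A^{op}:N\to A$ with commuting ranges; 1-morphisms are normal unital $*$-homomorphisms preserving the (anti-)embeddings; a 2-morphism $b:\phi\Rightarrow\psi$ between $\phi,\psi:A\to B$ is $b\in B$ with $b\phi(a)=\psi(a)b$ for all $a\in A$; 2-morphisms between fixed $A,B$ compose by multiplication, and for $b:\phi_1\Rightarrow\phi_2:A\to B$ and $c:\psi_1\Rightarrow\psi_2:B\to C$ the horizontal composite is $\psi_2(b)c:\psi_1\phi_1\Rightarrow\psi_2\phi_2$. $\mathbf{Cat}_{(N,N^{op})}$: objects are categories $\mathbf C$ equipped with a functor $\mathbf U_{\mathbf C}:\mathbf C\to\mathbf W^*\text{-}\mathbf{mod}_{(N,N^{op})}$ such that $\mathbf U_{\mathbf C}\mathbf C$ is a $*$-subcategory of $\mathbf W^*\text{-}\mathbf{mod}_{(N,N^{op})}$, and having a separating object, i.e. an object $G$ such that for each $X\in\mathbf C$ the closed linear span of $\mathbf H_{\mathbf C}(\mathbf C(G,X))(\mathbf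 H_{\mathbf C}G)$ is $\mathbf H_{\mathbf C}X$; here $\mathbf H_{\mathbf C}$ is $\mathbf U_{\mathbf C}$ followed by the forgetful functor to Hilbert spaces and bounded operators. 1-morphisms are functors $\mathbf F:\mathbf C\to\mathbf D$ with $\mathbf U_{\mathbf D}\mathbf F=\mathbf U_{\mathbf C}$; 2-morphisms are all natural transformations, with the usual vertical composition and horizontal composition $\beta_{\mathbf F_2}\circ\mathbf G_1\alpha$ for $\alpha:\mathbf F_1\Rightarrow\mathbf F_2$, $\beta:\mathbf G_1\Rightarrow\mathbf G_2$. $\mathbf{Mod}(A)$ is the category of normal unital representations $\pi:A\to\mathcal L(L)$ with $\pi\circ\iota_A$, $\pi\circ\iota_A^{op}$ faithful, with all intertwiners, and $\mathbf U_A(L,\pi)=(L,\pi\circ\iota_A,\pi\circ\iota_A^{op})$, $\mathbf U_A(T)=T$. For $\phi:A\to B$, $\phi^*:\mathbf{Mod}(B)\to\mathbf{Mod}(A)$ is $(L,\pi)\mapsto(L,\pi\circ\phi)$, $T\mapsto T$. For each $\mathbf C\in\mathbf{Cat}_{(N,N^{op})}$ a separating object $G_{\mathbf C}$ is chosen; with $\mathbf U_{\mathbf C}G_{\mathbf C}=(\mathbf H_{\mathbf C}G_{\mathbf C},\rho,\sigma)$, put $\mathbf{End}(\mathbf C)=\mathbf H_{\mathbf C}(\mathbf C(G_{\mathbf C},G_{\mathbf C}))'\subseteq\mathcal L(\mathbf H_{\mathbf C}G_{\mathbf C})$ (commutant), considered as an object of $\mathbf W^*_{(N,N^{op})}$ with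 respect to $\rho,\sigma$. For $X\in\mathbf C$, $\rho^X:\mathbf{End}(\mathbf C)\to\mathcal L(\mathbf H_{\mathbf C}X)$ is the normal unital $*$-homomorphism determined by $\rho^X(S)\,\mathbf H_{\mathbf C}(T)=\mathbf H_{\mathbf C}(T)\,S$ for all $S\in\mathbf{End}(\mathbf C)$, $T\in\mathbf C(G_{\mathbf C},X)$. A contravariant functor between enriched categories consists of an assignment on objects and, for each pair of objects $X,Y$, a functor from the category of morphisms $X\to Y$ to the category of morphisms between the images in the reverse direction, compatible with composition in the natural sense.
   Formalization: Objects of Cat are also required to have faithful left and right N-actions (else End(C) or η_C is undefined, e.g. the zero bimodule), and the *-subcategory condition is read hom-wise: the adjoint of U(T), T in C(X,Y), is U(T') for some T' in C(Y,X). *)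

(* Defs.v *)
From HB Require Import structures.
From mathcomp Require Import all_boot all_order all_algebra.
From mathcomp Require Import all_classical all_reals all_analysis.
From mathcomp Require Import complex.

Set Implicit Arguments.
Unset Strict Implicit.
Unset Printing Implicit Defensive.

Import Order.TTheory GRing.Theory Num.Theory.
Import numFieldNormedType.Exports.

Local Open Scope classical_set_scope.
Local Open Scope ring_scope.

Record category := Category {
  obj :> Type;
  mor : obj -> obj -> Type;
  idm : forall X, mor X X;
  compm : forall X Y Z, mor Y Z -> mor X Y -> mor X Z;
  compm1 : forall X Y (f : mor X Y), compm f (idm X) = f;
  comp1m : forall X Y (f : mor X Y), compm (idm Y) f = f;
  compmA : forall X Y Z W (h : mor Z W) (g : mor Y Z) (f : mor X Y),
    compm h (compm g f) = compm (compm h g) f }.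

Arguments mor {_} _ _.
Arguments idm {_} _.
Arguments compm {_ _ _ _} _ _.

Record functor (C D : category) := Functor {
  fob :> C -> D;
  fmor : forall X Y : C, mor X Y -> mor (fob X) (fob Y);
  fmor1 : forall X, fmor (idm X) = idm (fob X);
  fmorM : forall (X Y Z : C) (g : mor Y Z) (f : mor X Y),
    fmor (compm g f) = compm (fmor g) (fmor f) }.

Arguments fmor {_ _} _ {_ _} _.

Definition morcast (C : category) (X X' Y Y' : C) (eX : X = X') (eY : Y = Y')
    (f : mor X Y) : mor X' Y' :=
  match eX in _ = x, eY in _ = y return mor x y with erefl, erefl => f end.

Lemma functor_ext (C D : category) (F G : functor C D)
    (e : forall X, F X = G X) :
  (forall X Y (f : mor X Y), morcast (e X) (e Y) (fmor F f) = fmor G f) ->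
  F = G.
Proof.
case: F G e => [F f F1 FM] [G g G1 GM] /= e.
have eFG : F = G by apply/funext.
subst G => H.
have efg : f = g.
  apply: functional_extensionality_dep => X.
  apply: functional_extensionality_dep => Y.
  apply: functional_extensionality_dep => u.
  by rewrite -H (Prop_irrelevance (e X) erefl) (Prop_irrelevance (e Y) erefl).
subst g; congr Functor; exact: Prop_irrelevance.
Qed.

Section BasicFunctors.

Definition idF (C : category) : functor C C.
Proof. by exists id (fun _ _ f => f). Defined.

(* [compF F G] is [F] followed by [G]. *)
Definition compF (C D E : category) (F : functor C D) (G : functor D E) :
  functor C E.
Proof.
exists (fun X => G (F X)) (fun _ _ f => fmor G (fmor F f)).
- by move=> X; rewrite !fmor1.
- by move=> X Y Z g f; rewrite !fmorM.
Defined.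

Definition prodC (C D : category) : category.
Proof.
exists (obj C * obj D)%type
  (fun X Y => (mor X.1 Y.1 * mor X.2 Y.2)%type)
  (fun X => (idm X.1, idm X.2))
  (fun X Y Z g f => (compm g.1 f.1, compm g.2 f.2)).
- by move=> X Y [f g] /=; rewrite !compm1.
- by move=> X Y [f g] /=; rewrite !comp1m.
- by move=> X Y Z W h g f /=; rewrite !compmA.
Defined.

Definition prodF (C C' D D' : category) (F : functor C D) (F' : functor C' D') :
  functor (prodC C C') (prodC D D').
Proof.
exists ((fun X => (F X.1, F' X.2)) : prodC C C' -> prodC D D')
  (fun X Y (f : @mor (prodC C C') X Y) => (fmor F f.1, fmor F' f.2)).
- by move=> X /=; rewrite !fmor1.
- by move=> X Y Z g f /=; rewrite !fmorM.
Defined.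

Definition swapF (C D : category) : functor (prodC C D) (prodC D C).
Proof.
by exists ((fun X => (X.2, X.1)) : prodC C D -> prodC D C)
  (fun X Y (f : @mor (prodC C D) X Y) => (f.2, f.1)).
Defined.

Definition assocF (C D E : category) :
  functor (prodC (prodC C D) E) (prodC C (prodC D E)).
Proof.
by exists ((fun X => (X.1.1, (X.1.2, X.2))) :
      prodC (prodC C D) E -> prodC C (prodC D E))
  (fun X Y (f : @mor (prodC (prodC C D) E) X Y) => (f.1.1, (f.1.2, f.2))).
Defined.

Definition pairlF (C D : category) (X : C) : functor D (prodC C D).
Proof.
exists ((fun Y => (X, Y)) : D -> prodC C D)
  (fun Y Z (f : @mor D Y Z) => (idm X, f)) => //.
by move=> Y Z W g f /=; rewrite comp1m.
Defined.

Definition pairrF (C D : category) (X : D) : functor C (prodC C D).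
Proof.
exists ((fun Y => (Y, X)) : C -> prodC C D)
  (fun Y Z (f : @mor C Y Z) => (f, idm X)) => //.
by move=> Y Z W g f /=; rewrite comp1m.
Defined.

End BasicFunctors.

Definition is_iso_cat (C D : category) (F : functor C D) : Prop :=
  exists G : functor D C, compF F G = idF C /\ compF G F = idF D.

(* Categories enriched over small categories; [tcomp A B C] is composition in
   diagrammatic order, horizontal composition being its effect on morphisms. *)
Record twocat := TwoCat {
  tobj :> Type;
  thom : tobj -> tobj -> category;
  tid : forall A, thom A A;
  tcomp : forall A B C, functor (prodC (thom A B) (thom B C)) (thom A C);
  tcomp1l : forall A B, compF (pairlF (thom A B) (tid A)) (tcomp A A B) = idF _;
  tcomp1r : forall A B, compF (pairrF (thom A B) (tid B)) (tcomp A B B) = idF _;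
  tcompA : forall A B C D,
    compF (prodF (tcomp A B C) (idF (thom C D))) (tcomp A C D) =
    compF (assocF _ _ _)
      (compF (prodF (idF (thom A B)) (tcomp B C D)) (tcomp A B D)) }.

Arguments thom {_} _ _.
Arguments tid {_} _.
Arguments tcomp {_} _ _ _.

Definition is_contra2functor (X Y : twocat) (F0 : X -> Y)
    (F1 : forall A B, functor (thom A B) (thom (F0 B) (F0 A))) : Prop :=
  (forall A, F1 A A (tid A) = tid (F0 A)) /\
  (forall A B C,
     compF (tcomp A B C) (F1 A C) =
     compF (prodF (F1 A B) (F1 B C))
       (compF (swapF _ _) (tcomp (F0 C) (F0 B) (F0 A)))).

(* For contravariant [E : X -> Y] and [M : Y -> X], an adjunction in hom-set
   form: isomorphisms of categories [X(C, M A) ~ Y(A, E C)], natural (in the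
   enriched sense, hence on 1- and 2-cells) in [C] and in [A], such that the unit
   [eta_C : C -> M (E C)] corresponds to the identity of [E C], and the counit
   [A -> E (M A)] (that is, [E (M A) -> A] in the opposite of [Y]) is the image
   of the identity of [M A]; the last two conditions are the triangle
   identities. *)
Definition is_contra2adjunction (X Y : twocat)
    (E0 : X -> Y) (E1 : forall C D, functor (thom C D) (thom (E0 D) (E0 C)))
    (M0 : Y -> X) (M1 : forall A B, functor (thom A B) (thom (M0 B) (M0 A)))
    (Phi : forall C A, functor (thom C (M0 A)) (thom A (E0 C)))
    (eta : forall C, thom C (M0 (E0 C)))
    (counit : forall A, thom A (E0 (M0 A))) : Prop :=
  [/\ forall C A, is_iso_cat (Phi C A),
      (forall C' C A,
        compF (tcomp C' C (M0 A)) (Phi C' A) =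
        compF (prodF (E1 C' C) (Phi C A))
          (compF (swapF _ _) (tcomp A (E0 C) (E0 C')))) /\
      (forall C B A,
        compF (prodF (idF (thom C (M0 B))) (M1 A B))
          (compF (tcomp C (M0 B) (M0 A)) (Phi C A)) =
        compF (prodF (Phi C B) (idF (thom A B)))
          (compF (swapF _ _) (tcomp A B (E0 C)))),
      forall C, Phi C (E0 C) (eta C) = tid (E0 C),
      forall A, Phi (M0 A) A (tid (M0 A)) = counit A &
      (forall A, tcomp _ _ _ (eta (M0 A), M1 _ _ (counit A)) = tid (M0 A)) /\
      (forall C, tcomp _ _ _ (counit (E0 C), E1 _ _ (eta C)) = tid (E0 C))].

Definition Cx (R : realType) : numClosedFieldType := R[i].

Record hilbert (R : realType) := Hilbert {
  hilbert_mod :> completeNormedModType (Cx R);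
  ip : {dot hilbert_mod for @Num.conj (Cx R)};
  ip_norm : forall x, ip x x = `|x| ^+ 2 }.

Arguments ip {R h} : rename.

Record bop (R : realType) (H K : hilbert R) := Bop {
  bop_fun :> H -> K;
  bop_linear : linear bop_fun;
  bop_continuous : continuous bop_fun }.

HB.instance Definition _ (R : realType) (H K : hilbert R) (T : bop H K) :=
  GRing.isLinear.Build (Cx R) H K *:%R (bop_fun T) (@bop_linear R H K T).

HB.instance Definition _ (R : realType) (H K : hilbert R) :=
  gen_eqMixin (bop H K).
HB.instance Definition _ (R : realType) (H K : hilbert R) :=
  gen_choiceMixin (bop H K).

Section Operators.
Variable R : realType.
Implicit Types H K L : hilbert R.

Lemma bop_ext H K (S T : bop H K) : (forall x, S x = T x) -> S = T.
Proof.
case: S T => [S s s'] [T t t'] /= /funext E; subst T.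
by congr Bop; exact: Prop_irrelevance.
Qed.

Definition bzero H K : bop H K.
Proof.
exists (fun=> 0) => [a x y|]; first by rewrite scaler0 addr0.
exact: cst_continuous.
Defined.

Definition badd H K (S T : bop H K) : bop H K.
Proof.
exists (fun x => S x + T x) => [a x y|x]; first by rewrite !linearP scalerDr addrACA.
by apply: cvgD; exact: bop_continuous.
Defined.

Definition bopp H K (S : bop H K) : bop H K.
Proof.
exists (fun x => - S x) => [a x y|x]; first by rewrite linearP opprD scalerN.
by apply: cvgN; exact: bop_continuous.
Defined.

Definition bscale H K (k : Cx R) (S : bop H K) : bop H K.
Proof.
exists (fun x => k *: S x) => [a x y|x].
  by rewrite linearP scalerDr !scalerA mulrC.
by apply: cvgZl_tmp; exact: bop_continuous.
Defined.

Definition bid H : bop H H.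
Proof. by exists id => // x; exact: cvg_id. Defined.

Definition bcomp H K L (S : bop K L) (T : bop H K) : bop H L.
Proof.
exists (fun x => S (T x)) => [a x y|x]; first by rewrite !linearP.
by apply: continuous_comp; exact: bop_continuous.
Defined.

Fact baddA H K : associative (@badd H K).
Proof. by move=> S T U; apply: bop_ext => x /=; rewrite addrA. Qed.
Fact baddC H K : commutative (@badd H K).
Proof. by move=> S T; apply: bop_ext => x /=; rewrite addrC. Qed.
Fact badd0 H K : left_id (bzero H K) (@badd H K).
Proof. by move=> S; apply: bop_ext => x /=; rewrite add0r. Qed.
Fact baddN H K : left_inverse (bzero H K) (@bopp H K) (@badd H K).
Proof. by move=> S; apply: bop_ext => x /=; rewrite addNr. Qed.

HB.instance Definition _ H K :=
  GRing.isZmodule.Build (bop H K) (@baddA H K) (@baddC H K) (@badd0 H K)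
    (@baddN H K).

Fact bscaleA H K (a b : Cx R) (S : bop H K) :
  bscale a (bscale b S) = bscale (a * b) S.
Proof. by apply: bop_ext => x /=; rewrite scalerA. Qed.
Fact bscale1 H K : left_id 1 (@bscale H K).
Proof. by move=> S; apply: bop_ext => x /=; rewrite scale1r. Qed.
Fact bscaleDr H K : right_distributive (@bscale H K) +%R.
Proof. by move=> a S T; apply: bop_ext => x /=; rewrite scalerDr. Qed.
Fact bscaleDl H K (S : bop H K) : {morph (@bscale H K)^~ S : a b / a + b}.
Proof. by move=> a b; apply: bop_ext => x /=; rewrite scalerDl. Qed.

HB.instance Definition _ H K :=
  GRing.Zmodule_isLmodule.Build (Cx R) (bop H K) (@bscaleA H K) (@bscale1 H K)
    (@bscaleDr H K) (@bscaleDl H K).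

(* [T] is the adjoint of [S]; by the Riesz theorem every operator has exactly
   one. *)
Definition is_adjoint H K (S : bop H K) (T : bop K H) : Prop :=
  forall x y, ip (S x) y = ip x (T y).

Definition lspan H (A : set H) : set H :=
  [set v | exists n (k : 'I_n -> Cx R) (x : 'I_n -> H),
     (forall i, A (x i)) /\ v = \sum_(i < n) k i *: x i].

Definition bopcast H H' K K' (eH : H = H') (eK : K = K') (T : bop H K) :
    bop H' K' :=
  match eH in _ = h, eK in _ = k return bop h k with erefl, erefl => T end.

End Operators.

Arguments bid {R} H.
Notation "S *b T" := (bcomp S T) (at level 40, left associativity) : ring_scope.

Section OperatorLemmas.
Variable R : realType.
Implicit Types H K L : hilbert R.

Lemma bcompA H K L M (S : bop L M) (T : bop K L) (U : bop H K) :
  S *b (T *b U) = S *b T *b U.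
Proof. exact: bop_ext. Qed.

Lemma bcomp1 H K (S : bop H K) : S *b bid H = S.
Proof. exact: bop_ext. Qed.

Lemma bcomp1l H K (S : bop H K) : bid K *b S = S.
Proof. exact: bop_ext. Qed.

Lemma ipC H (x y : H) : ip y x = (ip x y)^*.
Proof. by rewrite [LHS]hermC expr0 mul1r. Qed.

Lemma is_adjoint_sym H K (S : bop H K) (T : bop K H) :
  is_adjoint S T -> is_adjoint T S.
Proof. by move=> ST x y; rewrite ipC -ST -ipC. Qed.

End OperatorLemmas.

Section VonNeumann.
Variable R : realType.
Implicit Types H K L : hilbert R.

Definition commutant H (M : set (bop H H)) : set (bop H H) :=
  [set S | forall T, M T -> S *b T = T *b S].

Definition star_closed H (M : set (bop H H)) : Prop :=
  forall S T, is_adjoint S T -> M S -> M T.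

Record vnalg := VNAlg {
  vn_space : hilbert R;
  vn_set :> set (bop vn_space vn_space);
  vn_star : star_closed vn_set;
  vn_bicommutant : commutant (commutant vn_set) = vn_set }.

(* The sigma-weak topology is the initial topology for the functionals
   [T |-> \sum_n <T x_n, y_n>] with [x], [y] square-summable. *)
Record l2seq H := L2Seq {
  l2val :> nat -> H;
  l2_summable : cvgn (series (fun n => `|l2val n| ^+ 2)) }.

Definition sw_functional H (x y : l2seq H) (T : bop H H) : Cx R :=
  limn (series (fun n => ip (T (x n)) (y n))).

Definition sw_eval H (T : bop H H) :
    prod_topology (fun _ : l2seq H * l2seq H => Cx R) :=
  fun p => sw_functional p.1 p.2 T.

Definition sigma_weak (S : choiceType) H (v : S -> bop H H) : topologicalType :=
  initial_topology (fun s => sw_eval (v s)).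

Definition normal (M : vnalg) K (f : M -> bop K K) : Prop :=
  continuous (f : sigma_weak (fun a : M => \val a) -> sigma_weak (@id (bop K K))).

Definition is_repr (M : vnalg) K (f : M -> bop K K) : Prop :=
  [/\ forall k (a b c : M),
        \val c = k *: \val a + \val b -> f c = k *: f a + f b,
      forall a b c : M, \val c = \val a *b \val b -> f c = f a *b f b,
      forall a b : M, is_adjoint (\val a) (\val b) -> is_adjoint (f a) (f b),
      forall e : M, \val e = bid (vn_space M) -> f e = bid K &
      normal f].

Definition is_antirepr (M : vnalg) K (f : M -> bop K K) : Prop :=
  [/\ forall k (a b c : M),
        \val c = k *: \val a + \val b -> f c = k *: f a + f b,
      forall a b c : M, \val c = \val a *b \val b -> f c = f b *b f a,
      forall a b : M, is_adjoint (\val a) (\val b) -> is_adjoint (f a) (f b),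
      forall e : M, \val e = bid (vn_space M) -> f e = bid K &
      normal f].

End VonNeumann.

Arguments vn_set {R} _ _.

Section VonNeumannLemmas.
Variable R : realType.
Implicit Types (H K : hilbert R) (M : vnalg R).

Lemma commutant_sub H (A B : set (bop H H)) :
  A `<=` B -> commutant B `<=` commutant A.
Proof. by move=> AB S HS T /AB; exact: HS. Qed.

Lemma commutant3 H (A : set (bop H H)) :
  commutant (commutant (commutant A)) = commutant A.
Proof.
apply/seteqP; split; last by move=> S HS T HT; rewrite HT.
by apply: commutant_sub => S HS T HT; rewrite HT.
Qed.

Lemma star_closed_commutant H (A : set (bop H H)) :
  (forall S, A S -> exists2 T, is_adjoint S T & A T) ->
  star_closed (commutant A).
Proof.
move=> Astar S S' SS' HS T /[dup] AT /Astar[T' TT' AT'].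
have E := HS _ AT'.
apply: bop_ext => y /=.
apply/eqP; rewrite -subr_eq0; set v := _ - _.
have vx x : ip x v = 0.
  rewrite linearB /= -SS' -(is_adjoint_sym TT') -(is_adjoint_sym TT') -SS'.
  have -> : S (T' x) = T' (S x) by have /(congr1 (fun f : bop H H => f x)) := E.
  by rewrite subrr.
by have := vx v; rewrite ip_norm => /eqP; rewrite expf_eq0 /= normr_eq0.
Qed.

Lemma vn_in M (a : M) : vn_set M (\val a).
Proof. exact: set_valP. Qed.

Lemma vn_set1 M : vn_set M (bid (vn_space M)).
Proof. by rewrite -(vn_bicommutant M) => T _; rewrite bcomp1 bcomp1l. Qed.

Lemma vn_setM M S T : vn_set M S -> vn_set M T -> vn_set M (S *b T).
Proof.
move=> MS MT; rewrite -(vn_bicommutant M) => U HU.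
by rewrite -bcompA -(HU _ MT) !bcompA (HU _ MS).
Qed.

Definition vone M : M := SigSub (mem_set (@vn_set1 M)).

Definition vmul M (a b : M) : M :=
  SigSub (mem_set (vn_setM (vn_in a) (vn_in b))).

Lemma vmulE M (a b : M) : \val (vmul a b) = \val a *b \val b.
Proof. by []. Qed.

Lemma val_repr M : is_repr (fun a : M => \val a).
Proof.
split => //.
apply: continuous_comp_initial.
exact: (@initial_continuous _ _ (fun a : M => sw_eval (\val a))).
Qed.

Lemma normal_comp M M' K (f : M -> M') (g : M' -> bop K K) :
  normal (fun a => \val (f a)) -> normal g -> normal (fun a => g (f a)).
Proof.
move=> nf ng.
have cf : continuous (f : sigma_weak (fun a : M => \val a) ->
                          sigma_weak (fun a : M' => \val a)).
  apply: continuous_comp_initial => a.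
  have cw : continuous (@sw_eval R (vn_space M') : sigma_weak id -> _).
    exact: initial_continuous.
  exact: (continuous_comp (nf a) (cw _)).
by move=> a; exact: (continuous_comp (cf a) (ng (f a))).
Qed.

End VonNeumannLemmas.

Section WStar.
Variables (R : realType) (N : vnalg R).

Record wobj := WObj {
  w_alg :> vnalg R;
  w_emb : N -> w_alg;
  w_op : N -> w_alg;
  w_ax : [/\ is_repr (fun n => \val (w_emb n)) /\ injective w_emb,
             is_antirepr (fun n => \val (w_op n)) /\ injective w_op &
             forall m n, \val (w_emb m) *b \val (w_op n) =
                         \val (w_op n) *b \val (w_emb m)] }.

Record wmor (A B : wobj) := WMor {
  wm_fun :> A -> B;
  wm_ax : [/\ is_repr (fun a => \val (wm_fun a)),
              forall n, wm_fun (w_emb A n) = w_emb B n &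
              forall n, wm_fun (w_op A n) = w_op B n] }.

Lemma wmor_ext A B (f g : wmor A B) : (forall a, f a = g a) -> f = g.
Proof.
case: f g => [f Hf] [g Hg] /= /funext E; subst g.
by congr WMor; exact: Prop_irrelevance.
Qed.

Record w2cell A B (f g : wmor A B) := W2Cell {
  w2_val :> B;
  w2_ax : forall a, \val w2_val *b \val (f a) = \val (g a) *b \val w2_val }.

Lemma w2cell_ext A B (f g : wmor A B) (b c : w2cell f g) :
  \val (w2_val b) = \val (w2_val c) -> b = c.
Proof.
case: b c => [b Hb] [c Hc] /= /val_inj E; subst c.
by congr W2Cell; exact: Prop_irrelevance.
Qed.

Definition w2id A B (f : wmor A B) : w2cell f f.
Proof. by exists (vone B) => a; rewrite /= bcomp1 bcomp1l. Defined.

Definition w2comp A B (f g h : wmor A B) (c : w2cell g h) (b : w2cell f g) :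
  w2cell f h.
Proof.
exists (vmul c b) => a.
by rewrite !vmulE -bcompA (w2_ax b) !bcompA (w2_ax c).
Defined.

Definition whom (A B : wobj) : category.
Proof.
exists (wmor A B) (@w2cell A B) (@w2id A B) (@w2comp A B).
- by move=> f g b; apply: w2cell_ext; rewrite /= bcomp1.
- by move=> f g b; apply: w2cell_ext; rewrite /= bcomp1l.
- by move=> f g h k d c b; apply: w2cell_ext; rewrite /= bcompA.
Defined.

Definition wmor_id (A : wobj) : wmor A A.
Proof. by exists id; split=> //; exact: val_repr. Defined.

Lemma repr_comp (M M' : vnalg R) (K : hilbert R) (f : M -> M')
    (g : M' -> bop K K) :
  is_repr (fun a => \val (f a)) -> is_repr g -> is_repr (fun a => g (f a)).
Proof.
move=> [f1 f2 f3 f4 f5] [g1 g2 g3 g4 g5]; split.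
- by move=> k a b c /f1/g1.
- by move=> a b c /f2/g2.
- by move=> a b /f3/g3.
- by move=> e /f4/g4.
- exact: normal_comp.
Qed.

Lemma antirepr_comp (M M' : vnalg R) (K : hilbert R) (f : M -> M')
    (g : M' -> bop K K) :
  is_antirepr (fun a => \val (f a)) -> is_repr g ->
  is_antirepr (fun a => g (f a)).
Proof.
move=> [f1 f2 f3 f4 f5] [g1 g2 g3 g4 g5]; split.
- by move=> k a b c /f1/g1.
- by move=> a b c /f2/g2.
- by move=> a b /f3/g3.
- by move=> e /f4/g4.
- exact: normal_comp.
Qed.

Lemma reprM (M : vnalg R) (K : hilbert R) (g : M -> bop K K) (a b : M) :
  is_repr g -> g (vmul a b) = g a *b g b.
Proof. by case=> _ g2 _ _ _; exact: g2. Qed.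

Lemma repr1 (M : vnalg R) (K : hilbert R) (g : M -> bop K K) :
  is_repr g -> g (vone M) = bid K.
Proof. by case=> _ _ _ g4 _; exact: g4. Qed.

Definition wmor_comp (A B C : wobj) (f : wmor A B) (g : wmor B C) : wmor A C.
Proof.
exists (fun a => g (f a)).
have [f1 f2 f3] := wm_ax f; have [g1 g2 g3] := wm_ax g; split.
- exact: (repr_comp f1 g1).
- by move=> n; rewrite f2.
- by move=> n; rewrite f3.
Defined.

Lemma wmorM (A B : wobj) (f : wmor A B) (a b : A) :
  \val (f (vmul a b)) = \val (f a) *b \val (f b).
Proof. by have [f1 _ _] := wm_ax f; exact: (reprM _ _ f1). Qed.

Lemma wmor1 (A B : wobj) (f : wmor A B) : \val (f (vone A)) = bid _.
Proof. by have [f1 _ _] := wm_ax f; exact: (repr1 f1). Qed.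

(* For [b : f1 => f2] and [c : g1 => g2], the horizontal composite [g2(b) c]. *)
Definition whcomp (A B C : wobj) (f1 f2 : wmor A B) (g1 g2 : wmor B C)
    (b : w2cell f1 f2) (c : w2cell g1 g2) : w2cell (wmor_comp f1 g1) (wmor_comp f2 g2).
Proof.
exists (vmul (g2 b) c) => a /=.
rewrite -bcompA (w2_ax c) !bcompA -!wmorM; congr (\val (g2 _) *b _).
by apply: val_inj; exact: (w2_ax b).
Defined.

Definition wcompF (A B C : wobj) :
  functor (prodC (whom A B) (whom B C)) (whom A C).
Proof.
exists ((fun fg => wmor_comp fg.1 fg.2) :
    obj (prodC (whom A B) (whom B C)) -> whom A C)
  (fun X Y (bc : @mor (prodC (whom A B) (whom B C)) X Y) =>
     whcomp bc.1 bc.2).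
- by move=> [f g]; apply: w2cell_ext; rewrite /= bcomp1 wmor1.
- move=> [f1 g1] [f2 g2] [f3 g3] [b' c'] [b c]; apply: w2cell_ext => /=.
  by rewrite wmorM -!bcompA; congr (_ *b _); rewrite !bcompA (w2_ax c').
Defined.

Lemma w2castE A B (f f' g g' : whom A B) (ef : f = f') (eg : g = g')
    (b : mor f g) : w2_val (morcast ef eg b) = w2_val b.
Proof. by subst f' g'. Qed.

Definition WStar : twocat.
Proof.
exists wobj whom wmor_id wcompF.
- move=> A B; apply: functor_ext => [f|e f g b]; first exact: wmor_ext.
  by apply: w2cell_ext; rewrite w2castE /= wmor1 bcomp1l.
- move=> A B; apply: functor_ext => [f|e f g b]; first exact: wmor_ext.
  by apply: w2cell_ext; rewrite w2castE /= bcomp1.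
- move=> A B C D; apply: functor_ext => [f|e f g b]; first exact: wmor_ext.
  by apply: w2cell_ext; rewrite w2castE /= wmorM bcompA.
Defined.

End WStar.

Section CatN.
Variables (R : realType) (N : vnalg R).

Record bimod := Bimod {
  bm_space : hilbert R;
  bm_l : N -> bop bm_space bm_space;
  bm_r : N -> bop bm_space bm_space;
  bm_ax : [/\ is_repr bm_l, is_antirepr bm_r &
              forall m n, bm_l m *b bm_r n = bm_r n *b bm_l m] }.

Record bimor (H K : bimod) := BiMor {
  bi_op : bop (bm_space H) (bm_space K);
  bi_ax : (forall n, bi_op *b bm_l H n = bm_l K n *b bi_op) /\
          (forall n, bi_op *b bm_r H n = bm_r K n *b bi_op) }.

Lemma bimor_ext H K (S T : bimor H K) : bi_op S = bi_op T -> S = T.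
Proof.
case: S T => [S HS] [T HT] /= E; subst T.
by congr BiMor; exact: Prop_irrelevance.
Qed.

Definition bi_id H : bimor H H.
Proof. by exists (bid _); split=> n; rewrite bcomp1 bcomp1l. Defined.

Definition bi_comp H K L (S : bimor K L) (T : bimor H K) : bimor H L.
Proof.
exists (bi_op S *b bi_op T).
have [S1 S2] := bi_ax S; have [T1 T2] := bi_ax T.
by split=> n; rewrite -bcompA ?T1 ?T2 bcompA ?S1 ?S2 bcompA.
Defined.

Definition Wmod : category.
Proof.
exists bimod bimor bi_id bi_comp.
- by move=> H K S; apply: bimor_ext; rewrite /= bcomp1.
- by move=> H K S; apply: bimor_ext; rewrite /= bcomp1l.
- by move=> H K L M U S T; apply: bimor_ext; rewrite /= bcompA.
Defined.

Lemma bimod_ext (H : hilbert R) (l l' r r' : N -> bop H H) e e' :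
  (forall n, l n = l' n) -> (forall n, r n = r' n) ->
  @Bimod H l r e = @Bimod H l' r' e'.
Proof.
move=> /funext El /funext Er; subst l' r'; congr Bimod; exact: Prop_irrelevance.
Qed.

Lemma bi_op_cast (H H' K K' : Wmod) (eH : H = H') (eK : K = K') (T : mor H K) :
  bi_op (morcast eH eK T) =
  bopcast (congr1 bm_space eH) (congr1 bm_space eK) (bi_op T).
Proof. by subst H' K'. Qed.

Lemma bopcast_id (H K : hilbert R) (eH : H = H) (eK : K = K) (T : bop H K) :
  bopcast eH eK T = T.
Proof. by rewrite (Prop_irrelevance eH erefl) (Prop_irrelevance eK erefl). Qed.

Record ccat := CCat {
  cc_cat :> category;
  cc_U : functor cc_cat Wmod }.

Definition hsp (C : ccat) (X : C) : hilbert R := bm_space (cc_U C X).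

Definition hmap (C : ccat) (X Y : C) (T : mor X Y) : bop (hsp X) (hsp Y) :=
  bi_op (fmor (cc_U C) T).

Lemma hmapM (C : ccat) (X Y Z : C) (S : mor Y Z) (T : mor X Y) :
  hmap (compm S T) = hmap S *b hmap T.
Proof. by rewrite /hmap fmorM. Qed.

Definition is_separating (C : ccat) (G : C) : Prop :=
  forall X : C,
    closure (lspan [set v | exists (T : mor G X) (x : hsp G), v = hmap T x]) =
    [set: hsp X].

(* Closure under the involution is read hom-set by hom-set: if the adjoint of
   [hmap T] only had to be the image of some morphism between objects with the
   same underlying bimodules, the endomorphisms of a separating object need not be
   self-adjoint and their commutant need not be a von Neumann algebra.
   Faithfulness is what makes [N] embed in [End(C)] and makes the [rho^X] objects
   of [Mod(End(C))]; without it the category whose only object is the zero bimodule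
   over a nonzero [N] would be a counterexample. *)
Definition is_catN (C : ccat) : Prop :=
  [/\ forall (X Y : C) (T : mor X Y),
        exists T' : mor Y X, is_adjoint (hmap T) (hmap T'),
      forall X : C, injective (bm_l (cc_U C X)) /\ injective (bm_r (cc_U C X)) &
      exists G : C, is_separating G].

Record catN := CatN { cn_cc :> ccat; cn_ax : is_catN cn_cc }.

Record cmor (C D : ccat) := CMor {
  cm_F :> functor C D;
  cm_U : compF cm_F (cc_U D) = cc_U C }.

Lemma cmor_ext (C D : ccat) (F G : cmor C D) : cm_F F = cm_F G -> F = G.
Proof.
case: F G => [F HF] [G HG] /= E; subst G.
by congr CMor; exact: Prop_irrelevance.
Qed.

Definition cm_hsp (C D : ccat) (F : cmor C D) (X : C) : hsp (F X) = hsp X :=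
  congr1 (fun U : functor C Wmod => bm_space (U X)) (cm_U F).

Record nattrans (C D : category) (F G : functor C D) := NatTrans {
  nt_fun :> forall X, mor (F X) (G X);
  nt_natural : forall X Y (f : mor X Y),
    compm (fmor G f) (nt_fun X) = compm (nt_fun Y) (fmor F f) }.

Lemma nt_ext (C D : category) (F G : functor C D) (a b : nattrans F G) :
  (forall X, a X = b X) -> a = b.
Proof.
case: a b => [a Ha] [b Hb] /= E.
have {}E : a = b by exact: functional_extensionality_dep.
by subst b; congr NatTrans; exact: Prop_irrelevance.
Qed.

Definition nt_id (C D : category) (F : functor C D) : nattrans F F.
Proof. by exists (fun X => idm (F X)) => X Y f; rewrite compm1 comp1m. Defined.

Definition nt_comp (C D : category) (F G H : functor C D)
    (b : nattrans G H) (a : nattrans F G) : nattrans F H.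
Proof.
exists (fun X => compm (b X) (a X)) => X Y f.
by rewrite compmA nt_natural -compmA nt_natural compmA.
Defined.

Definition chom (C D : ccat) : category.
Proof.
exists (cmor C D) (fun F G => nattrans F G) (fun F => nt_id F)
  (fun F G H b a => nt_comp b a).
- by move=> F G a; apply: nt_ext => X; rewrite /= compm1.
- by move=> F G a; apply: nt_ext => X; rewrite /= comp1m.
- by move=> F G H K c b a; apply: nt_ext => X; rewrite /= compmA.
Defined.

Lemma compFA (C D E E' : category) (F : functor C D) (G : functor D E)
  (H : functor E E') : compF (compF F G) H = compF F (compF G H).
Proof. by apply: functor_ext. Qed.

Lemma compF1 (C D : category) (F : functor C D) : compF (idF C) F = F.
Proof. by apply: functor_ext. Qed.

Definition cmor_id (C : ccat) : cmor C C.
Proof. by exists (idF C); exact: compF1. Defined.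

Definition cmor_comp (C D E : ccat) (F : cmor C D) (G : cmor D E) : cmor C E.
Proof. by exists (compF F G); rewrite compFA !cm_U. Defined.

(* For [a : F1 => F2] and [b : G1 => G2], the composite [b_F2 o G1 a]. *)
Definition chcomp (C D E : ccat) (F1 F2 : cmor C D) (G1 G2 : cmor D E)
    (a : nattrans F1 F2) (b : nattrans G1 G2) :
  nattrans (cmor_comp F1 G1) (cmor_comp F2 G2).
Proof.
exists (fun X => compm (b (F2 X)) (fmor G1 (a X))) => X Y f /=.
by rewrite compmA nt_natural -!compmA -!fmorM nt_natural.
Defined.

Definition ccompF (C D E : ccat) :
  functor (prodC (chom C D) (chom D E)) (chom C E).
Proof.
exists ((fun FG => cmor_comp FG.1 FG.2) :
    obj (prodC (chom C D) (chom D E)) -> chom C E)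
  (fun X Y (ab : @mor (prodC (chom C D) (chom D E)) X Y) =>
     chcomp ab.1 ab.2).
- by move=> [F G]; apply: nt_ext => X; rewrite /= fmor1 compm1.
- move=> [F1 G1] [F2 G2] [F3 G3] [a' b'] [a b]; apply: nt_ext => X /=.
  rewrite fmorM -!compmA; congr compm.
  by rewrite !compmA nt_natural.
Defined.

Lemma ntcastE (C D : ccat) (F F' G G' : chom C D) (eF : F = F') (eG : G = G')
    (a : mor F G) (X : C) :
  nt_fun (morcast eF eG a) X =
  morcast (congr1 (fun H : cmor C D => H X) eF)
          (congr1 (fun H : cmor C D => H X) eG) (nt_fun a X).
Proof. by subst F' G'. Qed.

Lemma morcast_id (C : category) (X Y : C) (eX : X = X) (eY : Y = Y)
  (f : mor X Y) : morcast eX eY f = f.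
Proof. by rewrite (Prop_irrelevance eX erefl) (Prop_irrelevance eY erefl). Qed.

Definition CatNN : twocat.
Proof.
exists catN (fun C D => chom C D) (fun C => cmor_id C) (fun C D E => ccompF C D E).
- move=> C D; apply: functor_ext => [F|e F G a].
    by apply: cmor_ext; exact: functor_ext.
  by apply: nt_ext => X; rewrite ntcastE morcast_id /= fmor1 compm1.
- move=> C D; apply: functor_ext => [F|e F G a].
    by apply: cmor_ext; exact: functor_ext.
  by apply: nt_ext => X; rewrite ntcastE morcast_id /= comp1m.
- move=> C D E E'; apply: functor_ext => [F|e F G a].
    by apply: cmor_ext; exact: functor_ext.
  by apply: nt_ext => X; rewrite ntcastE morcast_id /= fmorM compmA.
Defined.

Record rep (A : wobj N) := Rep {
  rep_space : hilbert R;
  rep_pi : A -> bop rep_space rep_space;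
  rep_ax : [/\ is_repr rep_pi, injective (fun n => rep_pi (w_emb A n)) &
               injective (fun n => rep_pi (w_op A n))] }.

Record repmor (A : wobj N) (L M : rep A) := RepMor {
  rm_op : bop (rep_space L) (rep_space M);
  rm_ax : forall a, rm_op *b rep_pi L a = rep_pi M a *b rm_op }.

Lemma repmor_ext (A : wobj N) (L M : rep A) (S T : repmor L M) :
  rm_op S = rm_op T -> S = T.
Proof.
case: S T => [S HS] [T HT] /= E; subst T.
by congr RepMor; exact: Prop_irrelevance.
Qed.

Definition rm_id (A : wobj N) (L : rep A) : repmor L L.
Proof. by exists (bid _) => a; rewrite bcomp1 bcomp1l. Defined.

Definition rm_comp (A : wobj N) (L M P : rep A) (S : repmor M P)
  (T : repmor L M) : repmor L P.
Proof.
by exists (rm_op S *b rm_op T) => a; rewrite -bcompA rm_ax bcompA rm_ax bcompA.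
Defined.

Definition Mod_cat (A : wobj N) : category.
Proof.
exists (rep A) (@repmor A) (@rm_id A) (@rm_comp A).
- by move=> L M S; apply: repmor_ext; rewrite /= bcomp1.
- by move=> L M S; apply: repmor_ext; rewrite /= bcomp1l.
- by move=> L M P Q U S T; apply: repmor_ext; rewrite /= bcompA.
Defined.

Definition rep_bimod (A : wobj N) (L : rep A) : bimod.
Proof.
exists (rep_space L) (fun n => rep_pi L (w_emb A n))
  (fun n => rep_pi L (w_op A n)).
have [L1 _ _] := rep_ax L; have [[A1 _] [A2 _] A3] := w_ax A; split.
- exact: repr_comp.
- exact: antirepr_comp.
- move=> m n; rewrite -!reprM //; congr (rep_pi L _).
  by apply: val_inj; exact: A3.
Defined.

Definition Mod_U (A : wobj N) : functor (Mod_cat A) Wmod.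
Proof.
exists (@rep_bimod A : Mod_cat A -> Wmod)
  (fun (L M : Mod_cat A) (T : mor L M) =>
     @BiMor (rep_bimod L) (rep_bimod M) (rm_op T)
       (conj (fun n => rm_ax T (w_emb A n)) (fun n => rm_ax T (w_op A n)))).
- by move=> L; exact: bimor_ext.
- by move=> L M P S T; exact: bimor_ext.
Defined.

Definition ModC (A : wobj N) : ccat := CCat (Mod_U A).

Definition pullback_fun (A B : wobj N) (phi : wmor A B) (L : rep B) : rep A.
Proof.
exists (rep_space L) (fun a => rep_pi L (phi a)).
have [L1 L2 L3] := rep_ax L; have [p1 p2 p3] := wm_ax phi; split.
- exact: repr_comp.
- by move=> m n /=; rewrite !p2 => /L2.
- by move=> m n /=; rewrite !p3 => /L3.
Defined.

Definition pullbackF (A B : wobj N) (phi : wmor A B) :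
  functor (Mod_cat B) (Mod_cat A).
Proof.
exists (pullback_fun phi : Mod_cat B -> Mod_cat A)
  (fun (L M : Mod_cat B) (T : mor L M) =>
     @RepMor A (pullback_fun phi L) (pullback_fun phi M) (rm_op T)
       (fun a => rm_ax T (phi a))).
- by move=> L; exact: repmor_ext.
- by move=> L M P S T; exact: repmor_ext.
Defined.

Definition pullback (A B : wobj N) (phi : wmor A B) : cmor (ModC B) (ModC A).
Proof.
exists (pullbackF phi); apply: functor_ext => [L|e L M T].
  have [p1 p2 p3] := wm_ax phi.
  by apply: bimod_ext => n /=; rewrite ?p2 ?p3.
by apply: bimor_ext; rewrite bi_op_cast; exact: bopcast_id.
Defined.

Lemma rep_w2cell (A B : wobj N) (phi psi : wmor A B) (b : w2cell phi psi)
    (L : rep B) (a : A) :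
  rep_pi L b *b rep_pi L (phi a) = rep_pi L (psi a) *b rep_pi L b.
Proof.
have [L1 _ _] := rep_ax L.
rewrite -!reprM //; congr (rep_pi L _).
by apply: val_inj; exact: (w2_ax b).
Qed.

Definition pullback_nt (A B : wobj N) (phi psi : wmor A B)
  (b : w2cell phi psi) : nattrans (pullback phi) (pullback psi).
Proof.
exists (fun L : Mod_cat B => @RepMor A (pullback_fun phi L) (pullback_fun psi L)
  (rep_pi L b) (rep_w2cell b L)).
by move=> L M T; apply: repmor_ext; rewrite /= (rm_ax T).
Defined.

Definition Mod1 (A B : wobj N) : functor (whom A B) (chom (ModC B) (ModC A)).
Proof.
exists (@pullback A B : whom A B -> chom (ModC B) (ModC A))
  (fun phi psi (b : @mor (whom A B) phi psi) => pullback_nt b).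
- move=> phi; apply: nt_ext => L; apply: repmor_ext => /=.
  by have [L1 _ _] := rep_ax L; exact: (repr1 L1).
- move=> phi psi chi c b; apply: nt_ext => L; apply: repmor_ext => /=.
  by have [L1 _ _] := rep_ax L; exact: reprM.
Defined.

Definition id_rep (A : wobj N) : rep A.
Proof.
exists (vn_space A) (fun a => \val a).
have [[_ A1] [_ A2] _] := w_ax A; split; first exact: val_repr.
- by move=> m n /= /val_inj /A1.
- by move=> m n /= /val_inj /A2.
Defined.

Section EndC.
Variables (C : catN) (G : C).

Definition end_ops : set (bop (hsp G) (hsp G)) :=
  [set S | exists T : mor G G, S = hmap T].

Definition EndAlg : vnalg R.
Proof.
exists (hsp G) (commutant end_ops); last exact: commutant3.
apply: star_closed_commutant => _ [T ->].
have [star _ _] := cn_ax C; have [T' TT'] := star _ _ T.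
by exists (hmap T') => //; exists T'.
Defined.

Lemma end_l n : commutant end_ops (bm_l (cc_U C G) n).
Proof. by move=> _ [T ->]; have [+ _] := bi_ax (fmor (cc_U C) T) => <-. Qed.

Lemma end_r n : commutant end_ops (bm_r (cc_U C G) n).
Proof. by move=> _ [T ->]; have [_ +] := bi_ax (fmor (cc_U C) T) => <-. Qed.

Definition EndObj : wobj N.
Proof.
exists EndAlg (fun n => SigSub (mem_set (end_l n)))
  (fun n => SigSub (mem_set (end_r n))).
have [b1 b2 b3] := bm_ax (cc_U C G); have [_ /(_ G)[f1 f2] _] := cn_ax C.
split.
- by split=> // m n /(congr1 \val) /f1.
- by split=> // m n /(congr1 \val) /f2.
- by [].
Defined.

(* The operator determined by [rho^X(S) H(T) = H(T) S]. *)
Definition rho (X : C) (S : EndObj) : bop (hsp X) (hsp X) :=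
  xget 0 [set Q | forall T : mor G X, Q *b hmap T = hmap T *b \val S].

Definition rep_of (A : wobj N) (phi : wmor A EndObj) : rep A.
Proof.
exists (hsp G) (fun a => \val (phi a)).
have [p1 p2 p3] := wm_ax phi; have [[_ e1] [_ e2] _] := w_ax EndObj; split=> //.
- by move=> m n /= /val_inj; rewrite !p2 => /e1.
- by move=> m n /= /val_inj; rewrite !p3 => /e2.
Defined.

End EndC.
End CatN.

(* Main.v *)
(* The categorical identities reduce to one principle: [G_C] being separating, an
   operator on [H_C X] is determined by its composites with the [H_C T], [T : G_C -> X],
   so that [rho^X (S)] is the only solution of its defining equation.  The analysis lies
   in three facts.

   Existence of [rho^X (S)]: [|sum_i T_i S x_i| <= c |sum_i T_i x_i|], because [S^* S]
   commutes with the operators [T_j^* T_i] (Reid's inequality).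

   Normality of [rho^X]: for [x], [y] in [ell2 (H_C X)] there is a bounded
   [T : ell2 (H_C G_C) -> ell2 (H_C X)] intertwining the amplifications, whose range
   contains sequences converging to [x] and to [y].  As [|T|] commutes with the
   amplifications and [|T| g] has the norm of [T g], the functional
   [S |-> <rho^X (S) x, y>] has the form [S |-> <S h, k>] with [h], [k] in
   [ell2 (H_C G_C)].

   The identity representation separates [Mod(A)]: normality of [pi] at 0 bounds
   [|pi a x|] by [c |a Z|] for a vector [Z] of a multiple of the identity
   representation, so [a Z |-> pi a x] extends to an intertwiner of that multiple with
   [pi], and [x], the image of [Z], lies in the closed span of the images of its
   components. *)
Require Import Defs.
From HB Require Import structures.
From mathcomp Require Import all_boot all_order all_algebra.
From mathcomp Require Import all_classical all_reals all_analysis.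
From mathcomp Require Import complex ring lra.

Set Implicit Arguments.
Unset Strict Implicit.
Unset Printing Implicit Defensive.

Import Order.TTheory GRing.Theory Num.Theory.
Import numFieldNormedType.Exports.

Local Open Scope classical_set_scope.
Local Open Scope ring_scope.

(** Two obstacles shape the development. The spaces that generate [hsp X] generate it only as a
    closed span, so a vector of [hsp X] need not lie in the range of any intertwiner, and a column
    of vectors can only be approximated by values of one operator T; passing to |T| replaces a
    missing preimage by a limit in the source. Since a sigma-weak functional involves just two
    sequences, and each vector of a closed span is the limit of a sequence of finite sums, countable
    rows of intertwiners are enough. The other obstacle is that a 1-morphism F satisfies U_D F = U_C
    as an equality of functors, so that the spaces of F X and of X agree only through a proof of
    equality. Operators are carried along it by [bopcast], and proof irrelevance identifies any two
    casts between the same spaces. Finally, the separating object chosen in Mod(A) is arbitrary, so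
    End(Mod(A)) acts on a space unrelated to that of A; the comparison runs through the identity
    representation. *)

Local Notation "x %:C" := (real_complex _ x : Cx _) : ring_scope.

(** * Real-valued norms, limits and closures over the complex numbers *)

Section RealNorm.
Variable R : realType.

(* Norms over [Cx R] take values in [Cx R], where the order is partial; [nm] is the
   real number underlying the norm. *)
Definition nm (V : normedZmodType (Cx R)) (x : V) : R := complex.Re `|x|.

Lemma nmE (V : normedZmodType (Cx R)) (x : V) : `|x| = (nm x)%:C :> Cx R.
Proof. by rewrite /nm RRe_real ?normr_real. Qed.

Lemma nm_ge0 (V : normedZmodType (Cx R)) (x : V) : 0 <= nm x.
Proof. by rewrite -ler0c -nmE. Qed.

Lemma nm0 (V : normedZmodType (Cx R)) : nm (0 : V) = 0.
Proof. by rewrite /nm normr0. Qed.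

Lemma nm_eq0 (V : normedZmodType (Cx R)) (x : V) : nm x = 0 -> x = 0.
Proof. by move=> x0; apply/eqP; rewrite -normr_eq0 nmE x0. Qed.

Lemma nmN (V : normedZmodType (Cx R)) (x : V) : nm (- x) = nm x.
Proof. by rewrite /nm normrN. Qed.

Lemma nm_distC (V : normedZmodType (Cx R)) (x y : V) : nm (x - y) = nm (y - x).
Proof. by rewrite /nm distrC. Qed.

Lemma nmD (V : normedZmodType (Cx R)) (x y : V) : nm (x + y) <= nm x + nm y.
Proof. by rewrite -lecR rmorphD /= -!nmE ler_normD. Qed.

Lemma nmB (V : normedZmodType (Cx R)) (x y : V) : nm (x - y) <= nm x + nm y.
Proof. by rewrite -[nm y]nmN nmD. Qed.

Lemma nmZ (V : normedModType (Cx R)) (k : Cx R) (x : V) : nm (k *: x) = nm k * nm x.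
Proof. by apply: complexI; rewrite rmorphM /= -!nmE normrZ. Qed.

Lemma nmM (k l : Cx R) : nm (k * l) = nm k * nm l.
Proof. by apply: complexI; rewrite rmorphM /= -!nmE normrM. Qed.

Lemma nm_conj (k : Cx R) : nm k^* = nm k.
Proof. by rewrite /nm norm_conjC. Qed.

Lemma nm_real (k : R) : nm (k%:C) = `|k|.
Proof.
by apply: complexI; rewrite -nmE normc_def /= expr0n addr0 sqrtr_sqr.
Qed.

Lemma Re_le_nm (k : Cx R) : complex.Re k <= nm k.
Proof.
rewrite (le_trans (ler_norm _)) // -lecR -nmE; exact: normc_ge_Re.
Qed.

Lemma conj_Re (k : Cx R) : k + k^* = (2 * complex.Re k)%:C.
Proof. by rewrite [LHS](addcJ k) rmorphM rmorphMn. Qed.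

Lemma ReD (k l : Cx R) : complex.Re (k + l) = complex.Re k + complex.Re l.
Proof. by case: k l => [? ?] [? ?]. Qed.

Lemma ReN (k : Cx R) : complex.Re (- k) = - complex.Re k.
Proof. by case: k. Qed.

(** A positive element of [Cx R] is real, so the complex radii of balls can be traded for real
    ones. *)
Lemma nm_cvg (V : normedModType (Cx R)) T (F : set_system T) {FF : Filter F}
    (u : T -> V) (l : V) :
  u @ F --> l <-> forall e : R, 0 < e -> \forall n \near F, nm (u n - l) < e.
Proof.
split=> [/cvgrPdist_lt ul e e0|H].
  have := ul e%:C; rewrite ltcR => /(_ e0); apply: filterS => n.
  by rewrite distrC nmE ltcR.
apply/cvgrPdist_lt => e e0.
have eE : e = (complex.Re e)%:C by rewrite RRe_real // gtr0_real.
have := H (complex.Re e); rewrite -ltcR -eE => /(_ e0).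
by apply: filterS => n; rewrite distrC nmE eE ltcR.
Qed.

Lemma cvgC_nm T (F : set_system T) {FF : Filter F} (u : T -> Cx R) (l : Cx R) :
  u @ F --> l <-> forall e : R, 0 < e -> \forall n \near F, nm (u n - l) < e.
Proof. exact: nm_cvg. Qed.

Lemma nm_cvgn (V : normedModType (Cx R)) (u : nat -> V) (l : V) :
  u @ \oo --> l <->
  forall e : R, 0 < e -> exists N, forall n, (N <= n)%N -> nm (u n - l) < e.
Proof.
rewrite nm_cvg; split=> H e /H.
  by move=> [N _ HN]; exists N => n Nn; exact: HN.
by move=> [N HN]; exists N.
Qed.

Lemma nm_cvgn_dist (V : normedModType (Cx R)) (u : nat -> V) (l : V) (a : nat -> R) :
  (forall n, nm (u n - l) <= a n) -> a @ \oo --> 0 -> u @ \oo --> l.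
Proof.
move=> ua /cvgr0Pnorm_lt a0; apply/nm_cvg => e /a0; apply: filterS => n.
by apply: le_lt_trans; rewrite (le_trans (ua n)) // ler_norm.
Qed.

Lemma cvg_nm (V : normedModType (Cx R)) T (F : set_system T) {FF : Filter F}
    (u : T -> V) (l : V) : u @ F --> l -> (fun n => nm (u n)) @ F --> nm l.
Proof.
move=> /nm_cvg ul; apply/cvgrPdist_lt => e /ul; apply: filterS => n.
apply: le_lt_trans; rewrite ler_norml lerBrDr lerBlDr addrC.
have := nmD (u n - l) l; have := nmD (l - u n) (u n).
rewrite !subrK (nm_distC l) => H1 H2; apply/andP; split; lra.
Qed.

Lemma nm_cvg_le (V : normedModType (Cx R)) (u : nat -> V) (l : V) (B : R) :
  u @ \oo --> l -> (forall n, nm (u n) <= B) -> nm l <= B.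
Proof.
move=> /cvg_nm ul uB; rewrite -(cvg_lim _ ul) //; apply: limr_le.
  by apply/cvg_ex; exists (nm l).
by apply: nearW.
Qed.

Lemma cvg_Re T (F : set_system T) {FF : Filter F} (u : T -> Cx R) (l : Cx R) :
  u @ F --> l -> (fun n => complex.Re (u n)) @ F --> complex.Re l.
Proof.
move=> /nm_cvg ul; apply/cvgrPdist_lt => e /ul; apply: filterS => n.
apply: le_lt_trans; rewrite distrC -lecR -ReN -ReD -nmE; exact: normc_ge_Re.
Qed.

Lemma cvg_Creal T (F : set_system T) {FF : Filter F} (u : T -> R) (l : R) :
  u @ F --> l -> (fun n => (u n)%:C) @ F --> (l%:C).
Proof.
move=> /cvgrPdist_lt ul; apply/nm_cvg => e /ul; apply: filterS => n.
by rewrite -rmorphB /= nm_real distrC.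
Qed.

Lemma cvg_conj T (F : set_system T) {FF : Filter F} (u : T -> Cx R) (l : Cx R) :
  u @ F --> l -> (fun n => (u n)^*) @ F --> l^*.
Proof.
move=> /nm_cvg ul; apply/nm_cvg => e /ul; apply: filterS => n.
by rewrite -rmorphB /= nm_conj.
Qed.

Lemma nm_cvg_unique (V : normedModType (Cx R)) T (F : set_system T)
    {FF : ProperFilter F} (u : T -> V) (a b : V) :
  u @ F --> a -> u @ F --> b -> a = b.
Proof. exact: (cvg_unique (@norm_hausdorff _ V)). Qed.

Lemma cvgC_unique T (F : set_system T) {FF : ProperFilter F} (u : T -> Cx R)
    (a b : Cx R) : u @ F --> a -> u @ F --> b -> a = b.
Proof. exact: nm_cvg_unique. Qed.

Lemma closureP_nm (V : normedModType (Cx R)) (A : set V) (x : V) :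
  closure A x <-> forall e : R, 0 < e -> exists2 y, A y & nm (y - x) < e.
Proof.
split=> [Ax e e0|H B].
  have e0' : (0 : Cx R) < e%:C by rewrite ltcR.
  have [y [Ay]] := Ax _ (nbhsx_ballx x _ e0').
  by rewrite -ball_normE /= nmE ltcR nm_distC => ye; exists y.
move=> /nbhs_ballP[e /= e0 eB].
have eE : e = (complex.Re e)%:C by rewrite RRe_real // gtr0_real.
have := H (complex.Re e); rewrite -ltcR -eE => /(_ e0)[y Ay yx].
exists y; split => //; apply: eB.
by rewrite -ball_normE /= nmE eE ltcR nm_distC.
Qed.

Lemma harmonic_lt (e : R) : 0 < e -> exists N, forall n, (N <= n)%N -> n.+1%:R^-1 < e.
Proof.
move=> e0; have /cvgr0Pnorm_lt/(_ e e0)[N _ HN] := @cvg_harmonic R.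
by exists N => n /HN /=; rewrite ger0_norm.
Qed.

Lemma closure_seq (V : normedModType (Cx R)) (A : set V) (x : V) :
  closure A x <-> exists2 u : nat -> V, (forall n, A (u n)) & u @ \oo --> x.
Proof.
split=> [/closureP_nm Ax|[u Au /nm_cvgn ux]]; last first.
  apply/closureP_nm => e /ux[N HN]; exists (u N) => //; exact: HN.
have /choice[u Hu] : forall n, exists y, A y /\ nm (y - x) < n.+1%:R^-1.
  move=> n; have [|y Ay yx] := Ax n.+1%:R^-1; last by exists y.
  by rewrite invr_gt0 ltr0n.
exists u => [n|]; first by have [] := Hu n.
apply: (@nm_cvgn_dist _ _ _ (fun n => n.+1%:R^-1)).
  by move=> n; have [_ /ltW] := Hu n.
exact: cvg_harmonic.
Qed.

Lemma nm_cauchy_cvg (V : completeNormedModType (Cx R)) (u : nat -> V) :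
  (forall e : R, 0 < e -> exists N, forall m n, (N <= m)%N -> (N <= n)%N ->
     nm (u m - u n) < e) -> exists l : V, u @ \oo --> l.
Proof.
move=> uC; suff /cvg_ex[l ul] : cvg (u @ \oo) by exists l.
apply: cauchy_cvg; apply/cauchyP => e e0.
have eE : e = (complex.Re e)%:C by rewrite RRe_real // gtr0_real.
have := uC (complex.Re e); rewrite -ltcR -eE => /(_ e0)[N HN].
exists (u N); exists N => // n Nn.
by rewrite -ball_normE /= nmE eE ltcR; apply: HN => //=.
Qed.

End RealNorm.

Section ComplexLimits.
Variables (R : realType) (T : Type) (F : set_system T).
Context {FF : Filter F}.
Implicit Types (u v : T -> Cx R) (a b : Cx R).

Lemma cvgCD u v a b : u @ F --> a -> v @ F --> b ->
  (fun n => u n + v n) @ F --> (a + b : Cx R).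
Proof. exact: cvgD. Qed.

Lemma cvgCB u v a b : u @ F --> a -> v @ F --> b ->
  (fun n => u n - v n) @ F --> (a - b : Cx R).
Proof. exact: cvgB. Qed.

Lemma cvgCM u v a b : u @ F --> a -> v @ F --> b ->
  (fun n => u n * v n) @ F --> (a * b : Cx R).
Proof. exact: cvgM. Qed.

Lemma cvgCZ (k : Cx R) u a : u @ F --> a -> (fun n => k * u n) @ F --> (k * a : Cx R).
Proof. exact: cvgMl_tmp. Qed.

(** The combination is the right-hand side of [polarization], with k = 1/4 and l = i. *)
Lemma cvgC_comb (k l : Cx R) u1 u2 u3 u4 a1 a2 a3 a4 :
  u1 @ F --> a1 -> u2 @ F --> a2 -> u3 @ F --> a3 -> u4 @ F --> a4 ->
  (fun n => k * (u1 n - u2 n + l * u3 n - l * u4 n)) @ F -->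
  (k * (a1 - a2 + l * a3 - l * a4) : Cx R).
Proof.
move=> h1 h2 h3 h4; apply: cvgCZ; apply: cvgCB; last exact: cvgCZ.
by apply: cvgCD; [exact: cvgCB|exact: cvgCZ].
Qed.

End ComplexLimits.

(** * Cauchy-Schwarz, polarization and continuity of inner products *)

Section InnerProduct.
Variable R : realType.

Section DotForm.
Variables (U : lmodType (Cx R)) (f : {dot U for @Num.conj (Cx R)}).

Lemma dot_Re x : f x x = (complex.Re (f x x))%:C.
Proof. by rewrite RRe_real // ger0_real // dnorm_ge0. Qed.

Lemma Re_dot_ge0 x : 0 <= complex.Re (f x x).
Proof. by rewrite -ler0c -dot_Re dnorm_ge0. Qed.

(** Cauchy-Schwarz for a bare dot form: it is needed for [l2ip] before [l2seq H] carries a norm. *)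
Lemma dot_CS x y :
  nm (f x y) ^+ 2 <= complex.Re (f x x) * complex.Re (f y y).
Proof.
have [->|y0] := eqVneq y 0.
  by rewrite linear0r nm0 expr0n mulr_ge0 ?Re_dot_ge0.
have fy : 0 < f y y by rewrite dnorm_gt0.
(* This vector is <y, y> times the component of x orthogonal to y. *)
have := dnorm_ge0 f (f y y *: x - f x y *: y).
rewrite dnormB !dnormZ linearZl_LR linearZr_LR /=.
set a := f x x; set b := f y y; set c := f x y.
have bR : b^* = b by apply/CrealP; exact: gtr0_real.
rewrite !rmorphM /= conjCK bR (ger0_norm (ltW fy)) normCK => H.
have {H} : 0 <= b * (b * a - c * c^*).
  by apply: le_trans H _; rewrite le_eqVlt; apply/orP; left; apply/eqP; ring.
rewrite pmulr_rge0 // subr_ge0 -normCK nmE => H.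
by rewrite -lecR rmorphXn rmorphM /= -!dot_Re mulrC.
Qed.

End DotForm.

Variable H : hilbert R.
Implicit Types x y z : H.

Lemma ip_nm x : ip x x = (nm x ^+ 2)%:C.
Proof. by rewrite ip_norm nmE rmorphXn. Qed.

Lemma nm_ip x : nm x ^+ 2 = complex.Re (ip x x).
Proof. by rewrite ip_nm. Qed.

Lemma ip_CS x y : nm (ip x y) <= nm x * nm y.
Proof.
rewrite -(@ler_pXn2r _ 2) ?nnegrE ?mulr_ge0 ?nm_ge0 //.
by rewrite exprMn !nm_ip dot_CS.
Qed.

Lemma ip0l x : ip 0 x = 0. Proof. exact: linear0l. Qed.
Lemma ip0r x : ip x 0 = 0. Proof. exact: linear0r. Qed.
Lemma ipDl x y z : ip (x + y) z = ip x z + ip y z. Proof. exact: linearDl. Qed.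
Lemma ipDr x y z : ip z (x + y) = ip z x + ip z y. Proof. exact: linearDr. Qed.
Lemma ipBl x y z : ip (x - y) z = ip x z - ip y z. Proof. exact: linearBl. Qed.
Lemma ipBr x y z : ip z (x - y) = ip z x - ip z y. Proof. exact: linearBr. Qed.
Lemma ipZl (k : Cx R) x y : ip (k *: x) y = k * ip x y.
Proof. exact: linearZl_LR. Qed.
Lemma ipZr (k : Cx R) x y : ip x (k *: y) = k^* * ip x y.
Proof. exact: linearZr_LR. Qed.

Lemma ip_suml I (r : seq I) (P : pred I) (F : I -> H) y :
  ip (\sum_(i <- r | P i) F i) y = \sum_(i <- r | P i) ip (F i) y.
Proof. by apply: (big_morph (fun x => ip x y)) => [u v|]; rewrite ?ipDl ?ip0l. Qed.

Lemma ip_sumr I (r : seq I) (P : pred I) (F : I -> H) y :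
  ip y (\sum_(i <- r | P i) F i) = \sum_(i <- r | P i) ip y (F i).
Proof. by apply: (big_morph (fun x => ip y x)) => [u v|]; rewrite ?ipDr ?ip0r. Qed.

Lemma ip_eq0 x : (forall y, ip x y = 0) -> x = 0.
Proof. by move=> /(_ x)/eqP; rewrite dnorm_eq0 => /eqP. Qed.

Lemma ip_injl x y : (forall z, ip x z = ip y z) -> x = y.
Proof.
by move=> E; apply/eqP; rewrite -subr_eq0; apply/eqP/ip_eq0 => z; rewrite ipBl E subrr.
Qed.

Lemma ip_injr x y : (forall z, ip z x = ip z y) -> x = y.
Proof. by move=> E; apply: ip_injl => z; rewrite ipC E -ipC. Qed.

Lemma nm_sqrD x y :
  nm (x + y) ^+ 2 = nm x ^+ 2 + nm y ^+ 2 + 2 * complex.Re (ip x y).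
Proof. by rewrite nm_ip dnormD /= conj_Re !ip_nm !ReD. Qed.

Lemma nm_sqrB x y :
  nm (x - y) ^+ 2 = nm x ^+ 2 + nm y ^+ 2 - 2 * complex.Re (ip x y).
Proof. by rewrite nm_ip dnormB /= conj_Re !ip_nm !ReD ReN. Qed.

Lemma parallelogram x y :
  nm (x + y) ^+ 2 + nm (x - y) ^+ 2 = 2 * (nm x ^+ 2 + nm y ^+ 2).
Proof. by rewrite nm_sqrD nm_sqrB; ring. Qed.

Lemma polarization x y :
  4 * ip x y = `|x + y| ^+ 2 - `|x - y| ^+ 2
    + 'i * `|x + 'i *: y| ^+ 2 - 'i * `|x - 'i *: y| ^+ 2.
Proof.
rewrite -!ip_norm !(ipBl, ipDl, ipBr, ipDr, ipZl, ipZr) conjCi.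
have : 'i * 'i = -1 :> Cx R by rewrite -expr2 sqrCi.
(* With i an opaque variable, its square is used once by hand to rewrite 4a, and the rest is a ring
   identity. *)
move: ('i) => i Hi.
set a := ip x y; set b := ip y x; set c := ip x x; set d := ip y y.
have -> : 4 * a = 2 * a + 2 * b - i * i * (2 * a) + i * i * (2 * b).
  by rewrite Hi; ring.
by ring.
Qed.

(** Polarization makes the inner product a polynomial in norms, so its continuity along any filter
    follows from that of the norm, with no boundedness argument. *)
Lemma cvg_ip T (F : set_system T) {FF : Filter F} (u v : T -> H) x y :
  u @ F --> x -> v @ F --> y -> (fun n => ip (u n) (v n)) @ F --> (ip x y : Cx R).
Proof.
move=> ux vy; pose p (x y : H) := `|x + y| ^+ 2 - `|x - y| ^+ 2
    + 'i * `|x + 'i *: y| ^+ 2 - 'i * `|x - 'i *: y| ^+ 2 : Cx R.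
have E x' y' : ip x' y' = 4^-1 * p x' y'.
  by rewrite /p -polarization mulrA mulVf ?mul1r // pnatr_eq0.
rewrite E; under eq_fun do rewrite E.
have N2 w z : w @ F --> z -> (fun n => `|w n : H| ^+ 2) @ F --> (`|z| ^+ 2 : Cx R).
  move=> wz; rewrite expr2; under eq_fun do rewrite expr2.
  by apply: cvgCM; apply: cvg_norm.
have iv : (fun n => 'i *: v n) @ F --> ('i *: y : H) by exact: cvgZl_tmp.
exact: (cvgC_comb (N2 _ _ (cvgD ux vy)) (N2 _ _ (cvgB ux vy))
  (N2 _ _ (cvgD ux iv)) (N2 _ _ (cvgB ux iv))).
Qed.

Lemma cvg_ipl T (F : set_system T) {FF : Filter F} (u : T -> H) x y :
  u @ F --> x -> (fun n => ip (u n) y) @ F --> (ip x y : Cx R).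
Proof. by move=> ux; apply: cvg_ip => //; exact: cvg_cst. Qed.

Lemma cvg_ipr T (F : set_system T) {FF : Filter F} (u : T -> H) x y :
  u @ F --> x -> (fun n => ip y (u n)) @ F --> (ip y x : Cx R).
Proof. by move=> ux; apply: cvg_ip => //; exact: cvg_cst. Qed.

End InnerProduct.

Lemma cvg_sum_ord (K : numFieldType) (V : normedModType K) T (F : set_system T)
    {FF : Filter F} (k : nat) (f : nat -> T -> V) (l : nat -> V) :
  (forall i, f i @ F --> l i) ->
  (fun n => \sum_(i < k) f i n) @ F --> \sum_(i < k) l i.
Proof.
move=> fl; elim: k => [|k IH].
  rewrite big_ord0; under eq_fun do rewrite big_ord0; exact: cvg_cst.
rewrite big_ord_recr /=; under eq_fun do rewrite big_ord_recr /=.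
exact: cvgD.
Qed.

(** * The Hilbert space of square-summable sequences *)

Section SquareSummable.
Variables (R : realType) (H : hilbert R).
Implicit Types x y z : l2seq H.

(** The partial sums are real and increasing, so their convergence in [Cx R] amounts to a real
    bound, which is the form in which summability is checked later. *)
Lemma l2P (x : nat -> H) :
  cvgn (series (fun n => `|x n| ^+ 2)) <->
  exists B : R, forall n, \sum_(i < n) nm (x i) ^+ 2 <= B.
Proof.
have -> : series (fun n => `|x n| ^+ 2) =
    (fun n => (\sum_(i < n) nm (x i) ^+ 2)%:C).
  apply/funext => n; rewrite seriesEord /= rmorph_sum; apply: eq_bigr => i _.
  by rewrite nmE rmorphXn.
have nd : nondecreasing_seq (fun n => \sum_(i < n) nm (x i) ^+ 2).
  by apply/nondecreasing_seqP => n; rewrite big_ord_recr /= lerDl exprn_ge0 ?nm_ge0.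
split=> [/cvg_ex[l /cvg_Re xl]|[B xB]].
  exists (complex.Re l) => n; rewrite -(cvg_lim _ xl) //.
  by apply: nondecreasing_cvgn_le => //; apply/cvg_ex; exists (complex.Re l).
have /cvg_ex[l xl] : cvgn (fun n => \sum_(i < n) nm (x i) ^+ 2).
  by apply: nondecreasing_is_cvgn => //; exists B => _ [n _ <-].
apply/cvg_ex; exists l%:C; exact: cvg_Creal.
Qed.

Lemma l2_bound x : exists B : R, forall n, \sum_(i < n) nm (x i) ^+ 2 <= B.
Proof. by apply/l2P; exact: l2_summable. Qed.

Lemma l2_ext x y : (forall n, x n = y n) -> x = y.
Proof.
case: x y => [x Hx] [y Hy] /= /funext E; subst y.
by congr L2Seq; exact: Prop_irrelevance.
Qed.

HB.instance Definition _ := gen_eqMixin (l2seq H).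
HB.instance Definition _ := gen_choiceMixin (l2seq H).

Definition l2zero : l2seq H.
Proof.
exists (fun=> 0); apply/l2P; exists 0 => n.
by rewrite big1 // => i _; rewrite nm0 expr0n.
Defined.

Definition l2add x y : l2seq H.
Proof.
exists (fun n => x n + y n); apply/l2P.
have [A xA] := l2_bound x; have [B yB] := l2_bound y.
(* By the parallelogram law, |x + y|^2 <= 2 (|x|^2 + |y|^2) in each coordinate. *)
exists (2 * (A + B)) => n.
rewrite (le_trans _ (ler_wpM2l _ (lerD (xA n) (yB n)))) //.
rewrite -big_split /= mulr_sumr; apply: ler_sum => i _.
by rewrite -parallelogram lerDl exprn_ge0 ?nm_ge0.
Defined.

Definition l2scale (k : Cx R) x : l2seq H.
Proof.
exists (fun n => k *: x n); apply/l2P; have [A xA] := l2_bound x.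
exists (nm k ^+ 2 * A) => n.
rewrite (le_trans _ (ler_wpM2l _ (xA n))) ?exprn_ge0 ?nm_ge0 //.
by rewrite mulr_sumr; apply: ler_sum => i _; rewrite nmZ exprMn.
Defined.

Definition l2opp x : l2seq H.
Proof.
exists (fun n => - x n); apply/l2P; have [A xA] := l2_bound x.
by exists A => n; under eq_bigr do rewrite nmN.
Defined.

Fact l2addA : associative l2add.
Proof. by move=> x y z; apply: l2_ext => n /=; rewrite addrA. Qed.
Fact l2addC : commutative l2add.
Proof. by move=> x y; apply: l2_ext => n /=; rewrite addrC. Qed.
Fact l2add0 : left_id l2zero l2add.
Proof. by move=> x; apply: l2_ext => n /=; rewrite add0r. Qed.
Fact l2addN : left_inverse l2zero l2opp l2add.
Proof. by move=> x; apply: l2_ext => n /=; rewrite addNr. Qed.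

HB.instance Definition _ :=
  GRing.isZmodule.Build (l2seq H) l2addA l2addC l2add0 l2addN.

Fact l2scaleA (a b : Cx R) x : l2scale a (l2scale b x) = l2scale (a * b) x.
Proof. by apply: l2_ext => n /=; rewrite scalerA. Qed.
Fact l2scale1 : left_id 1 l2scale.
Proof. by move=> x; apply: l2_ext => n /=; rewrite scale1r. Qed.
Fact l2scaleDr : right_distributive l2scale +%R.
Proof. by move=> a x y; apply: l2_ext => n /=; rewrite scalerDr. Qed.
Fact l2scaleDl x : {morph l2scale^~ x : a b / a + b}.
Proof. by move=> a b; apply: l2_ext => n /=; rewrite scalerDl. Qed.

HB.instance Definition _ :=
  GRing.Zmodule_isLmodule.Build (Cx R) (l2seq H) l2scaleA l2scale1
    l2scaleDr l2scaleDl.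

Definition l2ip x y : Cx R := limn (series (fun n => ip (x n) (y n))).

(* Polarization reduces the convergence to that of series of squared norms. *)
Lemma l2ip_cvg x y : series (fun n => ip (x n) (y n)) @ \oo --> l2ip x y.
Proof.
suff : cvgn (series (fun n => ip (x n) (y n))) by [].
have /cvg_ex[a xa] := @l2_summable _ _ (x + y).
have /cvg_ex[b xb] := @l2_summable _ _ (x - y).
have /cvg_ex[c xc] := @l2_summable _ _ (x + 'i *: y).
have /cvg_ex[d xd] := @l2_summable _ _ (x - 'i *: y).
apply/cvg_ex; exists (4^-1 * (a - b + 'i * c - 'i * d)).
have -> : series (fun n => ip (x n) (y n)) = fun n => 4^-1 *
   (series (fun n => `|(x + y) n| ^+ 2) n - series (fun n => `|(x - y) n| ^+ 2) n
   + 'i * series (fun n => `|(x + 'i *: y) n| ^+ 2) n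
   - 'i * series (fun n => `|(x - 'i *: y) n| ^+ 2) n).
  apply/funext => n; rewrite !seriesEord /= !mulr_sumr -!sumrB -big_split /=.
  rewrite -sumrB mulr_sumr; apply: eq_bigr => i _.
  by rewrite -polarization mulrA mulVf ?mul1r // pnatr_eq0.
exact: (cvgC_comb xa xb xc xd).
Qed.

Lemma l2ip_eq x y l : series (fun n => ip (x n) (y n)) @ \oo --> (l : Cx R) ->
  l2ip x y = l.
Proof. by move=> xl; apply: cvg_lim. Qed.

Lemma l2ip_linear y : scalar (l2ip^~ y).
Proof.
move=> k x x' /=; apply: l2ip_eq.
have -> : series (fun n => ip ((k *: x + x') n) (y n)) =
    fun n => k * series (fun n => ip (x n) (y n)) n
      + series (fun n => ip (x' n) (y n)) n.
  apply/funext => n; rewrite !seriesEord /= mulr_sumr -big_split /=.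
  by apply: eq_bigr => i _; rewrite ipDl ipZl.
exact: (cvgCD (cvgCZ (@l2ip_cvg x y)) (@l2ip_cvg x' y)).
Qed.

Lemma l2ip_conj x y : l2ip y x = (l2ip x y)^*.
Proof.
apply: l2ip_eq.
have -> : series (fun n => ip (y n) (x n)) =
    fun n => (series (fun n => ip (x n) (y n)) n)^*.
  apply/funext => n; rewrite !seriesEord /= rmorph_sum.
  by apply: eq_bigr => i _; exact: ipC.
exact: (cvg_conj (@l2ip_cvg x y)).
Qed.

Lemma l2ip_linearr x : linear_for (@Num.conj (Cx R) \; *%R) (l2ip x).
Proof.
by move=> k y z /=; rewrite l2ip_conj l2ip_linear rmorphD rmorphM /= -!l2ip_conj.
Qed.

Lemma l2ip_ge x n : (\sum_(i < n) nm (x i) ^+ 2)%:C <= l2ip x x.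
Proof.
have := @l2ip_cvg x x.
have E : series (fun n => ip (x n) (x n)) =
    (fun m => (\sum_(i < m) nm (x i) ^+ 2)%:C).
  apply/funext => m; rewrite seriesEord /= rmorph_sum.
  by apply: eq_bigr => i _; exact: ip_nm.
rewrite E => /[dup] /cvg_Re /= cR c.
have -> : l2ip x x = (complex.Re (l2ip x x))%:C.
  by apply: l2ip_eq; rewrite E; exact: cvg_Creal.
rewrite lecR -(cvg_lim _ cR) //.
apply: (@nondecreasing_cvgn_le _ (fun n => \sum_(i < n) nm (x i) ^+ 2)).
  by apply/nondecreasing_seqP => m; rewrite big_ord_recr /= lerDl exprn_ge0 ?nm_ge0.
by apply/cvg_ex; exists (complex.Re (l2ip x x)).
Qed.

Lemma l2ip_le x (B : R) : (forall n, \sum_(i < n) nm (x i) ^+ 2 <= B) ->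
  complex.Re (l2ip x x) <= B.
Proof.
move=> xB; have /cvg_Re cR := @l2ip_cvg x x.
rewrite -(cvg_lim _ cR) //; apply: limr_le.
  by apply/cvg_ex; exists (complex.Re (l2ip x x)).
apply: nearW => n; apply: le_trans (xB n); rewrite seriesEord /=.
rewrite (_ : \sum_(k < n) _ = (\sum_(i < n) nm (x i) ^+ 2)%:C) //.
by rewrite rmorph_sum; apply: eq_bigr => i _; exact: ip_nm.
Qed.

Lemma l2ip_gt0 x : x != 0 -> 0 < l2ip x x.
Proof.
move=> x0; have [n xn] : exists n, x n != 0.
  apply: contrapT => H0; move/eqP: x0; apply; apply: l2_ext => n.
  by apply/eqP; apply: contrapT => /negP ?; apply: H0; exists n.
apply: lt_le_trans (l2ip_ge x n.+1); rewrite ltcR big_ord_recr /=.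
apply: ltr_wpDl; first by apply: sumr_ge0 => i _; rewrite exprn_ge0 ?nm_ge0.
rewrite exprn_gt0 // lt_neqAle nm_ge0 andbT eq_sym; apply/eqP => /nm_eq0/eqP.
exact/negP.
Qed.

HB.instance Definition _ := bilinear_isBilinear.Build (Cx R) (l2seq H) (l2seq H)
  (Cx R) *%R (@Num.conj (Cx R) \; *%R) l2ip (l2ip_linear, l2ip_linearr).

Lemma l2ip_herm x y : l2ip x y = (-1) ^+ false * (l2ip y x)^*.
Proof. by rewrite expr0 mul1r l2ip_conj. Qed.

HB.instance Definition _ := isHermitianSesquilinear.Build (Cx R) (l2seq H) false
  (@Num.conj (Cx R)) l2ip l2ip_herm.

HB.instance Definition _ := isDotProduct.Build (Cx R) (l2seq H) l2ip l2ip_gt0.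

Definition l2norm x : Cx R := sqrtC (l2ip x x).

Lemma l2norm_sqr x : l2norm x ^+ 2 = l2ip x x.
Proof. by rewrite sqrtCK. Qed.

Lemma l2norm_ge0 x : 0 <= l2norm x.
Proof. by rewrite sqrtC_ge0 (dnorm_ge0 l2ip). Qed.

Lemma l2norm0_eq0 x : l2norm x = 0 -> x = 0.
Proof.
by move=> /(congr1 (fun u => u ^+ 2)); rewrite l2norm_sqr expr0n /= => /eqP;
  rewrite (dnorm_eq0 l2ip) => /eqP.
Qed.

Lemma l2normZ (k : Cx R) x : l2norm (k *: x) = `|k| * l2norm x.
Proof.
apply/eqP; rewrite -(@eqrXn2 _ 2) ?mulr_ge0 ?l2norm_ge0 ?normr_ge0 //.
by rewrite exprMn !l2norm_sqr (dnormZ l2ip).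
Qed.

Lemma l2normD x y : l2norm (x + y) <= l2norm x + l2norm y.
Proof.
rewrite -(@ler_pXn2r _ 2) ?nnegrE ?addr_ge0 ?l2norm_ge0 //.
rewrite sqrrD !l2norm_sqr (dnormD l2ip) /= conj_Re addrAC lerD2r lerD2l.
have aR z : l2norm z = (complex.Re (l2norm z))%:C.
  by rewrite RRe_real // ger0_real // l2norm_ge0.
have nE z : complex.Re (l2ip z z) = complex.Re (l2norm z) ^+ 2.
  by rewrite -l2norm_sqr aR -rmorphXn.
have n0 z : 0 <= complex.Re (l2norm z) by rewrite -ler0c -aR l2norm_ge0.
have := dot_CS l2ip x y; rewrite !nE -exprMn ler_pXn2r ?nnegrE ?mulr_ge0 ?nm_ge0 //.
move=> /(le_trans (Re_le_nm _)).
rewrite aR [l2norm y]aR -rmorphM -rmorphMn /= lecR.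
by move=> cs; lra.
Qed.

HB.instance Definition _ := Lmodule_isNormed.Build (Cx R) (l2seq H)
  l2normD l2normZ l2norm0_eq0.

Lemma l2_nm x : nm x ^+ 2 = complex.Re (l2ip x x).
Proof.
by rewrite -l2norm_sqr -[X in complex.Re (X ^+ 2)]/`|x| nmE -rmorphXn.
Qed.

Lemma nm_coord x n : nm (x n) <= nm x.
Proof.
rewrite -(@ler_pXn2r _ 2) ?nnegrE ?nm_ge0 // l2_nm -lecR -dot_Re.
apply: le_trans (l2ip_ge x n.+1); rewrite lecR big_ord_recr /= lerDr.
by apply: sumr_ge0 => i _; rewrite exprn_ge0 ?nm_ge0.
Qed.

Lemma l2_nm_le x (B : R) : 0 <= B ->
  (forall n, \sum_(i < n) nm (x i) ^+ 2 <= B ^+ 2) -> nm x <= B.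
Proof.
move=> B0 xB; rewrite -(@ler_pXn2r _ 2) ?nnegrE ?nm_ge0 // l2_nm.
exact: l2ip_le.
Qed.

Lemma l2_cauchy_cvg (u : nat -> l2seq H) :
  (forall e : R, 0 < e -> exists N, forall m n, (N <= m)%N -> (N <= n)%N ->
     nm (u m - u n) < e) -> exists l : l2seq H, u @ \oo --> l.
Proof.
move=> uC.
have /choice[v uv] : forall i, exists v : H, (fun n => u n i) @ \oo --> v.
  move=> i; apply: nm_cauchy_cvg => e /uC[N HN]; exists N => m n Nm Nn.
  by apply: le_lt_trans (HN m n Nm Nn); exact: (nm_coord (u m - u n)).
(* For a partial sum of fixed length k one may let n tend to infinity, and the resulting bound does
   not depend on k. *)
have key (e : R) N : 0 < e -> (forall m n, (N <= m)%N -> (N <= n)%N ->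
     nm (u m - u n) < e) -> forall m k, (N <= m)%N ->
     \sum_(i < k) nm (u m i - v i) ^+ 2 <= e ^+ 2.
  move=> e0 HN m k Nm.
  have c : (fun n => \sum_(i < k) nm (u m i - u n i) ^+ 2) @ \oo -->
      \sum_(i < k) nm (u m i - v i) ^+ 2.
    apply: (@cvg_sum_ord R R _ _ _ k (fun i n => nm (u m i - u n i) ^+ 2)
      (fun i => nm (u m i - v i) ^+ 2)) => i.
    rewrite expr2; under eq_fun do rewrite expr2.
    have h : (fun n => u m i - u n i) @ \oo --> u m i - v i.
      by apply: cvgB; [exact: cvg_cst|exact: uv].
    exact: (cvgM (cvg_nm h) (cvg_nm h)).
  rewrite -(cvg_lim _ c) //; apply: limr_le; first by apply/cvg_ex; eexists; exact: c.
  exists N => // n Nn; rewrite /=.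
  have /ltW := HN m n Nm Nn; rewrite -(@ler_pXn2r _ 2) ?nnegrE ?nm_ge0 ?(ltW e0) //.
  apply: le_trans; rewrite l2_nm -lecR -dot_Re.
  exact: (l2ip_ge (u m - u n) k).
have [N1 HN1] := uC 1 ltr01.
have vS : cvgn (series (fun n => `|u N1 n - v n| ^+ 2)).
  by apply/l2P; exists (1 ^+ 2) => n; exact: (key 1 N1).
(* [vS] says that u N1 - v is square-summable, so the coordinatewise limit v enters [l2seq H] as a
   difference. *)
pose w := u N1 - L2Seq vS.
have wv i : w i = v i by rewrite /= opprB addrC subrK.
exists w; apply/nm_cvgn => e e0.
have e2 : 0 < e / 2 by rewrite divr_gt0.
have [N HN] := uC _ e2; exists N => m Nm.
have : nm (u m - w) <= e / 2.
  apply: l2_nm_le; first exact: ltW.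
  move=> n; have := key _ N e2 HN m n Nm.
  by under [X in _ -> X <= _]eq_bigr do rewrite -[(u m - w) _]/(u m _ - w _) wv.
by move=> /le_lt_trans; apply; rewrite gtr_pMr // invf_lt1 // ltr1n.
Qed.

End SquareSummable.

(** A Cauchy filter contains balls of radius 1/(n+1); their centres form a Cauchy sequence, whose
    limit is the limit of the filter. *)
Lemma cauchy_seq_complete (R : realType) (V : normedModType (Cx R)) :
  (forall u : nat -> V,
    (forall e : R, 0 < e -> exists N, forall m n, (N <= m)%N -> (N <= n)%N ->
       nm (u m - u n) < e) -> exists l : V, u @ \oo --> l) ->
  forall F : set_system V, ProperFilter F -> cauchy F -> cvg F.
Proof.
move=> VC F FF /cauchyP FC.
have FC' (e : R) : 0 < e -> exists x, F [set y | nm (x - y) < e].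
  move=> e0; have [|x Fx] := FC e%:C; first by rewrite ltcR.
  exists x; move: Fx; apply: filterS => y.
  by rewrite -ball_normE /= nmE ltcR.
have /choice[u Fu] : forall n, exists x, F [set y | nm (x - y) < n.+1%:R^-1].
  by move=> n; apply: FC'; rewrite invr_gt0.
have half (e : R) : 0 < e -> 0 < e / 2 by move=> e0; rewrite divr_gt0.
have [|l ul] := VC u.
  move=> e /half/harmonic_lt[N HN]; exists N => m n Nm Nn.
  have [y [ym yn]] := filter_ex (filterI (Fu m) (Fu n)).
  have := nmD (u m - y) (y - u n); rewrite subrKA (nm_distC y).
  move=> /le_lt_trans; apply; rewrite [ltRHS]splitr.
  by apply: ltrD; [exact: lt_trans ym (HN _ Nm)|exact: lt_trans yn (HN _ Nn)].
apply/cvg_ex; exists l; apply/nm_cvg => e /half e0.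
have /nm_cvgn/(_ _ e0)[N1 H1] := ul; have [N2 H2] := harmonic_lt e0.
pose N := maxn N1 N2; move: (Fu N); apply: filterS => y /= yN.
have := nmD (y - u N) (u N - l); rewrite subrKA (nm_distC y (u N)) => /le_lt_trans; apply.
rewrite [ltRHS]splitr; apply: ltrD.
  by apply: lt_trans yN _; apply: H2; rewrite leq_maxr.
by apply: H1; rewrite leq_maxl.
Qed.

HB.instance Definition _ (R : realType) (H : hilbert R) :=
  Uniform_isComplete.Build (l2seq H) (cauchy_seq_complete (@l2_cauchy_cvg R H)).

Section Ell2.
Variable R : realType.

Lemma l2ip_norm (H : hilbert R) (x : l2seq H) : l2ip x x = `|x| ^+ 2.
Proof. by rewrite -l2norm_sqr. Qed.

Definition ell2 (H : hilbert R) : hilbert R := Hilbert (@l2ip_norm H).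

End Ell2.

(** * Spans, bounded operators and the Riesz theorem *)

Section Span.
Variables (R : realType) (H : hilbert R).

Definition subspace (M : set H) : Prop :=
  M 0 /\ forall (k : Cx R) x y, M x -> M y -> M (k *: x + y).

Lemma subspace_sum (M : set H) n (k : 'I_n -> Cx R) (x : 'I_n -> H) :
  subspace M -> (forall i, M (x i)) -> M (\sum_(i < n) k i *: x i).
Proof.
move=> [M0 Ml] Mx; elim/big_ind : _ => // [u v Mu Mv|i _].
  by rewrite -[u]scale1r; exact: Ml.
by rewrite -[_ *: _]addr0; exact: Ml.
Qed.

Lemma lspan_subspace (A : set H) : subspace (lspan A).
Proof.
split; first by exists 0%N, (fun=> 0), (fun=> 0); split=> [[]//|]; rewrite big_ord0.
move=> k _ _ [n [a [x [Ax ->]]]] [m [b [y [Ay ->]]]].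
exists (n + m)%N,
  (fun i : 'I_(n + m) => match fintype.split i with inl i => k * a i | inr i => b i end),
  (fun i : 'I_(n + m) => match fintype.split i with inl i => x i | inr i => y i end).
split=> [i|]; first by case: (fintype.split i).
rewrite big_split_ord /= scaler_sumr; congr (_ + _).
  by apply: eq_bigr => i _; rewrite -[lshift m i]/(unsplit (inl i)) unsplitK scalerA.
by apply: eq_bigr => i _; rewrite -[rshift n i]/(unsplit (inr i)) unsplitK.
Qed.

Lemma lspan_incl (A : set H) : A `<=` lspan A.
Proof.
move=> x Ax; exists 1%N, (fun=> 1), (fun=> x); split => //.
by rewrite big_ord1 scale1r.
Qed.

Lemma lspan_min (A M : set H) : subspace M -> A `<=` M -> lspan A `<=` M.
Proof. by move=> sM AM _ [n [k [x [Ax ->]]]]; apply: subspace_sum => // i; exact: AM. Qed.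

End Span.

Section Bounded.
Variable R : realType.
Implicit Types H K L : hilbert R.

Lemma bop_bounded H K (T : bop H K) :
  exists2 c : R, 0 < c & forall x, nm (T x) <= c * nm x.
Proof.
have /nm_cvg/(_ 1 ltr01) : T @ 0 --> T 0 by exact: bop_continuous.
move=> /nbhs_ballP[e /= e0 eT].
have eE : e = (complex.Re e)%:C by rewrite RRe_real // gtr0_real.
set r := complex.Re e in eE; have r0 : 0 < r by rewrite -ltcR -eE.
(* A nonzero vector rescaled to norm r / 2 lies in the ball, so its image has norm less than 1. *)
exists (2 / r) => [|x]; first by rewrite divr_gt0.
have [->|x0] := eqVneq x 0; first by rewrite linear0 !nm0 mulr0.
have xp : 0 < nm x.
  by rewrite lt_neqAle nm_ge0 andbT eq_sym; apply/eqP => /nm_eq0/eqP; exact/negP.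
pose k := r / (2 * nm x).
have k0 : 0 < k by rewrite divr_gt0 // mulr_gt0.
have /eT : ball 0 e (k%:C *: x).
  rewrite -ball_normE /= sub0r normrN nmE nmZ nm_real gtr0_norm // eE ltcR.
  have -> : k * nm x = r / 2 by rewrite /k; field; rewrite gt_eqF.
  by rewrite gtr_pMr // invf_lt1 // ltr1n.
rewrite /= linear0 subr0 linearZ_LR /= nmZ nm_real gtr0_norm // => h.
have -> : 2 / r * nm x = k^-1 by rewrite /k; field; rewrite !gt_eqF.
by rewrite -[leRHS]mul1r ler_pdivlMr // mulrC ltW.
Qed.

Lemma bounded_continuous H K (f : H -> K) (c : R) :
  linear f -> (forall x, nm (f x) <= c * nm x) -> continuous f.
Proof.
move=> fl fc x; apply/nm_cvg => e e0.
have fB y z : f (y - z) = f y - f z by rewrite addrC -scaleN1r fl scaleN1r addrC.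
have c0 : 0 < `|c| + 1 by rewrite ltr_pwDr.
have := (@cvg_id _ (nbhs x)) => /nm_cvg/(_ (e / (`|c| + 1)) (divr_gt0 e0 c0)).
apply: filterS => y /=; rewrite ltr_pdivlMr // -fB => h.
apply: le_lt_trans h; apply: le_trans (fc _) _; rewrite mulrC.
by apply: ler_wpM2l; [exact: nm_ge0|rewrite (le_trans (ler_norm c)) // lerDl].
Qed.

Definition mkbop H K (f : H -> K) (c : R) (fl : linear f)
  (fc : forall x, nm (f x) <= c * nm x) : bop H K :=
  Bop fl (bounded_continuous fl fc).

Lemma bop_dense_eq H K (A : set H) (S T : bop H K) : closure A = setT ->
  (forall x, A x -> S x = T x) -> S = T.
Proof.
move=> Ad ST; apply: bop_ext => x.
have /closure_seq[u Au ux] : closure A x by rewrite Ad.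
have Su : S \o u @ \oo --> S x by apply: cvg_comp ux _; exact: bop_continuous.
have Tu : T \o u @ \oo --> T x by apply: cvg_comp ux _; exact: bop_continuous.
have E : S \o u = T \o u by apply/funext => n /=; rewrite ST.
by rewrite E in Su; exact: nm_cvg_unique Su Tu.
Qed.

Lemma cvg_bop H K (T : bop H K) A (F : set_system A) {FF : Filter F} (u : A -> H) x :
  u @ F --> x -> (fun n => T (u n)) @ F --> T x.
Proof. by move=> ux; apply: cvg_comp ux _; exact: bop_continuous. Qed.

End Bounded.

Section Riesz.
Variables (R : realType) (H : hilbert R).

(* The functional [v |-> |v|^2 - 2 Re (f v)] on [M] is bounded below; a nearly
   minimal [v] nearly represents [f], and such [v] form a Cauchy sequence. *)
Lemma riesz_on (M : set H) (f : H -> Cx R) (c : R) :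
  subspace M -> scalar f -> (forall x, M x -> nm (f x) <= c * nm x) ->
  exists2 w, closure M w & forall m, M m -> f m = ip m w.
Proof.
move=> [M0 Ml] fl fc.
pose J v := nm v ^+ 2 - 2 * complex.Re (f v).
pose E := [set J v | v in M].
(* Completing the square: t^2 - 2 c t >= - c^2. *)
have JE v : M v -> - c ^+ 2 <= J v.
  move=> Mv; rewrite /J; have := le_trans (Re_le_nm (f v)) (fc _ Mv).
  by have := sqr_ge0 (nm v - c); rewrite !expr2; lra.
have Ei : has_inf E.
  by split; [exists (J 0), 0|exists (- c ^+ 2) => _ [v Mv <-]; exact: JE].
have near_min v (e : R) : 0 < e -> M v -> J v < inf E + e ^+ 2 ->
    forall u, M u -> nm (f u - ip u v) <= e * nm u.
  move=> e0 Mv Jv u Mu; have [->|u0] := eqVneq u 0.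
    have f0 : f 0 = 0.
      by have := fl (-1) 0 0; rewrite scaler0 add0r mulN1r addNr.
    by rewrite f0 ip0l subrr !nm0 mulr0.
  have up : 0 < nm u.
    by rewrite lt_neqAle nm_ge0 andbT eq_sym; apply/eqP => /nm_eq0/eqP; exact/negP.
  (* This k minimizes the functional on the line v + k u; the value drops by |d|^2 / |u|^2, which
     near minimality bounds by e^2. *)
  set d := f u - ip u v; pose k := (nm u ^- 2)%:C * d^*.
  have : inf E <= J (k *: u + v).
    by apply: ge_inf; [case: Ei|exists (k *: u + v) => //; exact: Ml].
  rewrite /J nm_sqrD nmZ ipZl fl !ReD.
  have -> : complex.Re (k * ip u v) = complex.Re (k * f u) - complex.Re (k * d).
    by rewrite -ReN -ReD; congr complex.Re; rewrite /d; ring.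
  have -> : complex.Re (k * d) = nm u ^- 2 * nm d ^+ 2.
    rewrite /k -mulrA [d^* * d]mulrC -normCK nmE.
    by rewrite -rmorphXn -rmorphM.
  rewrite /k nmM nm_conj nm_real ger0_norm ?invr_ge0 ?exprn_ge0 ?nm_ge0 //.
  have -> : (nm u ^- 2 * nm d * nm u) ^+ 2 = nm u ^- 2 * nm d ^+ 2.
    by field; rewrite gt_eqF.
  move: Jv; rewrite /J => Jv h.
  have {h} : nm u ^- 2 * nm d ^+ 2 <= e ^+ 2 by lra.
  rewrite mulrC ler_pdivrMr ?exprn_gt0 // -exprMn.
  by rewrite ler_pXn2r ?nnegrE ?mulr_ge0 ?nm_ge0 ?(ltW e0).
have cauchy v v' (e e' : R) : 0 < e -> 0 < e' -> M v -> M v' ->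
    (forall u, M u -> nm (f u - ip u v) <= e * nm u) ->
    (forall u, M u -> nm (f u - ip u v') <= e' * nm u) ->
    nm (v - v') <= e + e'.
  move=> e0 e0' Mv Mv' Hv Hv'; set u := v - v'.
  have Mu : M u by rewrite /u addrC -scaleN1r; exact: Ml.
  have [u0|u0] := leP (nm u) 0; first by rewrite (le_trans u0) // addr_ge0 ?ltW.
  rewrite -(ler_pM2r u0) -expr2 nm_ip.
  have -> : ip u u = (f u - ip u v') - (f u - ip u v).
    by rewrite {2}/u ipBr; ring.
  apply: le_trans (Re_le_nm _) _; apply: le_trans (nmB _ _) _.
  by rewrite mulrDl addrC lerD ?Hv ?Hv'.
have i0 n : 0 < n.+1%:R^-1 :> R by rewrite invr_gt0.
have /choice[v Hv] : forall n : nat, exists v, M v /\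
    forall u, M u -> nm (f u - ip u v) <= n.+1%:R^-1 * nm u.
  move=> n; have [|_ [v Mv <-] Jv] := inf_adherent _ Ei (eps := n.+1%:R^-1 ^+ 2).
    by rewrite exprn_gt0.
  by exists v; split=> //; exact: near_min.
have [|w vw] := @nm_cauchy_cvg R H v.
  move=> e e0; have [N HN] := harmonic_lt (divr_gt0 e0 (ltr0n R 2)).
  exists N => m n Nm Nn; have [[Mm Hm] [Mn Hn]] := (Hv m, Hv n).
  apply: le_lt_trans (cauchy _ _ _ _ (i0 m) (i0 n) Mm Mn Hm Hn) _.
  by rewrite [ltRHS]splitr ltrD ?HN.
exists w; first by apply/closure_seq; exists v => // n; have [] := Hv n.
move=> m Mm.
have c1 : (fun n => ip m (v n)) @ \oo --> (ip m w : Cx R) by exact: cvg_ipr.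
apply/esym; apply: (cvgC_unique c1).
apply: (@nm_cvgn_dist _ _ _ _ (fun n => n.+1%:R^-1 * nm m)).
  by move=> n; rewrite nm_distC; have [_] := Hv n; apply.
by rewrite -[0 in X in _ --> X](mul0r (nm m)); apply: cvgMr_tmp; exact: cvg_harmonic.
Qed.

(** The projection is the vector of [closure M] representing the functional <m, x> on [M]. *)
Lemma orthogonal_projection (M : set H) (x : H) : subspace M ->
  exists2 p, closure M p & forall m, M m -> ip m (x - p) = 0.
Proof.
move=> sM; have [||w Mw Hw] := @riesz_on M (fun m => ip m x) (nm x) sM.
- by move=> k y z; rewrite ipDl ipZl.
- by move=> m _; rewrite mulrC ip_CS.
by exists w => // m /Hw; rewrite ipBr => ->; rewrite subrr.
Qed.

Lemma dense_of_orthogonal (M : set H) : subspace M ->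
  (forall x, (forall m, M m -> ip m x = 0) -> x = 0) -> closure M = setT.
Proof.
move=> sM M0; apply/seteqP; split => // x _.
have [p Mp /M0/eqP] := orthogonal_projection x sM.
by rewrite subr_eq0 => /eqP ->.
Qed.

Lemma riesz (f : H -> Cx R) (c : R) : scalar f ->
  (forall x, nm (f x) <= c * nm x) -> exists w, forall x, f x = ip x w.
Proof.
move=> fl fc; have [||w _ Hw] := @riesz_on setT f c _ fl; [by split|by []|].
by exists w => x; apply: Hw.
Qed.

End Riesz.

(** * Operators defined by bounded relations, and adjoints *)

Section Relations.
Variable R : realType.
Implicit Types H K L : hilbert R.

(** A densely defined operator is given here by its graph, so that an operator prescribed on sums or
    orbits needs no separate proof of well-definedness: the bound provides it. *)
Lemma bop_of_relation H K (Gamma : H -> K -> Prop) (c : R) :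
  (forall k x x' y y', Gamma x y -> Gamma x' y' -> Gamma (k *: x + x') (k *: y + y')) ->
  (forall x y, Gamma x y -> nm y <= c * nm x) ->
  closure [set x | exists y, Gamma x y] = setT ->
  exists Q : bop H K, forall x y, Gamma x y -> Q x = y.
Proof.
move=> Gl Gc Gd.
(* The closure of the graph: single-valued by the bound, everywhere defined by density and the
   completeness of K. *)
pose Lim (x : H) (y : K) := exists u v, [/\ forall n, Gamma (u n) (v n),
  u @ \oo --> x & v @ \oo --> y].
have LimL k x x' y y' : Lim x y -> Lim x' y' -> Lim (k *: x + x') (k *: y + y').
  move=> [u [v [G ux vy]]] [u' [v' [G' ux' vy']]].
  exists (fun n => k *: u n + u' n), (fun n => k *: v n + v' n); split.
  - by move=> n; exact: Gl.
  - by apply: cvgD => //; exact: cvgZl_tmp.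
  - by apply: cvgD => //; exact: cvgZl_tmp.
have LimC x y : Lim x y -> nm y <= c * nm x.
  move=> [u [v [G /cvg_nm ux /cvg_nm vy]]].
  have cu : (fun n => c * nm (u n)) @ \oo --> c * nm x by exact: cvgMl_tmp.
  rewrite -(cvg_lim _ vy) // -(cvg_lim _ cu) //; apply: ler_lim.
  - by apply/cvg_ex; eexists; exact: vy.
  - by apply/cvg_ex; eexists; exact: cu.
  - by apply: nearW => n; exact: Gc.
have GB x x' y y' : Gamma x y -> Gamma x' y' -> Gamma (x - x') (y - y').
  by move=> G G'; have := Gl (-1) _ _ _ _ G' G; rewrite !scaleN1r addrC [- y' + y]addrC.
have /choice[Q HQ] : forall x, exists y, Lim x y.
  move=> x; have : closure [set x | exists y, Gamma x y] x by rewrite Gd.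
  move=> /closure_seq[u /choice[v Huv] ux].
  have [|y vy] := @nm_cauchy_cvg R K v; last by exists y, u, v.
  move=> e e0; have c0 : 0 < `|c| + 1 by rewrite ltr_pwDr.
  have d0 : 0 < e / (2 * (`|c| + 1)) by rewrite divr_gt0 // mulr_gt0.
  have /nm_cvgn/(_ _ d0)[N HN] := ux; exists N => m n Nm Nn.
  apply: le_lt_trans (Gc _ _ (GB _ _ _ _ (Huv m) (Huv n))) _.
  have h : nm (u m - u n) < e / (`|c| + 1).
    have := nmD (u m - x) (x - u n); rewrite subrKA (nm_distC x).
    move=> /le_lt_trans; apply.
    have -> : e / (`|c| + 1) = e / (2 * (`|c| + 1)) + e / (2 * (`|c| + 1)).
      by field; rewrite gt_eqF.
    by rewrite ltrD ?HN.
  move: h; rewrite ltr_pdivlMr // mulrC; apply: le_lt_trans.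
  by rewrite ler_wpM2r ?nm_ge0 // (le_trans (ler_norm c)) // lerDl.
have QE x y : Lim x y -> Q x = y.
  move=> L; have := LimC _ _ (LimL (-1) _ _ _ _ L (HQ x)).
  rewrite !scaleN1r addNr nm0 mulr0 => h; apply/eqP; rewrite -subr_eq0 addrC.
  by apply/eqP/nm_eq0/eqP; rewrite eq_le h nm_ge0.
have Ql : linear Q by move=> k x y; apply: QE; exact: LimL.
exists (mkbop Ql (fun x => LimC _ _ (HQ x))) => x y G; apply: QE.
by exists (fun=> x), (fun=> y); split=> //; exact: cvg_cst.
Qed.

Lemma adjoint_exists H K (T : bop H K) : exists T' : bop K H, is_adjoint T T'.
Proof.
have [c c0 cT] := bop_bounded T.
have /choice[S HS] : forall y, exists w, forall x, ip (T x) y = ip x w.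
  move=> y; apply: (@riesz _ _ _ (c * nm y)) => [k x z|x].
    by rewrite linearP ipDl ipZl.
  by rewrite (le_trans (ip_CS _ _)) // mulrAC ler_wpM2r ?nm_ge0.
have Sl : linear S.
  move=> k y z; apply: ip_injr => x.
  by rewrite -HS !ipDr !ipZr -!HS.
have Sc y : nm (S y) <= c * nm y.
  have [Sy0|Sy0] := leP (nm (S y)) 0.
    by rewrite (le_trans Sy0) // mulr_ge0 ?nm_ge0 ?ltW.
  rewrite -(ler_pM2r Sy0) -expr2 nm_ip -HS.
  rewrite (le_trans (Re_le_nm _)) // (le_trans (ip_CS _ _)) //.
  by rewrite mulrAC ler_wpM2r ?nm_ge0.
by exists (mkbop Sl Sc) => x y; exact: HS.
Qed.

End Relations.

Section Adjoint.
Variable R : realType.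
Implicit Types H K L : hilbert R.

Definition adj H K (T : bop H K) : bop K H := projT1 (cid (adjoint_exists T)).

Lemma adjP H K (T : bop H K) : is_adjoint T (adj T).
Proof. exact: projT2 (cid (adjoint_exists T)). Qed.

Lemma adjPl H K (T : bop H K) x y : ip (adj T x) y = ip x (T y).
Proof. by rewrite (is_adjoint_sym (@adjP _ _ T)). Qed.

Lemma is_adjoint_unique H K (T : bop H K) (S S' : bop K H) :
  is_adjoint T S -> is_adjoint T S' -> S = S'.
Proof. by move=> h h'; apply: bop_ext => y; apply: ip_injr => x; rewrite -h h'. Qed.

Lemma is_adjoint_comp H K L (S : bop K L) (T : bop H K) S' T' :
  is_adjoint S S' -> is_adjoint T T' -> is_adjoint (S *b T) (T' *b S').
Proof. by move=> h h' x y /=; rewrite h h'. Qed.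

Lemma adjoint_intertwine H K (T : bop H K) (S : bop H H) (S1 : bop K K)
    (T' : bop K H) (S' : bop H H) (S1' : bop K K) :
  is_adjoint T T' -> is_adjoint S S' -> is_adjoint S1 S1' ->
  T *b S = S1 *b T -> S' *b T' = T' *b S1'.
Proof.
move=> hT hS hS1 E; apply: (is_adjoint_unique (is_adjoint_comp hT hS)).
by rewrite E; exact: is_adjoint_comp.
Qed.

Lemma adjoint_bound H K (T : bop H K) (T' : bop K H) (c : R) :
  is_adjoint T T' -> 0 <= c -> (forall x, nm (T x) <= c * nm x) ->
  forall y, nm (T' y) <= c * nm y.
Proof.
move=> TT' c0 cT y; have [Sy0|Sy0] := leP (nm (T' y)) 0.
  by rewrite (le_trans Sy0) // mulr_ge0 ?nm_ge0.
rewrite -(ler_pM2r Sy0) -expr2 nm_ip -TT'.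
rewrite (le_trans (Re_le_nm _)) // (le_trans (ip_CS _ _)) //.
by rewrite mulrAC ler_wpM2r ?nm_ge0.
Qed.

Lemma bop_closure_lspan H K (T : bop H K) (A : set H) (B : set K) :
  (forall x, A x -> B (T x)) ->
  forall x, closure (lspan A) x -> closure (lspan B) (T x).
Proof.
move=> AB x /closure_seq[u Au ux]; apply/closure_seq.
exists (T \o u); last by apply: cvg_bop.
move=> n /=; have [m [k [y [Ay ->]]]] := Au n.
exists m, k, (T \o y); split=> [i|]; first exact: AB.
by rewrite linear_sum; apply: eq_bigr => i _; rewrite linearZ_LR.
Qed.

End Adjoint.

(** * Amplifications of operators and coordinate embeddings *)

Section Ell2Operators.
Variable R : realType.
Implicit Types H K : hilbert R.

Lemma ell2_ip H (x y : ell2 H) : ip x y = l2ip x y.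
Proof. by []. Qed.

Lemma amp_summable H K (T : bop H K) (x : l2seq H) :
  cvgn (series (fun n => `|T (x n)| ^+ 2)).
Proof.
have [c c0 cT] := bop_bounded T; have [B xB] := l2_bound x.
apply/l2P; exists (c ^+ 2 * B) => n.
apply: le_trans (ler_wpM2l (exprn_ge0 _ (ltW c0)) (xB n)).
rewrite mulr_sumr; apply: ler_sum => i _; rewrite -exprMn.
by rewrite ler_pXn2r ?nnegrE ?mulr_ge0 ?nm_ge0 // ltW.
Qed.

Definition amp_fun H K (T : bop H K) (x : ell2 H) : ell2 K :=
  L2Seq (@amp_summable H K T x).

Lemma amp_linear H K (T : bop H K) : linear (amp_fun T).
Proof. by move=> k x y; apply: l2_ext => n /=; rewrite linearP. Qed.

Lemma sum_nm_le H (x : l2seq H) n : \sum_(i < n) nm (x i) ^+ 2 <= nm x ^+ 2.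
Proof. by rewrite l2_nm -lecR -dot_Re l2ip_ge. Qed.

Lemma amp_continuous H K (T : bop H K) : continuous (amp_fun T).
Proof.
have [c c0 cT] := bop_bounded T.
apply: (@bounded_continuous R _ _ _ c (@amp_linear H K T)) => x.
apply: l2_nm_le => [|n]; first by rewrite mulr_ge0 ?nm_ge0 ?ltW.
rewrite exprMn; apply: le_trans (ler_wpM2l (exprn_ge0 _ (ltW c0)) (sum_nm_le x n)).
rewrite mulr_sumr; apply: ler_sum => i _; rewrite -exprMn.
by rewrite ler_pXn2r ?nnegrE ?mulr_ge0 ?nm_ge0 ?(ltW c0) //; exact: cT.
Qed.

Definition amp H K (T : bop H K) : bop (ell2 H) (ell2 K) :=
  Bop (@amp_linear H K T) (@amp_continuous H K T).

Lemma ampE H K (T : bop H K) (x : ell2 H) n : (amp T x : l2seq K) n = T ((x : l2seq H) n).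
Proof. by []. Qed.

Lemma amp_comp H K L (S : bop K L) (T : bop H K) : amp (S *b T) = amp S *b amp T.
Proof. by apply: bop_ext => x; apply: l2_ext. Qed.

Lemma amp_adjoint H K (T : bop H K) (T' : bop K H) :
  is_adjoint T T' -> is_adjoint (amp T) (amp T').
Proof.
move=> TT' x y; rewrite !ell2_ip /l2ip; congr (limn (series _)).
by apply/funext => n; rewrite TT'.
Qed.

(** Holds by computation: sigma-weak functionals on [H] are vector functionals on [ell2 H]. This
    turns normality into a question about vectors. *)
Lemma sw_functionalE H (x y : ell2 H) (T : bop H H) :
  sw_functional x y T = ip (amp T x) y.
Proof. by []. Qed.

Lemma inc_summable H n (h : H) :
  cvgn (series (fun m => `|if m == n then h else 0| ^+ 2)).
Proof.
apply/l2P; exists (nm h ^+ 2) => m.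
have [nm_|mn] := ltnP n m.
  rewrite (bigD1 (Ordinal nm_)) //= eqxx big1 ?addr0 // => i /negbTE.
  by rewrite -val_eqE /= => ->; rewrite nm0 expr0n.
rewrite big1 ?exprn_ge0 ?nm_ge0 // => i _.
by rewrite ltn_eqF ?nm0 ?expr0n // (leq_trans (ltn_ord i)).
Qed.

Definition inc_fun H n (h : H) : ell2 H := L2Seq (@inc_summable H n h).

Lemma inc_linear H n : linear (@inc_fun H n).
Proof.
move=> k x y; apply: l2_ext => m /=; case: eqP => // _.
by rewrite scaler0 addr0.
Qed.

Lemma inc_continuous H n : continuous (@inc_fun H n).
Proof.
apply: (@bounded_continuous R _ _ _ 1 (@inc_linear H n)) => x.
rewrite mul1r; apply: l2_nm_le => [|m]; first exact: nm_ge0.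
have [nm_|mn] := ltnP n m.
  rewrite (bigD1 (Ordinal nm_)) //= eqxx big1 ?addr0 // => i /negbTE.
  by rewrite -val_eqE /= => ->; rewrite nm0 expr0n.
rewrite big1 ?exprn_ge0 ?nm_ge0 // => i _ /=.
by rewrite ltn_eqF ?nm0 ?expr0n // (leq_trans (ltn_ord i)).
Qed.

Definition inc H n : bop H (ell2 H) := Bop (@inc_linear H n) (@inc_continuous H n).

Lemma ip_inc H n (h : H) (y : ell2 H) : ip (inc H n h) y = ip h ((y : l2seq H) n).
Proof.
rewrite ell2_ip; apply: l2ip_eq; apply/nm_cvgn => e e0; exists n.+1 => m nm_.
rewrite seriesEord /= (bigD1 (Ordinal nm_)) //= eqxx big1 => [|i /negbTE].
  by rewrite addr0 subrr nm0.
by rewrite -val_eqE /= => ->; rewrite ip0l.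
Qed.

Lemma amp_inc H K (T : bop H K) n : amp T *b inc H n = inc K n *b T.
Proof.
apply: bop_ext => x; apply: l2_ext => m /=; case: eqP => // _; exact: linear0.
Qed.

(** A vector orthogonal to these generators has every coordinate orthogonal to [A], hence to
    itself. *)
Lemma ell2_dense H (A : set H) : closure (lspan A) = setT ->
  closure (lspan [set x : ell2 H | exists n h, A h /\ x = inc H n h]) = setT.
Proof.
move=> Ad; apply: dense_of_orthogonal; first exact: lspan_subspace.
move=> x x0; apply: l2_ext => n.
have Axn h : A h -> ip h ((x : l2seq H) n) = 0.
  by move=> Ah; rewrite -ip_inc; apply: x0; apply: lspan_incl; exists n, h.
have : closure (lspan A) ((x : l2seq H) n) by rewrite Ad.
move=> /closure_seq[u Au ux].
suff u0 m : ip (u m) ((x : l2seq H) n) = 0.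
  have c : (fun m => ip (u m) ((x : l2seq H) n)) @ \oo -->
      (ip ((x : l2seq H) n) ((x : l2seq H) n) : Cx R) by exact: cvg_ipl.
  have E : (fun m => ip (u m) ((x : l2seq H) n)) = (fun=> 0) by exact/funext.
  rewrite E in c; have /eqP : ip ((x : l2seq H) n) ((x : l2seq H) n) = 0.
    by apply: (cvgC_unique c); exact: cvg_cst.
  by rewrite dnorm_eq0 => /eqP.
have [k [a [y [Ay ->]]]] := Au m; rewrite ip_suml big1 // => i _.
by rewrite ipZl Axn ?mulr0.
Qed.

End Ell2Operators.

(** * The absolute value of an operator *)

Section AbsoluteValue.
Variables (R : realType) (H K : hilbert R).

(* With [X = 1 - T' T], the operator [1 - B] is the limit of [Y 0 = 0],
   [Y (n+1) = (X + (Y n)^2) / 2]: its increments are bounded in norm by those of the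
   increasing scalar sequence [y 0 = 0], [y (n+1) = (1 + (y n)^2) / 2]. *)
Lemma bop_abs (T : bop H K) (T' : bop K H) :
  is_adjoint T T' -> (forall y, nm (T' y) <= nm y) ->
  exists B : bop H H, [/\ is_adjoint B B, B *b B = T' *b T &
    forall C, C *b (T' *b T) = T' *b T *b C -> C *b B = B *b C].
Proof.
move=> TT' T'1; set P := T' *b T; pose X := bid H - P.
have PP : is_adjoint P P.
  by apply: is_adjoint_comp => //; exact: is_adjoint_sym.
have T1 x : nm (T x) <= nm x.
  have := @adjoint_bound R _ _ _ _ 1 (is_adjoint_sym TT') ler01.
  by rewrite -[leRHS]mul1r; apply => y; rewrite mul1r.
(* |X x|^2 = |x|^2 - 2 |T x|^2 + |P x|^2, and |P x| <= |T x| because T' is a contraction. *)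
have X1 x : nm (X x) <= nm x.
  rewrite -(@ler_pXn2r _ 2) ?nnegrE ?nm_ge0 // [X x]/= nm_sqrB.
  have -> : complex.Re (ip x (P x)) = nm (T x) ^+ 2 by rewrite nm_ip TT'.
  have h1 := exprn_ge0 2 (nm_ge0 (T x)).
  have h2 : nm (P x) ^+ 2 <= nm (T x) ^+ 2.
    by rewrite ler_pXn2r ?nnegrE ?nm_ge0 //; exact: T'1.
  by lra.
have XX : is_adjoint X X by move=> x y; rewrite /X /= ipBl ipBr PP.
pose Y := fix Y n : bop H H :=
  if n is m.+1 then (2^-1 : Cx R) *: (X + Y m *b Y m) else 0.
pose y := fix y n : R := if n is m.+1 then 2^-1 * (1 + y m * y m) else 0.
have half : 0 <= 2^-1 :> R by rewrite invr_ge0.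
have nhalf : nm (2^-1 : Cx R) = 2^-1.
  by rewrite (_ : 2^-1 = (2^-1)%:C) ?nm_real ?ger0_norm // fmorphV rmorph_nat.
have y01 n : 0 <= y n <= 1.
  elim: n => [|n /andP[y0 y1]] /=; first by rewrite lexx ler01.
  by apply/andP; split; nra.
have Yc n C : C *b X = X *b C -> C *b Y n = Y n *b C.
  move=> CX; elim: n => [|n IH] /=.
    by apply: bop_ext => x /=; rewrite linear0.
  apply: bop_ext => x /=; rewrite linearZ_LR /= linearD /=; congr (_ *: (_ + _)).
    by have /(congr1 (fun f : bop H H => f x)) := CX.
  have E z : C (Y n z) = Y n (C z).
    by have /(congr1 (fun f : bop H H => f z)) := IH.
  by rewrite !E.
have YX n : X *b Y n = Y n *b X by exact: Yc.
have YY m n : Y m *b Y n = Y n *b Y m by apply: Yc; rewrite YX.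
have Yn n x : nm (Y n x) <= y n * nm x.
  elim: n x => [|n IH] x /=; first by rewrite nm0 mul0r.
  rewrite nmZ nhalf -mulrA ler_wpM2l // mulrDl mul1r.
  apply: le_trans (nmD _ _) _; rewrite lerD ?X1 // (le_trans (IH _)) // -mulrA.
  by have /andP[y0 _] := y01 n; rewrite ler_wpM2l.
(* For commuting A and B, A^2 - B^2 = (A + B)(A - B); hence the increments of Y satisfy the
   recursion of the increments of y. *)
have square_diff (A B : bop H H) x : A *b B = B *b A ->
    (2^-1 : Cx R) *: (X x + A (A x)) - (2^-1 : Cx R) *: (X x + B (B x)) =
    (2^-1 : Cx R) *: (A (A x - B x) + B (A x - B x)).
  move=> /(congr1 (fun f : bop H H => f x)) /= E.
  rewrite -scalerBr; congr (_ *: _).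
  by rewrite !linearB /= E opprD addrACA subrr add0r addrA subrK.
have Yd n x : nm (Y n.+1 x - Y n x) <= (y n.+1 - y n) * nm x.
  elim: n x => [|n IH] x.
    by rewrite /= !subr0 nmZ nhalf mulr0 !addr0 mulr1 ler_wpM2l ?X1.
  have -> : Y n.+2 x - Y n.+1 x =
      (2^-1 : Cx R) *: (Y n.+1 (Y n.+1 x - Y n x) + Y n (Y n.+1 x - Y n x)).
    exact: (square_diff (Y n.+1) (Y n) x (YY _ _)).
  rewrite nmZ nhalf.
  have -> : y n.+2 - y n.+1 = 2^-1 * ((y n.+1 + y n) * (y n.+1 - y n)).
    rewrite -[LHS]/(2^-1 * (1 + y n.+1 * y n.+1) - 2^-1 * (1 + y n * y n)).
    by move: (y n.+1) (y n) => a b; ring.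
  rewrite -!mulrA ler_wpM2l //; apply: le_trans (nmD _ _) _.
  have /andP[a0 _] := y01 n; have /andP[b0 _] := y01 n.+1.
  rewrite mulrDl lerD // (le_trans (Yn _ _)) // ler_wpM2l //; exact: IH.
have Ydd m n x : (m <= n)%N -> nm (Y n x - Y m x) <= (y n - y m) * nm x.
  elim: n => [|n IH]; first by rewrite leqn0 => /eqP ->; rewrite !subrr nm0 mul0r.
  rewrite leq_eqVlt => /predU1P[->|]; first by rewrite !subrr nm0 mul0r.
  rewrite ltnS => /IH h; have := nmD (Y n.+1 x - Y n x) (Y n x - Y m x).
  rewrite subrKA => /le_trans; apply; apply: le_trans (lerD (Yd n x) h) _.
  by rewrite -mulrDl subrKA.
have ynd : nondecreasing_seq y.
  apply/nondecreasing_seqP => n; elim: n => [|n IH] /=.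
    by rewrite mulr0 addr0 mulr1.
  have /andP[a0 _] := y01 n; have /andP[b0 _] := y01 n.+1.
  by rewrite ler_wpM2l // lerD2l ler_pM.
have /cvg_ex[l yl] : cvgn y.
  by apply: nondecreasing_is_cvgn => //; exists 1 => _ [n _ <-]; have /andP[] := y01 n.
have yC (e : R) : 0 < e -> exists N, forall m n, (N <= m)%N -> (m <= n)%N -> y n - y m < e.
  move=> e0; have /cvgrPdist_lt/(_ _ e0)[N _ HN] := yl.
  exists N => m n Nm mn.
  have := HN m Nm; have yln : y n <= l.
    by rewrite -(cvg_lim _ yl) //; apply: nondecreasing_cvgn_le => //; apply/cvg_ex; exists l.
  by move=> /=; have := ler_norm (l - y m); lra.
have /choice[Yl HY] : forall x, exists z : H, (fun n => Y n x) @ \oo --> z.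
  move=> x; apply: nm_cauchy_cvg => e e0.
  have x1 : 0 < nm x + 1 by rewrite ltr_wpDl ?nm_ge0.
  have [N HN] := yC _ (divr_gt0 e0 x1).
  have key m n : (N <= m)%N -> (m <= n)%N -> nm (Y n x - Y m x) < e.
    move=> Nm mn; apply: le_lt_trans (Ydd _ _ x mn) _.
    have := HN m n Nm mn; rewrite ltr_pdivlMr //; apply: le_lt_trans.
    by rewrite ler_wpM2l ?lerDl // subr_ge0 ynd.
  exists N => m n Nm Nn; have [mn|/ltnW nm_] := leqP m n; last exact: key.
  by rewrite nm_distC; exact: key.
have Yll : linear Yl.
  move=> k u v; apply: (nm_cvg_unique (HY _)).
  rewrite (_ : (fun n => _) = fun n => k *: Y n u + Y n v).
    by apply: cvgD => //; exact: cvgZl_tmp.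
  by apply/funext => n; rewrite linearP.
have Yl1 u : nm (Yl u) <= 1 * nm u.
  apply: (nm_cvg_le (HY u)) => n; apply: le_trans (Yn _ _) _.
  by rewrite ler_wpM2r ?nm_ge0 //; have /andP[] := y01 n.
pose Z := mkbop Yll Yl1.
have ZC C : C *b X = X *b C -> C *b Z = Z *b C.
  move=> CX; apply: bop_ext => u /=; apply: (nm_cvg_unique (cvg_bop (T := C) (HY u))).
  rewrite (_ : (fun n => _) = fun n => Y n (C u)); first exact: HY.
  by apply/funext => n; have /(congr1 (fun f : bop H H => f u)) := Yc n C CX.
have YA n : is_adjoint (Y n) (Y n).
  elim: n => [|n IH] u v; first by rewrite /= ip0l ip0r.
  have e w : Y n.+1 w = (2^-1 : Cx R) *: (X w + Y n (Y n w)) by [].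
  rewrite !e ipZl ipZr ipDl ipDr XX !IH; congr (_ * _).
  by rewrite fmorphV rmorph_nat.
have ZA : is_adjoint Z Z.
  move=> u v; apply: (cvgC_unique (cvg_ipl (y := v) (HY u))).
  rewrite (_ : (fun n => _) = fun n => ip u (Y n v)); first exact: cvg_ipr.
  by apply/funext => n; rewrite YA.
(* The limit of the recursion, 2 Z = X + Z^2, says that (1 - Z)^2 = 1 - X = T' T. *)
have ZZ u : 2 *: Z u = X u + Z (Z u).
  have c1 : (fun n => Y n (Y n u)) @ \oo --> Z (Z u).
    apply: (@nm_cvgn_dist _ _ _ _ (fun n => nm (Y n u - Z u) + nm (Y n (Z u) - Z (Z u)))).
      move=> n; have -> : Y n (Y n u) - Z (Z u) =
          Y n (Y n u - Z u) + (Y n (Z u) - Z (Z u)) by rewrite linearB addrA subrK.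
      apply: le_trans (nmD _ _) _; rewrite lerD2r; apply: le_trans (Yn _ _) _.
      by rewrite ler_piMl ?nm_ge0 //; have /andP[] := y01 n.
    have c0 (w : H) (f : nat -> H) : f @ \oo --> w -> (fun n => nm (f n - w)) @ \oo --> 0.
      move=> fw; rewrite -[0 in X in _ --> X](nm0 H) -(subrr w).
      by apply: cvg_nm; apply: cvgB fw _; exact: cvg_cst.
    by rewrite -[0 in X in _ --> X](addr0 0); apply: cvgD; apply: c0; exact: HY.
  have c2 : (fun n => 2 *: Y n.+1 u) @ \oo --> 2 *: Z u.
    by apply: cvgZl_tmp; have := HY u; rewrite -(cvg_shiftS (fun n => Y n u)).
  apply: (nm_cvg_unique c2).
  rewrite (_ : (fun n => _) = fun n => X u + Y n (Y n u)).
    by apply: cvgD c1; exact: cvg_cst.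
  by apply/funext => n /=; rewrite scalerA divff ?scale1r // pnatr_eq0.
exists (bid H - Z); split.
- by move=> u v /=; rewrite ipBl ipBr ZA.
- apply: bop_ext => u.
  rewrite -[LHS]/(u - Z u - Z (u - Z u)) linearB -[RHS]/(T' (T u)).
  have -> : T' (T u) = u - X u by rewrite /X /P /= opprB addrC subrK.
  have -> : X u = 2 *: Z u - Z (Z u) by rewrite ZZ addrK.
  by rewrite scaler_nat mulr2n !opprD !opprK !addrA.
- move=> C CP; have /ZC CZ : C *b X = X *b C.
    apply: bop_ext => u; rewrite -[LHS]/(C (u - P u)) -[RHS]/(C u - P (C u)) linearB.
    by have /(congr1 (fun f : bop H H => f u)) := CP => /= ->.
  apply: bop_ext => u; rewrite -[LHS]/(C (u - Z u)) -[RHS]/(C u - Z (C u)) linearB.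
  by have /(congr1 (fun f : bop H H => f u)) := CZ => /= ->.
Qed.

End AbsoluteValue.

(** * Sigma-weak convergence and normality *)

Section SigmaWeak.
Variable R : realType.

(** The topology is initial for a map into a product, so convergence is tested on each coordinate,
    that is, on each functional. *)
Lemma sigma_weakP (S : choiceType) (H : hilbert R) (v : S -> bop H H)
    (F : set_system S) {FF : Filter F} (s : S) :
  F --> (s : sigma_weak v) <->
  forall x y : l2seq H, (fun a => sw_functional x y (v a)) @ F -->
    (sw_functional x y (v s) : Cx R).
Proof.
split=> [Fs x y|Fs].
  have c1 : sw_eval (v s') @[s' --> F] --> sw_eval (v s).
    move=> A hA; apply: Fs.
    exact: (@initial_continuous _ _ (fun s => sw_eval (v s)) s A hA).
  pose P := prod_topology (fun _ : l2seq H * l2seq H => Cx R).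
  have c0 : nbhs (sw_eval (v s) : P) --> (sw_eval (v s) : P) by exact: cvg_id.
  have /cvg_sup/(_ (x, y)) c2 := c0.
  have c3 : (fun p : prod_topology (fun _ : l2seq H * l2seq H => Cx R) => p (x, y)) @
     (sw_eval (v s)) --> (sw_functional x y (v s) : Cx R).
    move=> A hA; apply: c2; exact: (@initial_continuous _ _
      (fun p : prod_topology (fun _ : l2seq H * l2seq H => Cx R) => p (x, y)) _ A hA).
  exact: cvg_comp c1 c3.
move=> A [_ [[B oB <-] Bs] BA]; rewrite nbhs_filterE; apply: filterS BA _.
have c : sw_eval (v s') @[s' --> F] --> sw_eval (v s).
  apply/cvg_sup => -[x y] C [_ [[D oD <-] Ds] DC].
  rewrite nbhs_filterE; apply: filterS DC _.
  have := Fs x y D; apply; exact: open_nbhs_nbhs.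
by apply: c; exact: open_nbhs_nbhs.
Qed.

(** Arbitrary filters are allowed so that normality can be tested on a filter built for the
    purpose. *)
Lemma normal_functionalsP (M : vnalg R) (K : hilbert R) (f : M -> bop K K) :
  normal f <-> forall (F : set_system M) (a : M), Filter F ->
    (forall x y : l2seq (vn_space M), (fun b => sw_functional x y (\val b)) @ F -->
       (sw_functional x y (\val a) : Cx R)) ->
    forall x y : l2seq K, (fun b => sw_functional x y (f b)) @ F -->
       (sw_functional x y (f a) : Cx R).
Proof.
split=> [nf F a FF Fa x y|nf a].
  have Fa' : F --> (a : sigma_weak (fun a : M => \val a)) by apply/sigma_weakP.
  have fc : f @ F --> (f a : sigma_weak (@id (bop K K))).
    exact: cvg_comp Fa' (nf a).
  by move: fc => /sigma_weakP/(_ x y).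
have Fa : nbhs (a : sigma_weak (fun a : M => \val a)) -->
    (a : sigma_weak (fun a : M => \val a)) by exact: cvg_id.
have FF : Filter (nbhs (a : sigma_weak (fun a : M => \val a))).
  exact: nbhs_filter.
suff : f @ (nbhs (a : sigma_weak (fun a : M => \val a))) -->
   (f a : sigma_weak (@id (bop K K))) by [].
apply/sigma_weakP => x y; apply: nf => x' y'.
by move: Fa => /sigma_weakP/(_ x' y').
Qed.

End SigmaWeak.

(** * Vector functionals pulled back along intertwiners; normality *)

Section NormalVector.
Variables (R : realType) (H K : hilbert R) (Sm : bop H H -> bop K K -> Prop).
Hypothesis Sm_star : forall S S', Sm S S' ->
  exists S1 S1', [/\ is_adjoint S S1, is_adjoint S' S1' & Sm S1 S1'].

Let intertw (T : bop H K) := forall S S', Sm S S' -> T *b S = S' *b T.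
Let ranges := [set v : K | exists T h, intertw T /\ v = T h].

(** Scalars are absorbed into the vectors and operators are padded with 0 to families over [nat], a
    form in which countably many sums can be merged into one row. *)
Let span_nat (v : K) : lspan ranges v ->
  exists d : nat * (nat -> bop H K) * (nat -> H),
    (forall i, intertw (d.1.2 i)) /\ v = \sum_(i < d.1.1) d.1.2 i (d.2 i).
Proof.
move=> [n [k [x [Ax ->]]]].
have /choice[T] := Ax => /choice[h Hh].
have T0 : intertw 0.
  by move=> S S' _; apply: bop_ext => y /=; rewrite linear0.
exists (n, fun i => if insub i is Some j then T j else 0,
  fun i => if insub i is Some j then k j *: h j else 0); split=> [i|] /=.
  by case: (insub i) => [j|//]; have [] := Hh j.
apply: eq_bigr => i _; rewrite valK linearZ_LR /=; congr (_ *: _).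
by have [_ ->] := Hh i.
Qed.

(* The row [(l 0 T_0, l 1 T_1, ...)] with small positive [l j] is obtained as the
   adjoint of the column of adjoints, which needs no convergence argument. *)
Lemma row_operator (v : nat -> K) : (forall k, lspan ranges (v k)) ->
  exists (T : bop (ell2 H) K) (T' : bop K (ell2 H)),
    [/\ is_adjoint T T', forall y, nm (T' y) <= nm y,
      forall S S', Sm S S' -> T *b amp S = S' *b T &
      forall k, exists g, v k = T g].
Proof.
move=> Hv; have /choice[d Hd] k := span_nat (Hv k).
have T0 : intertw 0.
  by move=> S S' _; apply: bop_ext => y /=; rewrite linear0.
(* All operators of all the finite sums, listed along the codes of pairs (k, i), with 0 at numbers
   that code no pair. *)
pose Q j : bop H K := if unpickle j is Some p then (d p.1).1.2 p.2 else 0.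
have Qi j : intertw (Q j).
  by rewrite /Q; case: (unpickle j) => [p|//]; have [] := Hd p.1.
(* The weights give the j-th weighted adjoint norm at most 2^-(j+1), so that the column is a
   contraction, as [bop_abs] requires. *)
have /choice[l Hl] : forall j, exists l : R, 0 < l /\
    forall y, l * nm (adj (Q j) y) <= 2^-1 ^+ j.+1 * nm y.
  move=> j; have [c c0 cQ] := bop_bounded (adj (Q j)).
  exists (2^-1 ^+ j.+1 / c); split=> [|y].
    by rewrite divr_gt0 // exprn_gt0 // invr_gt0.
  rewrite -mulrA ler_wpM2l ?exprn_ge0 ?invr_ge0 //.
  by rewrite mulrC ler_pdivrMr // mulrC.
have geo n : \sum_(i < n) (2^-1 ^+ i.+1 : R) ^+ 2 <= 1 - 2^-1 ^+ n.
  elim: n => [|n IH]; first by rewrite big_ord0 expr0 subrr.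
  rewrite big_ord_recr /= [2^-1 ^+ n.+1]exprS.
  have a0 : 0 <= 2^-1 ^+ n :> R by rewrite exprn_ge0 ?invr_ge0.
  have a1 : 2^-1 ^+ n <= 1 :> R by rewrite exprn_ile1 ?invr_ge0 // invf_le1 // ler1n.
  have h : (2^-1 * 2^-1 ^+ n) ^+ 2 <= 2^-1 * 2^-1 ^+ n :> R.
    rewrite expr2 ler_piMl // ?mulr_ge0 ?invr_ge0 // -exprS.
    by rewrite exprn_ile1 ?invr_ge0 // invf_le1 // ler1n.
  by lra.
have bnd y n : \sum_(j < n) nm ((l j)%:C *: adj (Q j) y) ^+ 2 <= nm y ^+ 2.
  rewrite -[leRHS]mul1r; apply: (@le_trans _ _ ((1 - 2^-1 ^+ n) * nm y ^+ 2)).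
    apply: le_trans (ler_wpM2r (exprn_ge0 _ (nm_ge0 y)) (geo n)).
    rewrite mulr_suml; apply: ler_sum => j _; rewrite -exprMn.
    have [l0 lj] := Hl j.
    rewrite ler_pXn2r ?nnegrE ?mulr_ge0 ?nm_ge0 ?exprn_ge0 ?invr_ge0 //.
    by rewrite nmZ nm_real gtr0_norm.
  by rewrite ler_wpM2r ?exprn_ge0 ?nm_ge0 // lerBlDr lerDl exprn_ge0 ?invr_ge0.
have sm y : cvgn (series (fun j => `|(l j)%:C *: adj (Q j) y| ^+ 2)).
  by apply/l2P; exists (nm y ^+ 2) => n.
pose T'f y : ell2 H := L2Seq (sm y).
have T'l : linear T'f.
  move=> k y z; apply: l2_ext => j /=; rewrite linearP scalerDr !scalerA.
  by rewrite mulrC.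
have T'1 y : nm (T'f y) <= 1 * nm y.
  by rewrite mul1r; apply: l2_nm_le => [|n]; [exact: nm_ge0|exact: bnd].
pose T' := mkbop T'l T'1.
have TT' : is_adjoint (adj T') T' by apply: is_adjoint_sym; exact: adjP.
exists (adj T'), T'; split => // [y|S S' SS'|k].
- by have := T'1 y; rewrite mul1r.
- have [S1 [S1' [a a' SS1]]] := Sm_star SS'.
  apply/esym; apply: (adjoint_intertwine (adjP T') (is_adjoint_sym a')
    (is_adjoint_sym (amp_adjoint a))).
  apply: bop_ext => y; apply: l2_ext => j /=; rewrite linearZ_LR /=; congr (_ *: _).
  have := adjoint_intertwine (adjP (Q j)) a a' (Qi j _ _ SS').
  by move=> /(congr1 (fun f : bop K H => f y)).
have Tinc j h : adj T' (inc H j h) = (l j)%:C *: Q j h.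
  apply: ip_injl => z; rewrite adjPl ip_inc /= ipZr ipZl adjP; congr (_ * _).
  exact: conjc_real.
(* The inverse weights cancel those built into the row. *)
exists (\sum_(i < (d k).1.1) inc H (pickle (k, val i))
          ((l (pickle (k, val i)))^-1%:C *: (d k).2 i)).
have [_ {1}->] := Hd k; rewrite linear_sum; apply: eq_bigr => i _.
rewrite -[RHS]/(adj T' (inc H (pickle (k, val i)) _)) Tinc linearZ_LR scalerA /=.
rewrite -rmorphM divff ?rmorph1 ?scale1r.
  by rewrite /Q pickleK.
by have [/lt0r_neq0] := Hl (pickle (k, val i)).
Qed.

(* If [T (g n)] tends to [x], then [|T| (g n)] converges, and its limit is [h]. *)
Lemma normal_vector (x y : K) : closure (lspan ranges) x -> closure (lspan ranges) y ->
  exists h k : l2seq H, forall S S', Sm S S' -> ip (S' x) y = sw_functional h k S.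
Proof.
move=> /closure_seq[u Au ux] /closure_seq[w Aw wy].
(* The two approximating sequences are interleaved so that a single T reaches both. *)
have [|T [T' [TT' T'1 Ti Tv]]] :=
  @row_operator (fun n => if odd n then w n./2 else u n./2).
  by move=> n; case: ifP.
have [B [BB BT Bc]] := bop_abs TT' T'1.
have /choice[g Hg] : forall n, exists g, u n = T g.
  by move=> n; have [g] := Tv n.*2; rewrite odd_double doubleK; exists g.
have /choice[g' Hg'] : forall n, exists g, w n = T g.
  by move=> n; have [g'] := Tv n.*2.+1; rewrite /= odd_double uphalf_double; exists g'.
have nB z : nm (B z) = nm (T z).
  apply/eqP; rewrite -(@eqrXn2 _ 2) ?nm_ge0 // !nm_ip.
  rewrite BB TT'; apply/eqP; congr (complex.Re (ip _ _)).
  by have /(congr1 (fun f : bop (ell2 H) (ell2 H) => f z)) := BT.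
have lim_B (a : nat -> ell2 H) (z : K) : (fun n => T (a n)) @ \oo --> z ->
    exists h : ell2 H, (fun n => B (a n)) @ \oo --> h.
  move=> az; apply: nm_cauchy_cvg => e e0.
  have /nm_cvgn/(_ _ (divr_gt0 e0 (ltr0n R 2)))[N HN] := az.
  exists N => m n Nm Nn; rewrite -linearB nB linearB.
  have := nmD (T (a m) - z) (z - T (a n)); rewrite subrKA (nm_distC z).
  by move=> /le_lt_trans; apply; rewrite [ltRHS]splitr ltrD ?HN.
have Tgx : (fun n => T (g n)) @ \oo --> x.
  by rewrite (_ : (fun n => _) = u) //; apply/funext => n; rewrite Hg.
have Tgy : (fun n => T (g' n)) @ \oo --> y.
  by rewrite (_ : (fun n => _) = w) //; apply/funext => n; rewrite Hg'.
have [h Bh] := lim_B _ _ Tgx; have [k Bk] := lim_B _ _ Tgy.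
exists h, k => S S' SS'; rewrite sw_functionalE.
have c1 : (fun n => ip (S' (T (g n))) (T (g' n))) @ \oo --> (ip (S' x) y : Cx R).
  by apply: cvg_ip => //; exact: cvg_bop.
have c2 : (fun n => ip (amp S (B (g n))) (B (g' n))) @ \oo --> (ip (amp S h) k : Cx R).
  by apply: cvg_ip => //; exact: cvg_bop.
(* <S' T g, T g'> = <amp S g, T' T g'> = <B amp S g, B g'> = <amp S B g, B g'>: the operator amp S
   commutes with T' T, hence with B. *)
apply: (cvgC_unique c1); rewrite (_ : (fun n => _) = fun n =>
  ip (amp S (B (g n))) (B (g' n))) //; apply/funext => n.
have := Ti _ _ SS' => /(congr1 (fun f : bop (ell2 H) K => f (g n))) /= <-.
rewrite TT'.
have := BT => /(congr1 (fun f : bop (ell2 H) (ell2 H) => f (g' n))) /= <-.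
rewrite -BB; congr (ip _ _).
have [S1 [S1' [a a' SS1]]] := Sm_star SS'.
have E : amp S *b T' = T' *b S'.
  exact: (adjoint_intertwine TT' (amp_adjoint (is_adjoint_sym a))
    (is_adjoint_sym a') (Ti _ _ SS1)).
have /Bc : amp S *b (T' *b T) = T' *b T *b amp S.
  by rewrite bcompA E -!bcompA (Ti _ _ SS').
by move=> /(congr1 (fun f : bop (ell2 H) (ell2 H) => f (g n))).
Qed.

End NormalVector.

(** [ell2 X] is again generated by intertwiners, the coordinate embeddings composed with those into
    [X]. So [normal_vector] rewrites each sigma-weak functional of [f a] as a sigma-weak functional
    of [a]. *)
Lemma star_rep_normal (R : realType) (M : vnalg R) (X : hilbert R) (f : M -> bop X X) :
  (forall a b, is_adjoint (\val a) (\val b) -> is_adjoint (f a) (f b)) ->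
  closure (lspan [set v | exists (T : bop (vn_space M) X) h,
     (forall a, T *b \val a = f a *b T) /\ v = T h]) = setT ->
  normal f.
Proof.
move=> fstar fd; pose H := vn_space M.
pose Sm (S : bop H H) (S' : bop (ell2 X) (ell2 X)) :=
  exists a, S = \val a /\ S' = amp (f a).
have Sm_star S S' : Sm S S' ->
    exists S1 S1', [/\ is_adjoint S S1, is_adjoint S' S1' & Sm S1 S1'].
  move=> [a [-> ->]]; have Ma := vn_star (adjP (\val a)) (vn_in a).
  pose b : M := SigSub (mem_set Ma).
  exists (\val b), (amp (f b)); split; [exact: adjP| |by exists b].
  by apply: amp_adjoint; apply: fstar; exact: adjP.
have dense z : closure (lspan [set v : ell2 X | exists (T : bop H (ell2 X)) h,
    (forall S S', Sm S S' -> T *b S = S' *b T) /\ v = T h]) z.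
  have : closure (lspan [set x : ell2 X | exists n h,
    [set v | exists (T : bop (vn_space M) X) h,
     (forall a, T *b \val a = f a *b T) /\ v = T h] h /\ x = inc X n h]) z.
    by rewrite ell2_dense.
  apply: (@closure_subset _ _ _); apply: lspan_min; first exact: lspan_subspace.
  move=> _ [n [_ [[T [h [HT ->]]] ->]]]; apply: lspan_incl.
  exists (inc X n *b T), h; split=> // _ _ [a [-> ->]].
  by rewrite -bcompA HT !bcompA amp_inc.
apply/normal_functionalsP => F a FF Fa x y.
have [h [k hk]] := normal_vector Sm_star (dense x) (dense y).
have E b : sw_functional x y (f b) = sw_functional h k (\val b).
  by rewrite sw_functionalE; apply: hk; exists b.
by rewrite E; under eq_fun do rewrite E; exact: Fa.
Qed.

(** * Normal representations are generated by the identity representation *)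

Section VNAlgebra.
Variables (R : realType) (M : vnalg R).

Lemma vn_set_linear (k : Cx R) S T : vn_set M S -> vn_set M T -> vn_set M (k *: S + T).
Proof.
move=> MS MT; rewrite -(vn_bicommutant M) => U HU; apply: bop_ext => x /=.
rewrite linearD linearZ_LR /=; congr (_ *: _ + _).
  by have /(congr1 (fun f : bop _ _ => f x)) := HU _ MS.
by have /(congr1 (fun f : bop _ _ => f x)) := HU _ MT.
Qed.

Lemma vn_set0 : vn_set M 0.
Proof.
rewrite -(vn_bicommutant M) => U HU; apply: bop_ext => x /=.
by rewrite linear0.
Qed.

Definition vzero : M := SigSub (mem_set vn_set0).
Definition vlin (k : Cx R) (a b : M) : M :=
  SigSub (mem_set (vn_set_linear k (vn_in a) (vn_in b))).
Definition vadj (a : M) : M := SigSub (mem_set (vn_star (adjP (\val a)) (vn_in a))).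

Lemma vadjP (a : M) : is_adjoint (\val a) (\val (vadj a)).
Proof. exact: adjP. Qed.

Variables (L : hilbert R) (f : M -> bop L L).
Hypothesis fr : is_repr f.

Lemma repr0 : f vzero = 0.
Proof.
have [fl _ _ _ _] := fr; have := fl 1 vzero vzero vzero.
rewrite scale1r => /(_ (esym (addr0 _))) => /eqP.
by rewrite scale1r -subr_eq subrr => /eqP ->.
Qed.

Lemma repr_lin k a b : f (vlin k a b) = k *: f a + f b.
Proof. by have [fl _ _ _ _] := fr; exact: fl. Qed.

Lemma repr_adj a : is_adjoint (f a) (f (vadj a)).
Proof. by have [_ _ fa _ _] := fr; apply: fa; exact: vadjP. Qed.

End VNAlgebra.

Section GeneratingRepresentation.
Variables (R : realType) (M : vnalg R) (L : hilbert R) (f : M -> bop L L).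
Hypothesis fr : is_repr f.
Let H := vn_space M.

(* Normality is tested on the filter generated by the finitely many conditions that
   define a sigma-weak neighbourhood of 0. *)
Lemma normal_finite (x : L) : exists (s : seq (l2seq H * l2seq H)) (e : R),
  0 < e /\ forall a : M,
    (forall p, p \in s -> nm (sw_functional p.1 p.2 (\val a)) < e) ->
    nm (ip (f a x) x) < 1.
Proof.
pose F : set_system M := [set A | exists (s : seq (l2seq H * l2seq H)) (e : R),
  0 < e /\ forall a : M,
    (forall p, p \in s -> nm (sw_functional p.1 p.2 (\val a)) < e) -> A a].
have FF : Filter F.
  split.
  - by exists [::], 1; split.
  - move=> A B [s [e [e0 sA]]] [s' [e' [e0' sB]]].
    exists (s ++ s'), (Num.min e e'); split; first by rewrite lt_min e0.
    move=> a Ha; split; [apply: sA|apply: sB] => p ps.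
      by have := Ha p; rewrite mem_cat ps lt_min => /(_ isT)/andP[].
    by have := Ha p; rewrite mem_cat ps orbT lt_min => /(_ isT)/andP[].
  - move=> A B AB [s [e [e0 sA]]]; exists s, e; split=> // a /sA; exact: AB.
have [_ _ _ _ fn] := fr; have nf := (normal_functionalsP f).1 fn.
have F0 (u v : l2seq H) : (fun b : M => sw_functional u v (\val b)) @ F -->
    (sw_functional u v (\val (vzero M)) : Cx R).
  have -> : sw_functional u v (\val (vzero M)) = 0.
    rewrite sw_functionalE (_ : amp _ u = 0) ?ip0l //.
    exact: l2_ext.
  apply/nm_cvg => e e0; exists [:: (u, v)], e; split => // a /(_ (u, v)).
  by rewrite mem_head subr0; apply.
(* Sequences concentrated at index 0 turn <f a x, x> into a sigma-weak functional of f a. *)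
have := nf F (vzero M) FF F0 (inc L 0 x) (inc L 0 x).
have E S : sw_functional (inc L 0 x) (inc L 0 x) S = ip (S x) x.
  rewrite sw_functionalE.
  have /(congr1 (fun f : bop _ _ => f x)) /= -> := amp_inc S 0.
  by rewrite ip_inc.
rewrite E; under eq_fun do rewrite E.
rewrite (repr0 fr) /= ip0l => /cvgC_nm/(_ 1 ltr01)[s [e [e0 He]]].
by exists s, e; split=> // a /He; rewrite /= subr0.
Qed.

Lemma normal_bound (x : L) : exists (s : seq (l2seq H * l2seq H)) (C : R),
  0 <= C /\ forall a : M, nm (ip (f a x) x) <=
    C * \sum_(p <- s) nm (sw_functional p.1 p.2 (\val a)).
Proof.
have [s [e [e0 He]]] := normal_finite x.
exists s, (2 / e); split=> [|a]; first by rewrite divr_ge0 // ltW.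
set W := nm _; set m := \sum_(p <- s) _.
rewrite leNgt; apply/negP => Wm.
have m0 : 0 <= m by apply: sumr_ge0 => p _; exact: nm_ge0.
have W0 : 0 < W by apply: le_lt_trans Wm; rewrite mulr_ge0 // divr_ge0 // ltW.
(* Scaled so that <f b x, x> has modulus 1 while all tested functionals stay below e at b. *)
pose b := vlin (W^-1)%:C a (vzero M).
have bE : \val b = (W^-1)%:C *: \val a by rewrite /= addr0.
have : nm (ip (f b x) x) < 1.
  apply: He => p ps.
  have -> : sw_functional p.1 p.2 (\val b) =
      (W^-1)%:C * sw_functional p.1 p.2 (\val a).
    rewrite !sw_functionalE bE -ipZl; congr (ip _ _); exact: l2_ext.
  rewrite nmM nm_real ger0_norm ?invr_ge0 ?(ltW W0) //.
  rewrite mulrC ltr_pdivrMr //.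
  have pm : nm (sw_functional p.1 p.2 (\val a)) <= m.
    rewrite /m (big_rem p) //= lerDl; apply: sumr_ge0 => q _; exact: nm_ge0.
  apply: le_lt_trans pm _; move: Wm; rewrite mulrAC ltr_pdivrMr // mulrC.
  by have := m0; nra.
rewrite /b (repr_lin fr) (repr0 fr) addr0 /= ipZl nmM nm_real.
by rewrite ger0_norm ?invr_ge0 ?(ltW W0) // -/W mulVf ?gt_eqF // ltxx.
Qed.

(** The previous bound is applied to the product of the adjoint of a with a: |f a x|^2 = <f (a^* a)
    x, x>, and each functional <a p, a q> is at most |a p|^2 + |a q|^2. *)
Lemma normal_dominated (x : L) : exists (s : seq (ell2 H)) (C : R),
  0 <= C /\ forall a : M, nm (f a x) ^+ 2 <=
    C * \sum_(z <- s) nm (amp (\val a) z) ^+ 2.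
Proof.
have [s [C [C0 HC]]] := normal_bound x.
exists (map fst s ++ map snd s), C; split=> // a.
have [_ fM _ _ _] := fr.
have E p : nm (sw_functional p.1 p.2 (\val (vmul (vadj a) a))) <=
    nm (amp (\val a) p.1) ^+ 2 + nm (amp (\val a) p.2) ^+ 2.
  rewrite sw_functionalE vmulE amp_comp.
  rewrite -[X in ip X _]/(amp (\val (vadj a)) (amp (\val a) p.1)).
  rewrite (is_adjoint_sym (amp_adjoint (vadjP a))).
  apply: le_trans (ip_CS _ _) _.
  have := sqr_ge0 (nm (amp (\val a) p.1) - nm (amp (\val a) p.2)).
  have := nm_ge0 (amp (\val a) p.1); have := nm_ge0 (amp (\val a) p.2).
  move: (nm _) (nm _) => u v; rewrite !expr2; nra.
have -> : nm (f a x) ^+ 2 = complex.Re (ip (f (vmul (vadj a) a) x) x).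
  by rewrite nm_ip (reprM _ _ fr) /= -(is_adjoint_sym (repr_adj fr a)).
apply: le_trans (Re_le_nm _) _; apply: le_trans (HC _) _.
by rewrite ler_wpM2l // big_cat /= !big_map -big_split; apply: ler_sum => p _; exact: E.
Qed.

Let E2 := ell2 (ell2 H).

(** Placing the finitely many vectors in distinct coordinates makes their sum of squares a single
    squared norm, at the price of a second [ell2]. *)
Lemma normal_dominated_vector (x : L) : exists (Z : E2) (c : R),
  0 <= c /\ forall a : M, nm (f a x) <= c * nm (amp (amp (\val a)) Z).
Proof.
have [s [C [C0 HC]]] := normal_dominated x.
pose Z : E2 := \sum_(i < size s) inc (ell2 H) i (nth 0 s i).
have Zi i : (i < size s)%N -> (Z : l2seq (ell2 H)) i = nth 0 s i.
  move=> il; rewrite /Z.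
  have -> : forall n (g : 'I_n -> E2), ((\sum_(i < n) g i : E2) : l2seq (ell2 H)) i =
      \sum_(j < n) (g j : l2seq (ell2 H)) i.
    by move=> n g; elim/big_rec2 : _ => // j y1 y2 _ <-.
  rewrite (bigD1 (Ordinal il)) //= eqxx big1 ?addr0 // => j.
  by rewrite -val_eqE /= eq_sym => /negbTE ->.
(* C <= (C + 1)^2, which spares a square root. *)
exists Z, (C + 1); split=> [|a]; first by rewrite addr_ge0.
rewrite -(@ler_pXn2r _ 2) ?nnegrE ?mulr_ge0 ?nm_ge0 ?addr_ge0 //.
apply: le_trans (HC a) _; rewrite exprMn.
apply: (@le_trans _ _ (C * nm (amp (amp (\val a)) Z) ^+ 2)).
  rewrite ler_wpM2l //.
  apply: le_trans (sum_nm_le (amp (amp (\val a)) Z) (size s)).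
  rewrite (big_nth 0) big_mkord; apply: ler_sum => i _.
  by rewrite ampE Zi.
by rewrite ler_wpM2r ?exprn_ge0 ?nm_ge0 // expr2; nra.
Qed.

(* The map [a Z |-> f a x], extended by 0 to the orthogonal complement of its domain,
   is a bounded intertwiner sending [Z] to [x]. *)
Lemma repr_span (x : L) : closure (lspan [set v | exists (T : bop H L) h,
     (forall a, T *b \val a = f a *b T) /\ v = T h]) x.
Proof.
have [Z [c [c0 HZ]]] := normal_dominated_vector x.
pose AA (a : M) := amp (amp (\val a)).
have AAM a b : AA (vmul a b) = AA a *b AA b by rewrite /AA vmulE !amp_comp.
have AAl k a b u : AA (vlin k a b) u = k *: AA a u + AA b u.
  by apply: l2_ext => i; apply: l2_ext => j.
have AA0 u : AA (vzero M) u = 0 by apply: l2_ext => i; apply: l2_ext => j.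
pose Gamma (u : E2) (v : L) := exists a e,
  [/\ u = AA a Z + e, v = f a x & forall b, ip (AA b Z) e = 0].
have Gl k u u' v v' : Gamma u v -> Gamma u' v' -> Gamma (k *: u + u') (k *: v + v').
  move=> [a [e [-> -> He]]] [a' [e' [-> -> He']]].
  exists (vlin k a a'), (k *: e + e'); split=> [||b].
  - by rewrite AAl scalerDr; exact: addrACA.
  - by rewrite (repr_lin fr).
  - by rewrite ipDr ipZr He He' mulr0 addr0.
have Gc u v : Gamma u v -> nm v <= c * nm u.
  move=> [a [e [-> -> He]]]; apply: le_trans (HZ a) _.
  rewrite ler_wpM2l // -(@ler_pXn2r _ 2) ?nnegrE ?nm_ge0 //.
  by rewrite nm_sqrD He mulr0 addr0 lerDl exprn_ge0 ?nm_ge0.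
have G0 : Gamma 0 0.
  exists (vzero M), 0; rewrite AA0 addr0 (repr0 fr); split=> // b.
  by rewrite ip0r.
have Gd : closure [set u | exists v, Gamma u v] = setT.
  apply: dense_of_orthogonal.
    split; first by exists 0.
    by move=> k u u' [v G] [v' G']; exists (k *: v + v'); exact: Gl.
  (* A vector orthogonal to the domain is orthogonal to the orbit of Z, so it lies in the domain
     itself, paired with 0. *)
  move=> u Hu; apply: ip_eq0 => w.
  have /eqP : ip u u = 0.
    apply: (Hu); exists 0; exists (vzero M), u; rewrite AA0 add0r (repr0 fr).
    split=> // b; apply: Hu; exists (f b x), b, 0; rewrite addr0; split=> // d.
    by rewrite ip0r.
  by rewrite dnorm_eq0 => /eqP ->; rewrite ip0l.
have [V HV] := bop_of_relation Gl Gc Gd.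
have VZ : V Z = x.
  apply: HV; exists (vone M), 0; split=> [||b]; last by rewrite ip0r.
    by rewrite addr0; apply: l2_ext => i; apply: l2_ext => j.
  by rewrite (repr1 fr).
have VA a : V *b AA a = f a *b V.
  apply: (bop_dense_eq Gd) => u [v G].
  rewrite -[LHS]/(V (AA a u)) -[RHS]/(f a (V u)) (HV _ _ G).
  have [b [e [-> -> He]]] := G; rewrite linearD; apply: HV.
  (* The orthogonal complement of the orbit is stable under AA a, because the orbit is stable under
     its adjoint. *)
  exists (vmul a b), (AA a e); split=> [||d].
  - by rewrite AAM.
  - by rewrite (reprM _ _ fr).
  - rewrite -(is_adjoint_sym (amp_adjoint (amp_adjoint (vadjP a)))).
    by rewrite -[X in ip X _]/((AA (vadj a) *b AA d) Z) -AAM.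
have Td : closure (lspan [set: H]) = setT.
  by apply/seteqP; split=> // z _; apply: subset_closure; exact: lspan_incl.
have ZE := ell2_dense (ell2_dense Td).
have : closure (lspan [set v | exists n h,
     [set w | exists n h, [set: H] h /\ w = inc H n h] h /\ v = inc (ell2 H) n h]) Z.
  by rewrite ZE.
move=> /(bop_closure_lspan (T := V)); rewrite VZ; apply.
move=> _ [n [_ [[m [h [_ ->]]] ->]]].
exists (V *b inc (ell2 H) n *b inc H m), h; split=> // a.
by rewrite !bcompA -VA -!bcompA -amp_inc !bcompA -[V *b _ *b amp _]bcompA -amp_inc !bcompA.
Qed.

End GeneratingRepresentation.

(** * Transport of an operator along a generating family *)

Section Transport.
Variables (R : realType) (G X : hilbert R) (TT : set (bop G X)).
Variables (S S' : bop G G).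
Hypothesis SS' : is_adjoint S S'.
Hypothesis S_comm : forall T T1 T1', TT T -> TT T1 -> is_adjoint T1 T1' ->
  S *b (T1' *b T) = T1' *b T *b S.
Hypothesis S'_comm : forall T T1 T1', TT T -> TT T1 -> is_adjoint T1 T1' ->
  S' *b (T1' *b T) = T1' *b T *b S'.

(** Log-convexity makes the successive ratios increase: if the first ratio r exceeded c, then n k >=
    r^k n 0 would outgrow K c^k. *)
Lemma log_convex_bound (n : nat -> R) (K c : R) : 0 < c ->
  (forall k, 0 <= n k) -> (forall k, n k.+1 ^+ 2 <= n k.+2 * n k) ->
  (forall k, n k <= K * c ^+ k) -> n 1%N <= c * n 0%N.
Proof.
move=> c0 n0 nc nK; rewrite leNgt; apply/negP => cn.
have n00 : 0 < n 0%N.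
  rewrite lt_neqAle n0 andbT eq_sym; apply/eqP => n00.
  have := nc 0%N; rewrite n00 mulr0 => h.
  have : 0 < n 1%N by rewrite (le_lt_trans _ cn) // n00 mulr0.
  by move=> /(exprn_gt0 2); rewrite ltNge h.
pose r := n 1%N / n 0%N.
have rc : c < r by rewrite /r ltr_pdivlMr.
have r0 : 0 < r by exact: lt_trans rc.
have nr k : 0 < n k /\ r * n k <= n k.+1.
  elim: k => [|k [nk0 IH]]; first by rewrite /r divfK ?gt_eqF.
  have nk1 : 0 < n k.+1 by rewrite (lt_le_trans _ IH) // mulr_gt0.
  split=> //; rewrite -(ler_pM2r nk0); apply: le_trans (nc k).
  by rewrite mulrAC expr2 ler_pM2r.
have nrk k : r ^+ k * n 0%N <= n k.
  elim: k => [|k IH]; first by rewrite mul1r.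
  have [_] := nr k; apply: le_trans; rewrite exprS -mulrA.
  by rewrite ler_wpM2l ?(ltW r0).
have K0 : 0 < K.
  by have := nK 0%N; rewrite mulr1; exact: lt_le_trans.
(* Bernoulli's inequality for r / c > 1. *)
have bern k : 1 + k%:R * (r / c - 1) <= (r / c) ^+ k.
  elim: k => [|k IH]; first by rewrite mul0r addr0 expr0.
  have d0 : 0 <= r / c - 1 by rewrite subr_ge0 ler_pdivlMr // mul1r ltW.
  rewrite exprS; apply: le_trans (ler_wpM2l _ IH); last first.
    by rewrite divr_ge0 ?ltW.
  rewrite -natr1; have kk : 0 <= k%:R :> R by exact: ler0n.
  move: d0 kk; set d := r / c; move: (k%:R) => z d0 kk.
  by have := mulr_ge0 kk (sqr_ge0 (d - 1)); rewrite expr2; nra.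
have d0 : 0 < r / c - 1 by rewrite subr_gt0 ltr_pdivlMr // mul1r.
have [k Hk] : exists k : nat, K / n 0%N / (r / c - 1) < k%:R.
  exists (Num.bound (K / n 0%N / (r / c - 1))).
  by apply: archi_boundP; rewrite !divr_ge0 ?ltW.
have : (r / c) ^+ k * n 0%N <= K.
  rewrite expr_div_n mulrAC ler_pdivrMr ?exprn_gt0 //.
  exact: le_trans (nrk k) (nK k).
rewrite -ler_pdivlMr // leNgt => /negP; apply.
move: Hk; rewrite ltr_pdivrMr // => /lt_le_trans; apply.
by apply: le_trans (bern k); rewrite lerDr.
Qed.

Let E := S' *b S.
Let vv (s : seq (bop G X * G)) k := \sum_(p <- s) p.1 (iter k E p.2).

(** One factor E moves across the inner product: it is self-adjoint and commutes with the T_j^*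
    T_i. *)
Let vv_shift s k l : (forall p, p \in s -> TT p.1) ->
  ip (vv s k) (vv s l.+1) = ip (vv s k.+1) (vv s l).
Proof.
move=> Hs; rewrite /vv !ip_suml [LHS]big_seq [RHS]big_seq; apply: eq_bigr => p ps.
rewrite !ip_sumr [LHS]big_seq [RHS]big_seq; apply: eq_bigr => q qs.
rewrite -!(is_adjoint_sym (@adjP _ _ _ q.1)) !iterS.
set A := adj q.1 *b p.1.
have EA z : E (A z) = A (E z).
  have h1 := congr1 (fun f : bop G G => f z) (S_comm (Hs _ ps) (Hs _ qs) (adjP q.1)).
  have h2 := congr1 (fun f : bop G G => f (S z)) (S'_comm (Hs _ ps) (Hs _ qs) (adjP q.1)).
  rewrite /= in h1 h2; by rewrite /E /A /= h1 h2.
have EE : is_adjoint E E by apply: is_adjoint_comp => //; exact: is_adjoint_sym.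
rewrite -[X in ip X _]/(A (iter k E p.2)) -[X in _ = ip X _]/(A (E (iter k E p.2))).
by rewrite -EE EA.
Qed.

(* For [v k = sum_i T_i (S' S)^k x_i] one has [|v (k+1)|^2 = <v (k+2), v k>], and
   [|v k|] grows at most geometrically, so that [|v 1| <= c |v 0|]. *)
Let transport_bound : exists c : R, forall s : seq (bop G X * G),
  (forall p, p \in s -> TT p.1) ->
  nm (\sum_(p <- s) p.1 (S p.2)) <= c * nm (\sum_(p <- s) p.1 p.2).
Proof.
have [c c0 cE] := bop_bounded E; exists (c + 1) => s Hs.
have K_ex : exists K, forall k, nm (vv s k) <= K * c ^+ k.
  elim: s {Hs} => [|p s [K HK]].
    by exists 0 => k; rewrite /vv big_nil nm0 mul0r.
  have [d d0 dp] := bop_bounded p.1.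
  exists (d * nm p.2 + K) => k; rewrite /vv big_cons mulrDl.
  apply: le_trans (nmD _ _) _; rewrite lerD //; last exact: HK.
  apply: le_trans (dp _) _; rewrite -mulrA ler_wpM2l ?(ltW d0) // mulrC.
  elim: k => [|k IH]; first by rewrite mul1r.
  by rewrite iterS (le_trans (cE _)) // exprS -mulrA ler_wpM2l ?(ltW c0).
have [K HK] := K_ex.
have h1 : nm (vv s 1) <= c * nm (vv s 0).
  apply: (@log_convex_bound (fun k => nm (vv s k)) K) => // k; first exact: nm_ge0.
  rewrite nm_ip vv_shift //; apply: le_trans (Re_le_nm _) _; exact: ip_CS.
rewrite -(@ler_pXn2r _ 2) ?nnegrE ?mulr_ge0 ?nm_ge0 ?addr_ge0 ?(ltW c0) //.
(* Since S' commutes with T_j^* T_i, the square is <v 1, v 0>, at most c |v 0|^2, and c <= (c +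
   1)^2. *)
have -> : nm (\sum_(p <- s) p.1 (S p.2)) ^+ 2 = complex.Re (ip (vv s 1) (vv s 0)).
  rewrite nm_ip; congr complex.Re; rewrite /vv !ip_suml [LHS]big_seq [RHS]big_seq.
  apply: eq_bigr => p ps; rewrite !ip_sumr [LHS]big_seq [RHS]big_seq.
  apply: eq_bigr => q qs.
  rewrite -!(is_adjoint_sym (@adjP _ _ _ q.1)) /=.
  have h2 := congr1 (fun f : bop G G => f (S p.2)) (S'_comm (Hs _ ps) (Hs _ qs) (adjP q.1)).
  by rewrite /= in h2; rewrite /E /= -h2 (is_adjoint_sym SS').
apply: le_trans (Re_le_nm _) _; apply: le_trans (ip_CS _ _) _.
have n0 := nm_ge0 (vv s 0).
apply: le_trans (ler_wpM2r n0 h1) _.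
rewrite -[\sum_(p <- s) p.1 p.2]/(vv s 0) exprMn -mulrA -expr2 ler_wpM2r ?exprn_ge0 //.
by rewrite expr2; nra.
Qed.

(** The relation sending sum_i T_i x_i to sum_i T_i S x_i is bounded by [transport_bound], and its
    domain is dense. *)
Lemma transport_exists :
  closure (lspan [set v | exists (T : bop G X) x, TT T /\ v = T x]) = setT ->
  exists Q : bop X X, forall T, TT T -> Q *b T = T *b S.
Proof.
move=> Gd; have [c Hc] := transport_bound.
pose Gamma u v := exists s : seq (bop G X * G), [/\ forall p, p \in s -> TT p.1,
  u = \sum_(p <- s) p.1 p.2 & v = \sum_(p <- s) p.1 (S p.2)].
have Gl k u u' v v' : Gamma u v -> Gamma u' v' -> Gamma (k *: u + u') (k *: v + v').
  move=> [s [Hs -> ->]] [s' [Hs' -> ->]].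
  exists ([seq (p.1, k *: p.2) | p <- s] ++ s'); split.
  - by move=> p; rewrite mem_cat => /orP[/mapP[q /Hs ? ->]//|/Hs'].
  - rewrite big_cat big_map scaler_sumr /=; congr (_ + _).
    by apply: eq_bigr => p _; rewrite linearZ_LR.
  - rewrite big_cat big_map scaler_sumr /=; congr (_ + _).
    by apply: eq_bigr => p _; rewrite !linearZ_LR.
have [||Q HQ] := @bop_of_relation _ _ _ Gamma c Gl.
- by move=> u v [s [Hs -> ->]]; exact: Hc.
- apply/seteqP; split=> // x _.
  have : closure (lspan [set v | exists (T : bop G X) x, TT T /\ v = T x]) x by rewrite Gd.
  apply: closure_subset; apply: lspan_min.
    split; first by exists 0, [::]; rewrite !big_nil.
    by move=> k u u' [v Gv] [v' Gv']; exists (k *: v + v'); exact: Gl.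
  move=> _ [T [y [HT ->]]]; exists (T (S y)), [:: (T, y)].
  by rewrite !big_seq1; split=> // p; rewrite inE => /eqP ->.
exists Q => T HT; apply: bop_ext => y; apply: HQ; exists [:: (T, y)].
by rewrite !big_seq1; split=> // p; rewrite inE => /eqP ->.
Qed.

End Transport.

Lemma bop_span_eq (R : realType) (H K : hilbert R) (A : set H) (S T : bop H K) :
  closure (lspan A) = setT -> (forall x, A x -> S x = T x) -> S = T.
Proof.
move=> Ad ST; apply: (bop_dense_eq Ad) => _ [n [k [x [Ax ->]]]].
rewrite !linear_sum; apply: eq_bigr => i _; rewrite -[LHS]/(S _) -[RHS]/(T _).
by rewrite !linearZ_LR /= ST.
Qed.

(** * The category of representations and its separating object *)

Section ModuleCategory.
Variables (R : realType) (N : vnalg R) (A : wobj N).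

Lemma repmor_adjoint (L M : rep A) (T : repmor L M) :
  exists T' : repmor M L, is_adjoint (rm_op T) (rm_op T').
Proof.
have [L1 _ _] := rep_ax L; have [M1 _ _] := rep_ax M.
suff E a : adj (rm_op T) *b rep_pi M a = rep_pi L a *b adj (rm_op T).
  by exists (RepMor E); exact: adjP.
apply/esym; apply: (adjoint_intertwine (adjP _) _ _ (rm_ax T (vadj a))).
  exact: is_adjoint_sym (repr_adj L1 a).
exact: is_adjoint_sym (repr_adj M1 a).
Qed.

Lemma id_rep_separating : @is_separating R N (ModC A) (id_rep A).
Proof.
move=> L; apply/seteqP; split=> // x _; have [L1 _ _] := rep_ax L.
have := @repr_span _ _ _ _ L1 x; apply: closure_subset.
apply: lspan_min; first exact: lspan_subspace.
move=> _ [T [h [HT ->]]]; apply: lspan_incl.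
by exists (@RepMor R N A (id_rep A) L T HT), h.
Qed.

Lemma Mod_is_catN : is_catN (ModC A).
Proof.
split.
- by move=> L M T; have [T' TT'] := repmor_adjoint T; exists T'.
- by move=> L; have [_ L2 L3] := rep_ax L; split.
- by exists (id_rep A); exact: id_rep_separating.
Qed.

Definition ModN : catN N := CatN Mod_is_catN.

End ModuleCategory.

(** * The representations rho^X *)

Section RhoTheory.
Variables (R : realType) (N : vnalg R) (C : catN N) (G : C).
Hypothesis Gsep : is_separating G.

Lemma hmap1 (X : C) : hmap (idm X) = bid (hsp X).
Proof. by rewrite /hmap fmor1. Qed.

Lemma hmap_adjoint (X Y : C) (T : mor X Y) :
  exists T' : mor Y X, is_adjoint (hmap T) (hmap T').
Proof. by have [H _ _] := cn_ax C; exact: H. Qed.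

Lemma end_commute (S : EndObj G) (T : mor G G) : \val S *b hmap T = hmap T *b \val S.
Proof. by apply: (vn_in S); exists T. Qed.

Lemma sep_eq (X : C) (K : hilbert R) (P Q : bop (hsp X) K) :
  (forall T : mor G X, P *b hmap T = Q *b hmap T) -> P = Q.
Proof.
move=> E; apply: (bop_span_eq (Gsep X)) => _ [T [x ->]].
by have /(congr1 (fun f : bop _ _ => f x)) := E T.
Qed.

(** [rho] is picked with default 0, so the defining equation has to be shown solvable. By the star
    axiom T1^* T is the image of an endomorphism of [G], hence commutes with the elements of the
    commutant. *)
Lemma rhoE (X : C) (S : EndObj G) (T : mor G X) :
  rho X S *b hmap T = hmap T *b \val S.
Proof.
pose TT : set (bop (hsp G) (hsp X)) := [set U | exists T : mor G X, U = hmap T].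
have comm (S' : EndObj G) U U1 U1' : TT U -> TT U1 -> is_adjoint U1 U1' ->
    \val S' *b (U1' *b U) = U1' *b U *b \val S'.
  move=> [t ->] [t1 ->] a; have [t1' a'] := hmap_adjoint t1.
  by rewrite (is_adjoint_unique a a') -hmapM end_commute.
have d : closure (lspan
    [set v | exists (U : bop (hsp G) (hsp X)) x, TT U /\ v = U x]) = setT.
  apply/seteqP; split=> // x _.
  have : closure (lspan [set v | exists (T : mor G X) x, v = hmap T x]) x by rewrite Gsep.
  apply: closure_subset; apply: lspan_min; first exact: lspan_subspace.
  move=> _ [t [y ->]]; apply: lspan_incl.
  by exists (hmap t), y; split=> //; exists t.
have [Q HQ] := transport_exists (vadjP S) (comm S) (comm (vadj S)) d.
have /xgetPex : exists Q : bop (hsp X) (hsp X),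
    [set Q | forall T : mor G X, Q *b hmap T = hmap T *b \val S] Q.
  by exists Q => t; apply: HQ; exists t.
by move=> /(_ 0); apply.
Qed.

Lemma rho_unique (X : C) (S : EndObj G) (Q : bop (hsp X) (hsp X)) :
  (forall T : mor G X, Q *b hmap T = hmap T *b \val S) -> rho X S = Q.
Proof. by move=> HQ; apply: sep_eq => T; rewrite rhoE HQ. Qed.

Lemma rho_G (S : EndObj G) : rho G S = \val S.
Proof. by apply: rho_unique => T; exact: end_commute. Qed.

Lemma rho_natural (X Y : C) (f : mor X Y) (S : EndObj G) :
  hmap f *b rho X S = rho Y S *b hmap f.
Proof.
by apply: sep_eq => T; rewrite -!bcompA rhoE -hmapM rhoE bcompA hmapM.
Qed.

Lemma rho_repr (X : C) : is_repr (@rho R N C G X).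
Proof.
(* The adjoint of H(T) is H(T') with T' : X -> G, and T' intertwines rho^X(a) with rho^G(a) = a;
   taking adjoints, the adjoint of rho^X(a) solves the equation for b. *)
have star (a b : EndObj G) : is_adjoint (\val a) (\val b) -> is_adjoint (rho X a) (rho X b).
  move=> ab; suff -> : rho X b = adj (rho X a) by exact: adjP.
  apply: (@rho_unique X b (adj (rho X a))) => T; have [T' TT'] := hmap_adjoint T.
  have := rho_natural T' a; rewrite rho_G => E.
  exact: (adjoint_intertwine (is_adjoint_sym TT') (@adjP _ _ _ _) ab E).
split=> //.
- move=> k a b c E; apply: rho_unique => T; apply: bop_ext => x.
  rewrite E /= linearD linearZ_LR /=.
  have /(congr1 (fun f : bop _ _ => f x)) /= -> := rhoE a T.
  by have /(congr1 (fun f : bop _ _ => f x)) /= -> := rhoE b T.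
- move=> a b c E; apply: rho_unique => T.
  by rewrite E -bcompA rhoE bcompA rhoE bcompA.
- by move=> e E; apply: rho_unique => T; rewrite E bcomp1 bcomp1l.
- apply: star_rep_normal => //; apply/seteqP; split=> // x _.
  have : closure (lspan [set v | exists (T : mor G X) x, v = hmap T x]) x by rewrite Gsep.
  apply: closure_subset; apply: lspan_min; first exact: lspan_subspace.
  move=> _ [t [y ->]]; apply: lspan_incl; exists (hmap t), y; split=> // a.
  by rewrite rhoE.
Qed.

Lemma rho_emb (X : C) n : rho X (w_emb (EndObj G) n) = bm_l (cc_U C X) n.
Proof. by apply: rho_unique => T; have [+ _] := bi_ax (fmor (cc_U C) T) => <-. Qed.

Lemma rho_op (X : C) n : rho X (w_op (EndObj G) n) = bm_r (cc_U C X) n.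
Proof. by apply: rho_unique => T; have [_ +] := bi_ax (fmor (cc_U C) T) => <-. Qed.

End RhoTheory.

(** * Transport of operators along equalities of spaces *)

Section Casts.
Variable R : realType.
Implicit Types H K L : hilbert R.

Lemma bopcast_comp H H' K K' L L' (eH : H = H') (eK : K = K') (eL : L = L')
    (S : bop K L) (T : bop H K) :
  bopcast eH eL (S *b T) = bopcast eK eL S *b bopcast eH eK T.
Proof. by subst H' K' L'. Qed.

Lemma bopcast_trans H H' H'' K K' K'' (eH : H = H') (eK : K = K')
    (eH' : H' = H'') (eK' : K' = K'') (T : bop H K) :
  bopcast eH' eK' (bopcast eH eK T) = bopcast (etrans eH eH') (etrans eK eK') T.
Proof. by subst H'' K'' H' K'. Qed.

(** Closes the goals in which one operator is cast along two different routes. *)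
Lemma bopcast_irr H H' K K' (eH eH' : H = H') (eK eK' : K = K') (T : bop H K) :
  bopcast eH eK T = bopcast eH' eK' T.
Proof. by rewrite (Prop_irrelevance eH eH') (Prop_irrelevance eK eK'). Qed.

Lemma bopcast_bid H H' (e : H = H') : bopcast e e (bid H) = bid H'.
Proof. by subst H'. Qed.

Lemma repr_cast (M : vnalg R) K K' (e : K = K') (f : M -> bop K K) :
  is_repr f -> is_repr (fun a => bopcast e e (f a)).
Proof. by subst K'. Qed.

Variable N : vnalg R.

Lemma rep_eq (A : wobj N) (L L' : rep A) (e : rep_space L = rep_space L') :
  (forall a, bopcast e e (rep_pi L a) = rep_pi L' a) -> L = L'.
Proof.
case: L L' e => [H p ax] [H' p' ax'] /= e; subst H' => /= /funext E; subst p'.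
by congr Rep; exact: Prop_irrelevance.
Qed.

Lemma bimod_eq (B B' : bimod N) (e : bm_space B = bm_space B') :
  (forall n, bopcast e e (bm_l B n) = bm_l B' n) ->
  (forall n, bopcast e e (bm_r B n) = bm_r B' n) -> B = B'.
Proof.
case: B B' e => [H l r ax] [H' l' r' ax'] /= e; subst H' => /= El Er.
exact: bimod_ext.
Qed.

Lemma rm_op_cast (A : wobj N) (L L' M M' : Mod_cat A) (eL : L = L') (eM : M = M')
    (T : mor L M) :
  rm_op (morcast eL eM T) =
  bopcast (congr1 (@rep_space R N A) eL) (congr1 (@rep_space R N A) eM) (rm_op T).
Proof. by subst L' M'. Qed.

Variables (C D : ccat N) (F : cmor C D).

Lemma cm_hmap (X Y : C) (T : mor X Y) :
  bopcast (cm_hsp F X) (cm_hsp F Y) (hmap (fmor F T)) = hmap T.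
Proof.
case: F => F0 eF; rewrite /cm_hsp /hmap /hsp /=.
(* Once [cc_U C] is a variable, the equation of functors can be substituted and the casts compute
   away. *)
by move: (cc_U C) eF => U eF; subst U.
Qed.

Lemma cm_bm_l (X : C) n :
  bopcast (cm_hsp F X) (cm_hsp F X) (bm_l (cc_U D (F X)) n) = bm_l (cc_U C X) n.
Proof.
case: F => F0 eF; rewrite /cm_hsp /hsp /=.
by move: (cc_U C) eF => U eF; subst U.
Qed.

Lemma cm_bm_r (X : C) n :
  bopcast (cm_hsp F X) (cm_hsp F X) (bm_r (cc_U D (F X)) n) = bm_r (cc_U C X) n.
Proof.
case: F => F0 eF; rewrite /cm_hsp /hsp /=.
by move: (cc_U C) eF => U eF; subst U.
Qed.

Lemma cm_natural (F' : cmor C D) (alpha : nattrans F F') (X Y : C) (T : mor X Y) :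
  bopcast (cm_hsp F Y) (cm_hsp F' Y) (hmap (alpha Y)) *b hmap T =
  hmap T *b bopcast (cm_hsp F X) (cm_hsp F' X) (hmap (alpha X)).
Proof.
rewrite -{1}cm_hmap -bopcast_comp -hmapM -nt_natural hmapM.
rewrite (bopcast_comp _ (cm_hsp F' X)); congr (_ *b _).
case: F' {alpha} => F0 eF; rewrite /cm_hsp /hmap /hsp /=.
by move: (cc_U C) eF => U eF; subst U.
Qed.

End Casts.

(** * Functoriality of End *)

Section EndFunctor.
Variables (R : realType) (N : vnalg R).
Variables (G : forall C : catN N, C) (Gsep : forall C : catN N, is_separating (G C)).
Local Notation E0 C := (EndObj (G C)).

Section EndMor.
Variables (C D : catN N).

Lemma rho_cast_comm (F : cmor C D) (S : E0 D) (X Y : C) (T : mor X Y) :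
  bopcast (cm_hsp F Y) (cm_hsp F Y) (rho (F Y) S) *b hmap T =
  hmap T *b bopcast (cm_hsp F X) (cm_hsp F X) (rho (F X) S).
Proof.
by rewrite -(cm_hmap F) -!bopcast_comp (rho_natural (@Gsep D)).
Qed.

Lemma End_in (F : cmor C D) (S : E0 D) : commutant (@end_ops R N C (G C))
  (bopcast (cm_hsp F (G C)) (cm_hsp F (G C)) (rho (F (G C)) S)).
Proof. by move=> _ [T ->]; exact: rho_cast_comm. Qed.

Definition End_mor (F : cmor C D) : wmor (E0 D) (E0 C).
Proof.
exists (fun S => SigSub (mem_set (End_in F S)) : E0 C); split.
- exact: repr_cast (rho_repr (@Gsep D) (F (G C))).
- by move=> n; apply: val_inj; rewrite /= (rho_emb (@Gsep D)) cm_bm_l.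
- by move=> n; apply: val_inj; rewrite /= (rho_op (@Gsep D)) cm_bm_r.
Defined.

Lemma End_cell_in (F F' : cmor C D) (alpha : nattrans F F') :
  commutant (@end_ops R N C (G C))
    (bopcast (cm_hsp F (G C)) (cm_hsp F' (G C)) (hmap (alpha (G C)))).
Proof. by move=> _ [T ->]; exact: cm_natural. Qed.

Definition End_cell (F F' : cmor C D) (alpha : nattrans F F') :
  w2cell (End_mor F) (End_mor F').
Proof.
exists (SigSub (mem_set (End_cell_in alpha)) : E0 C) => S /=.
by rewrite -!bopcast_comp (rho_natural (@Gsep D)).
Defined.

Definition End1 : functor (chom C D) (whom (E0 D) (E0 C)).
Proof.
exists (End_mor : chom C D -> whom (E0 D) (E0 C))
  (fun F F' (alpha : @mor (chom C D) F F') => End_cell alpha).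
- by move=> F; apply: w2cell_ext; rewrite /= hmap1 bopcast_bid.
- move=> F F' F'' b a; apply: w2cell_ext => /=.
  by rewrite hmapM (bopcast_comp _ (cm_hsp F' (G C))).
Defined.

(** Composing End(F) with a further End applies rho to elements of the form End(F)(S); this
    evaluates it at every X, beyond the defining case of the chosen separating object. *)
Lemma rho_End_mor (F : cmor C D) (S : E0 D) (X : C) :
  rho X (End_mor F S) = bopcast (cm_hsp F X) (cm_hsp F X) (rho (F X) S).
Proof. by apply: (rho_unique (@Gsep C)) => T; exact: rho_cast_comm. Qed.

(** Evaluates the factor psi_2(b) of a horizontal composite: a 2-cell is known at the separating
    object only, and rho^X recovers the component of alpha at X. *)
Lemma rho_End_cell (F F' : cmor C D) (alpha : nattrans F F') (X : C) :
  rho X (End_cell alpha) = bopcast (cm_hsp F X) (cm_hsp F' X) (hmap (alpha X)).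
Proof. by apply: (rho_unique (@Gsep C)) => T; exact: cm_natural. Qed.

End EndMor.

Lemma End_contra2functor :
  @is_contra2functor (CatNN N) (WStar N) (fun C : catN N => E0 C) End1.
Proof.
split=> [C|C D E].
  apply: wmor_ext => S; apply: val_inj => /=.
  by rewrite bopcast_id (rho_G (@Gsep C)).
apply: functor_ext => [[F K]|e [F K] [F' K'] [a b]].
  apply: wmor_ext => S; apply: val_inj => /=.
  rewrite rho_End_mor bopcast_trans; exact: bopcast_irr.
apply: w2cell_ext; rewrite w2castE /= rho_End_cell hmapM.
(* The horizontal composite is b at F' G_C after K applied to a at G_C; its cast is split at the
   space of K (F' G_C). *)
rewrite (bopcast_comp _ (etrans (cm_hsp K (F' (G C))) (cm_hsp F' (G C)))).
congr (_ *b _).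
  rewrite bopcast_trans; exact: bopcast_irr.
rewrite -(cm_hmap K) bopcast_trans; exact: bopcast_irr.
Qed.

End EndFunctor.

(** * Functoriality of Mod *)

Section ModFunctor.
Variables (R : realType) (N : vnalg R).

Lemma Mod_contra2functor :
  @is_contra2functor (WStar N) (CatNN N) (fun A => ModN A) (@Mod1 R N).
Proof.
split=> [A|A B C].
  apply: cmor_ext; apply: functor_ext => [L|e L M T].
    exact: (@rep_eq _ _ _ (pullback_fun _ L) L erefl).
  by apply: repmor_ext; rewrite rm_op_cast; exact: bopcast_id.
apply: functor_ext => [[f g]|e [f g] [f' g'] [b c]].
  apply: cmor_ext; apply: functor_ext => [L|e L M T].
    exact: (@rep_eq _ _ _ (pullback_fun (wmor_comp f g) L)
      (pullback_fun f (pullback_fun g L)) erefl).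
  by apply: repmor_ext; rewrite rm_op_cast; exact: bopcast_id.
apply: nt_ext => L; rewrite ntcastE; apply: repmor_ext.
rewrite rm_op_cast bopcast_id /=.
by have [L1 _ _] := rep_ax L; exact: reprM.
Qed.

End ModFunctor.

(** * The adjunction, its unit and its counit *)

Section Adjunction.
Variables (R : realType) (N : vnalg R).
Variables (G : forall C : catN N, C) (Gsep : forall C : catN N, is_separating (G C)).
Local Notation E0 C := (EndObj (G C)).

Section HomIso.
Variables (C : catN N) (A : wobj N).

Lemma cast_pi_comm (F : cmor C (ModN A)) (a : A) (X Y : C) (T : mor X Y) :
  bopcast (cm_hsp F Y) (cm_hsp F Y) (rep_pi (F Y) a) *b hmap T =
  hmap T *b bopcast (cm_hsp F X) (cm_hsp F X) (rep_pi (F X) a).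
Proof.
rewrite -(cm_hmap F) -!bopcast_comp; congr bopcast.
exact/esym/(rm_ax (fmor F T)).
Qed.

Lemma Phi_in (F : cmor C (ModN A)) (a : A) : commutant (@end_ops R N C (G C))
  (bopcast (cm_hsp F (G C)) (cm_hsp F (G C)) (rep_pi (F (G C)) a)).
Proof. by move=> _ [T ->]; exact: cast_pi_comm. Qed.

Definition Phi_mor (F : cmor C (ModN A)) : wmor A (E0 C).
Proof.
exists (fun a => SigSub (mem_set (Phi_in F a)) : E0 C); split.
- by have [L1 _ _] := rep_ax (F (G C)); exact: repr_cast L1.
- by move=> n; apply: val_inj; rewrite /= -(cm_bm_l F).
- by move=> n; apply: val_inj; rewrite /= -(cm_bm_r F).
Defined.

Definition Phi_cell (F F' : cmor C (ModN A)) (alpha : nattrans F F') :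
  w2cell (Phi_mor F) (Phi_mor F').
Proof.
exists (SigSub (mem_set (End_cell_in alpha)) : E0 C) => a /=.
rewrite -!bopcast_comp; congr bopcast; exact: (rm_ax (alpha (G C))).
Defined.

Definition Phi : functor (chom C (ModN A)) (whom A (E0 C)).
Proof.
exists (Phi_mor : chom C (ModN A) -> whom A (E0 C))
  (fun F F' (alpha : @mor (chom C (ModN A)) F F') => Phi_cell alpha).
- by move=> F; apply: w2cell_ext; exact: (bopcast_bid (cm_hsp F (G C))).
- move=> F F' F'' b a; apply: w2cell_ext.
  exact: (bopcast_comp _ (cm_hsp F' (G C))).
Defined.

(** Shows that Phi loses nothing: the representation on F X is recovered from the one at the
    separating object. *)
Lemma rho_Phi_mor (F : cmor C (ModN A)) (a : A) (X : C) :
  rho X (Phi_mor F a) = bopcast (cm_hsp F X) (cm_hsp F X) (rep_pi (F X) a).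
Proof. by apply: (rho_unique (@Gsep C)) => T; exact: cast_pi_comm. Qed.

Lemma rho_Phi_cell (F F' : cmor C (ModN A)) (alpha : nattrans F F') (X : C) :
  rho X (Phi_cell alpha) = bopcast (cm_hsp F X) (cm_hsp F' X) (hmap (alpha X)).
Proof. by apply: (rho_unique (@Gsep C)) => T; exact: cm_natural. Qed.

Lemma Phi_rep_of (F : cmor C (ModN A)) : F (G C) = rep_of (Phi_mor F).
Proof. exact: (@rep_eq _ _ _ (F (G C)) (rep_of (Phi_mor F)) (cm_hsp F (G C))). Qed.

Lemma rho_rep_ax (phi : wmor A (E0 C)) (X : C) :
  [/\ is_repr (fun a => rho X (phi a)),
      injective (fun n => rho X (phi (w_emb A n))) &
      injective (fun n => rho X (phi (w_op A n)))].
Proof.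
have [p1 p2 p3] := wm_ax phi; have [_ /(_ X)[f1 f2] _] := cn_ax C; split.
- exact: repr_comp p1 (rho_repr (@Gsep C) X).
- by move=> m n; rewrite !p2 !(rho_emb (@Gsep C)) => /f1.
- by move=> m n; rewrite !p3 !(rho_op (@Gsep C)) => /f2.
Qed.

Definition rho_rep (phi : wmor A (E0 C)) (X : C) : rep A := Rep (rho_rep_ax phi X).

Definition rho_functor (phi : wmor A (E0 C)) : functor C (Mod_cat A).
Proof.
exists (rho_rep phi : C -> Mod_cat A)
  (fun X Y T => @RepMor R N A (rho_rep phi X) (rho_rep phi Y) (hmap T)
     (fun a => rho_natural (@Gsep C) T (phi a))).
- by move=> X; apply: repmor_ext; exact: hmap1.
- by move=> X Y Z S T; apply: repmor_ext; exact: hmapM.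
Defined.

(** The inverse of [Phi_mor]: a morphism into End(C) is spread over all of C by rho. *)
Definition Psi_mor (phi : wmor A (E0 C)) : cmor C (ModN A).
Proof.
exists (rho_functor phi); apply: functor_ext => [X|e X Y T].
  have [p1 p2 p3] := wm_ax phi.
  apply: (@bimod_eq _ _ (rep_bimod (rho_rep phi X)) (cc_U C X) erefl) => n /=.
    by rewrite p2 (rho_emb (@Gsep C)).
  by rewrite p3 (rho_op (@Gsep C)).
by apply: bimor_ext; rewrite bi_op_cast; exact: bopcast_id.
Defined.

Lemma rho_w2cell (phi psi : wmor A (E0 C)) (b : w2cell phi psi) (X : C) (a : A) :
  rho X (w2_val b) *b rho X (phi a) = rho X (psi a) *b rho X (w2_val b).
Proof.
have r := rho_repr (@Gsep C) X; rewrite -!(reprM _ _ r); congr rho.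
by apply: val_inj; exact: (w2_ax b).
Qed.

Definition Psi_cell (phi psi : wmor A (E0 C)) (b : w2cell phi psi) :
  nattrans (Psi_mor phi) (Psi_mor psi).
Proof.
exists (fun X : C => @RepMor R N A (rho_rep phi X) (rho_rep psi X)
  (rho X (w2_val b)) (rho_w2cell b X)).
by move=> X Y T; apply: repmor_ext; exact: (rho_natural (@Gsep C)).
Defined.

Definition Psi : functor (whom A (E0 C)) (chom C (ModN A)).
Proof.
exists (Psi_mor : whom A (E0 C) -> chom C (ModN A))
  (fun phi psi (b : @mor (whom A (E0 C)) phi psi) => Psi_cell b).
- move=> phi; apply: nt_ext => X; apply: repmor_ext.
  exact: (repr1 (rho_repr (@Gsep C) X)).
- move=> phi psi chi c b; apply: nt_ext => X; apply: repmor_ext.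
  exact: (reprM _ _ (rho_repr (@Gsep C) X)).
Defined.

Lemma Psi_Phi_mor (F : cmor C (ModN A)) : Psi_mor (Phi_mor F) = F.
Proof.
have e X : rho_rep (Phi_mor F) X = F X.
  apply/esym; apply: (@rep_eq _ _ _ (F X) (rho_rep (Phi_mor F) X) (cm_hsp F X)) => a /=.
  by rewrite rho_Phi_mor.
apply: cmor_ext.
apply: (@functor_ext _ _ (rho_functor (Phi_mor F)) F e) => X Y T; apply: repmor_ext.
rewrite rm_op_cast /= -(cm_hmap F) bopcast_trans; exact: bopcast_id.
Qed.

Lemma Phi_Psi_mor (phi : wmor A (E0 C)) : Phi_mor (Psi_mor phi) = phi.
Proof.
apply: wmor_ext => a; apply: val_inj; rewrite /= (rho_G (@Gsep C)).
exact: bopcast_id.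
Qed.

Lemma Phi_iso : is_iso_cat Phi.
Proof.
exists Psi; split.
  apply: (@functor_ext _ _ (compF Phi Psi) (idF _) Psi_Phi_mor) => F F' a.
  apply: nt_ext => X; rewrite ntcastE; apply: repmor_ext.
  rewrite rm_op_cast -[rm_op _]/(rho X (Phi_cell a)) rho_Phi_cell bopcast_trans.
  exact: bopcast_id.
apply: (@functor_ext _ _ (compF Psi Phi) (idF _) Phi_Psi_mor) => phi psi b.
apply: w2cell_ext; rewrite w2castE /= -[RHS](rho_G (@Gsep C)).
exact: bopcast_id.
Qed.

End HomIso.

(** Taken as the preimage of the identity under Phi, so that the unit condition is an instance of
    [Phi_Psi_mor]. *)
Definition unit_mor (C : catN N) : cmor C (ModN (E0 C)) := Psi_mor (wmor_id (E0 C)).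

Definition counit_inv (A : wobj N) : wmor A (E0 (ModN A)) :=
  Phi_mor (cmor_id (ModN A)).

Section Counit.
Variable A : wobj N.

(** Every U in the commutant of A is an endomorphism of the identity representation, so rho commutes
    with it; the bicommutant property concludes. *)
Lemma counit_in (S : E0 (ModN A)) : vn_set A (rho (id_rep A : ModN A) S).
Proof.
rewrite -(vn_bicommutant A) => U HU.
have U_ax a : U *b rep_pi (id_rep A) a = rep_pi (id_rep A) a *b U.
  by apply: HU; exact: vn_in.
exact: (esym (@rho_natural R N (ModN A) (G (ModN A)) (@Gsep (ModN A)) (id_rep A)
  (id_rep A) (@RepMor R N A (id_rep A) (id_rep A) U U_ax) S)).
Qed.

Definition counit_mor : wmor (E0 (ModN A)) A.
Proof.
exists (fun S => SigSub (mem_set (counit_in S)) : A); split.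
- exact: (@rho_repr _ _ _ _ (@Gsep (ModN A)) (id_rep A)).
- by move=> n; apply: val_inj; exact: (@rho_emb _ _ _ _ (@Gsep (ModN A)) (id_rep A) n).
- by move=> n; apply: val_inj; exact: (@rho_op _ _ _ _ (@Gsep (ModN A)) (id_rep A) n).
Defined.

Lemma rho_counit_inv (a : A) (L : ModN A) : rho L (counit_inv A a) = rep_pi L a.
Proof. by rewrite rho_Phi_mor; exact: bopcast_id. Qed.

(** Both sides are natural in L and agree at the identity representation, whose intertwiners into L
    span L. At L = G this makes the counit invertible. *)
Lemma rep_counit (S : E0 (ModN A)) (L : ModN A) : rep_pi L (counit_mor S) = rho L S.
Proof.
apply: (bop_span_eq (@id_rep_separating R N A L)) => _ [T [x ->]].
have /(congr1 (fun f : bop _ _ => f x)) /= := rho_natural (@Gsep (ModN A)) T S.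
have /(congr1 (fun f : bop _ _ => f x)) /= := rm_ax T (counit_mor S).
by move=> E1 E2; exact: etrans (esym E1) E2.
Qed.

Lemma counit_invK : wmor_comp counit_mor (counit_inv A) = wmor_id (E0 (ModN A)).
Proof.
apply: wmor_ext => S; apply: val_inj; rewrite /= rep_counit (rho_G (@Gsep (ModN A))).
exact: bopcast_id.
Qed.

Lemma counitK : wmor_comp (counit_inv A) counit_mor = wmor_id A.
Proof. by apply: wmor_ext => a; apply: val_inj; exact: (rho_counit_inv a (id_rep A)). Qed.

End Counit.

(** The computation for the functoriality of End, with the rho formulas for Phi in place of those
    for End. *)
Lemma Phi_natural_cat (C' C : catN N) (A : wobj N) :
  compF (@tcomp (CatNN N) C' C (ModN A)) (Phi C' A) =
  compF (prodF (End1 Gsep C' C) (Phi C A))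
    (compF (swapF _ _) (@tcomp (WStar N) A (E0 C) (E0 C'))).
Proof.
apply: functor_ext => [[F K]|e [F K] [F' K'] [a k]].
  apply: wmor_ext => x; apply: val_inj => /=.
  rewrite rho_Phi_mor bopcast_trans; exact: bopcast_irr.
apply: w2cell_ext; rewrite w2castE /= rho_Phi_cell hmapM.
rewrite (bopcast_comp _ (etrans (cm_hsp K (F' (G C'))) (cm_hsp F' (G C')))).
congr (_ *b _).
  rewrite bopcast_trans; exact: bopcast_irr.
rewrite -(cm_hmap K) bopcast_trans; exact: bopcast_irr.
Qed.

(** Pulling back changes neither spaces nor morphisms, so only casts remain to be compared. *)
Lemma Phi_natural_alg (C : catN N) (B A : wobj N) :
  compF (prodF (idF (chom C (ModN B))) (Mod1 A B))
    (compF (@tcomp (CatNN N) C (ModN B) (ModN A)) (Phi C A)) =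
  compF (prodF (Phi C B) (idF (whom A B)))
    (compF (swapF _ _) (@tcomp (WStar N) A B (E0 C))).
Proof.
apply: functor_ext => [[K f]|e [K f] [K' f'] [k b]].
  by apply: wmor_ext => x; apply: val_inj; exact: bopcast_irr.
apply: w2cell_ext; rewrite w2castE /= hmapM.
rewrite (bopcast_comp _ (cm_hsp K' (G C))).
by congr (_ *b _); exact: bopcast_irr.
Qed.

Lemma unit_counit_Mod (A : wobj N) :
  cmor_comp (unit_mor (ModN A)) (pullback (counit_inv A)) = cmor_id (ModN A).
Proof.
apply: cmor_ext; apply: functor_ext => [L|e L M T].
  apply: (@rep_eq _ _ _ (pullback_fun (counit_inv A) (unit_mor (ModN A) L)) L erefl) => a.
  exact: rho_counit_inv.
by apply: repmor_ext; rewrite rm_op_cast; exact: bopcast_id.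
Qed.

Lemma unit_counit_End (C : catN N) :
  wmor_comp (counit_inv (E0 C)) (End_mor Gsep (unit_mor C)) = wmor_id (E0 C).
Proof.
apply: wmor_ext => a; apply: val_inj; rewrite /= rho_counit_inv /= bopcast_id.
exact: (rho_G (@Gsep C)).
Qed.

End Adjunction.

Theorem theorem4p16 (R : realType) (N : vnalg R)
    (G : forall C : catN N, C) (G_sep : forall C : catN N, is_separating (G C)) :
  exists Mod_ok : forall A : wobj N, is_catN (ModC A),
  let Mod0 := fun A : wobj N => CatN (Mod_ok A) in
  let End0 := fun C : catN N => EndObj (G C) in
  exists (End1 : forall C D : catN N,
            functor (chom C D) (whom (End0 D) (End0 C)))
         (Phi : forall (C : catN N) (A : wobj N),
            functor (chom C (Mod0 A)) (whom A (End0 C)))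
         (eta : forall C : catN N, cmor C (Mod0 (End0 C)))
         (eps : forall A : wobj N, wmor (End0 (Mod0 A)) A),
  (* rho^X satisfies its defining equation *)
  (forall (C : catN N) (X : C) (S : End0 C) (T : mor (G C) X),
     rho X S *b hmap T = hmap T *b \val S) /\
  (* F |-> rho^(F G_C) and alpha |-> H_D(alpha_(G_C)) *)
  (forall (C D : catN N) (F : cmor C D) (S : End0 D),
     \val ((End1 C D F : wmor (End0 D) (End0 C)) S) =
     bopcast (cm_hsp F (G C)) (cm_hsp F (G C)) (rho (F (G C)) S)) /\
  (forall (C D : catN N) (F F' : cmor C D) (alpha : nattrans F F'),
     \val (w2_val (fmor (End1 C D) (alpha : @mor (chom C D) F F'))) =
     bopcast (cm_hsp F (G C)) (cm_hsp F' (G C)) (hmap (alpha (G C)))) /\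
  (* F G_C = (H_C G_C, Phi F) and Phi(alpha) = alpha_(G_C) *)
  (forall (C : catN N) (A : wobj N) (F : cmor C (Mod0 A)),
     F (G C) = rep_of (Phi C A F : wmor A (End0 C))) /\
  (forall (C : catN N) (A : wobj N) (F F' : cmor C (Mod0 A))
      (alpha : nattrans F F'),
     \val (w2_val (fmor (Phi C A) (alpha : @mor (chom C (Mod0 A)) F F'))) =
     bopcast (cm_hsp F (G C)) (cm_hsp F' (G C)) (hmap (alpha (G C)))) /\
  (* eta_C : X |-> (H_C X, rho^X), T |-> H_C T *)
  (forall (C : catN N) (X : C), exists rhoP,
     eta C X = @Rep R N (End0 C) (hsp X) (@rho R N C (G C) X) rhoP) /\
  (forall (C : catN N) (X Y : C) (T : mor X Y),
     bopcast (cm_hsp (eta C) X) (cm_hsp (eta C) Y) (hmap (fmor (eta C) T)) =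
     hmap T) /\
  (* eps_A = rho^(id_A), inverse to Phi(id_(Mod A)) *)
  (forall (A : wobj N) (S : End0 (Mod0 A)),
     \val (eps A S) = @rho R N (Mod0 A) (G (Mod0 A)) (id_rep A) S) /\
  (forall A : wobj N,
     wmor_comp (eps A) (Phi (Mod0 A) A (cmor_id (Mod0 A))) = wmor_id (End0 (Mod0 A)) /\
     wmor_comp (Phi (Mod0 A) A (cmor_id (Mod0 A))) (eps A) = wmor_id A) /\
  (* Mod and End are contravariant functors of enriched categories *)
  @is_contra2functor (WStar N) (CatNN N) Mod0 (@Mod1 R N) /\
  @is_contra2functor (CatNN N) (WStar N) End0 End1 /\
  (* the Phi define an adjunction with unit eta; as a 1-cell A -> End(Mod A),
     the counit is the inverse of eps_A *)
  (exists eps_inv : forall A : wobj N, wmor A (End0 (Mod0 A)),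
     (forall A : wobj N, wmor_comp (eps A) (eps_inv A) = wmor_id (End0 (Mod0 A)) /\
                         wmor_comp (eps_inv A) (eps A) = wmor_id A) /\
     @is_contra2adjunction (CatNN N) (WStar N) End0 End1 Mod0 (@Mod1 R N)
       Phi eta eps_inv).
Proof.
exists (@Mod_is_catN R N).
exists (End1 G_sep), (Phi G), (@unit_mor R N G G_sep), (@counit_mor R N G G_sep).
split; first by move=> C X S T; exact: (rhoE (@G_sep C)).
split; first by [].
split; first by [].
split; first by move=> C A F; exact: Phi_rep_of.
split; first by [].
split; first by move=> C X; exists (rho_rep_ax G_sep (wmor_id (EndObj (G C))) X).
split; first by move=> C X Y T; exact: bopcast_id.
split; first by [].
split; first by move=> A; split; [exact: counit_invK|exact: counitK].
split; first exact: Mod_contra2functor.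
split; first exact: End_contra2functor.
exists (@counit_inv R N G); split.
  by move=> A; split; [exact: counit_invK|exact: counitK].
split.
- by move=> C A; exact: Phi_iso.
- by split; [exact: Phi_natural_cat|exact: Phi_natural_alg].
- by move=> C; exact: Phi_Psi_mor.
- by [].
- by split; [exact: unit_counit_Mod|exact: unit_counit_End].
Qed.
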